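(* Let $K_{1,n}$ ($n\ge2$) be the star-graph group described in the context, with Carnot–Carathéodory distance $d$ from $o$, and write $x=(x_1,x_* )\in\mathbb R\times\mathbb R^n$. Then: (1) For every $g\in K_{1,n}$, $d(g)^2=\sup_{\tau\in\Omega_*}\phi(g;\tau)$. (2) The cut locus of $o$ is $\mathrm{Cut}_o=\mathbb M^c=\Big\{((0,x_* ),t):\ |x_*\cdot t|\le\frac{|x_*|^2}{\sqrt\pi}\sqrt{\big|t-\langle t,\tfrac{x_*}{|x_*|}\rangle\tfrac{x_*}{|x_*|}\big|}\Big\}$, with the convention $\frac{x_*}{|x_*|}=0$ if $x_*=0$. Also $d(0,t)^2=4\pi|t|$, and for $((0,x_* ),t)\in\mathbb M^c$ with $x_*\neq0$, $$d((0,x_* ),t)^2=|x_*|^2+4\pi\Big|t-\langle t,\tfrac{x_*}{|x_*|}\rangle\tfrac{x_*}{|x_*|}\Big|.$$ (3) If $(x,t)=((x_1,x_* ),t)\in\mathbb M$, there is a unique $\theta\in\Omega_*$ with $$t=\frac14\nabla_\theta\big[f(|\theta|)x_1^2+\psi(|\theta|)\langle\theta,x_*\rangle^2\big]=\frac14\Big[\frac{f'(|\theta|)}{|\theta|}x_1^2\theta+\frac{\psi'(|\theta|)}{|\theta|}\langle\theta,x_*\rangle^2\theta+2\psi(|\theta|)\langle\theta,x_*\rangle x_*\Big],$$ and $$d(x,t)^2=\phi((x,t);\theta)=\Big(\frac{|\theta|}{\sin|\theta|}\Big)^2x_1^2+|x_*|^2+\Big[\Big(\frac{|\theta|}{\sin|\theta|}\Big)^2-1\Big]\Big(x_*\cdot\frac{\theta}{|\theta|}\Big)^2=\Big|\frac{U(\theta)}{\sin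 U(\theta)}x\Big|^2.$$
   Context: $K_{1,n}$ is the step-two group $\mathbb R^{n+1}\times\mathbb R^n$ with law $(x,t)\cdot(x',t')=(x+x',t+t'+\frac12\langle\mathbb Ux,x'\rangle)$, $\langle\mathbb Ux,x'\rangle=(\langle U^{(j)}x,x'\rangle)_{j=1}^n$, where $\sum_j\tau_jU^{(j)}=\begin{pmatrix}0&\tau^T\\-\tau&\mathbb O_{n\times n}\end{pmatrix}$ for $\tau\in\mathbb R^n$ (column vector); identity $o$. $d(g)$ is the Carnot–Carathéodory distance from $o$ (infimum of $\int_0^1|x'|$ over absolutely continuous curves from $o$ to $g$ with $t'=\frac12\langle\mathbb Ux,x'\rangle$). $U(\tau)=i\sum_j\tau_jU^{(j)}$, $\Omega_*=\{\tau:\|U(\tau)\|<\pi\}=B_{\mathbb R^n}(0,\pi)$, $f(s)=1-s\cot s$, $\psi(s)=f(s)/s^2$ (with $\psi(0)=1/3$), and $\phi((x,t);\tau)=\langle U(\tau)\cot U(\tau)x,x\rangle+4t\cdot\tau=|x|^2+4t\cdot\tau-[x_1^2f(|\tau|)+\langle\tau,x_*\rangle^2\psi(|\tau|)]$. $\mathbb M$ is the set of $g$ such that $\phi(g;\cdot)$ has a nondegenerate critical point in $\Omega_*$. $\mathrm{Cut}_o$ is the complement of $\{g:d^2$ is $C^\infty$ near $g\}$. Convention $|\theta|/\sin|\theta|=1$ at $\theta=0$. *)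

(* Defs.v *)
From HB Require Import structures.
From mathcomp Require Import all_boot all_order all_algebra.
From mathcomp Require Import all_classical all_reals all_analysis.
Set Implicit Arguments. Unset Strict Implicit. Unset Printing Implicit Defensive.
Import Order.TTheory GRing.Theory Num.Theory.
Import numFieldNormedType.Exports.
Local Open Scope classical_set_scope.
Local Open Scope ring_scope.

Section K1n.
Variables (R : realType) (n : nat).

Definition dot {m} (u v : 'rV[R]_m) : R := \sum_(i < m) u 0 i * v 0 i.
Definition enorm {m} (u : 'rV[R]_m) : R := Num.sqrt (dot u u).
Definition unitv {m} (u : 'rV[R]_m) : 'rV[R]_m :=
  if u == 0 then 0 else (enorm u)^-1 *: u.
(* the row-vector realization of "M x" for a column vector x *)
Definition mxapp {m} (M : 'M[R]_m) (x : 'rV[R]_m) : 'rV[R]_m := x *m M^T.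
Definition evec {m} (i : 'I_m) : 'rV[R]_m := delta_mx 0 i.

Definition pt := 'rV[R]_(n.+1 + n).
Definition xof (g : pt) : 'rV[R]_n.+1 := lsubmx g.
Definition tof (g : pt) : 'rV[R]_n := rsubmx g.
Definition x1 (x : 'rV[R]_n.+1) : R := x 0 ord0.
Definition xstar (x : 'rV[R]_n.+1) : 'rV[R]_n := \row_(i < n) x 0 (lift ord0 i).

(* U^{(j)}: sum_j tau_j U^{(j)} = [[0, tau^T], [-tau, 0]] *)
Definition Umat (j : 'I_n) : 'M[R]_n.+1 :=
  \matrix_(a, b) (((a == ord0) && (b == lift ord0 j))%:R
                  - ((a == lift ord0 j) && (b == ord0))%:R).
(* sum_j tau_j U^{(j)}  (so that U(tau) = i * Asum tau) *)
Definition Asum (tau : 'rV[R]_n) : 'M[R]_n.+1 := \sum_(j < n) tau 0 j *: Umat j.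

Definition abs_cont (a b : R) (f : R -> R) : Prop :=
  forall eps : R, 0 < eps -> exists2 delta : R, 0 < delta &
    forall (m : nat) (l r : 'I_m -> R),
      (forall k, a <= l k /\ l k <= r k /\ r k <= b) ->
      (forall k k', k != k' -> r k <= l k' \/ r k' <= l k) ->
      \sum_(k < m) (r k - l k) < delta ->
      \sum_(k < m) `|f (r k) - f (l k)| < eps.

Definition dx (x : R -> 'rV[R]_n.+1) (s : R) : 'rV[R]_n.+1 :=
  \row_i derive1 (fun u => x u 0 i) s.

Definition horizontal_curve (g : pt) (x : R -> 'rV[R]_n.+1) (t : R -> 'rV[R]_n) : Prop :=
  [/\ (forall i, abs_cont 0 1 (fun s => x s 0 i)),
      (forall j, abs_cont 0 1 (fun s => t s 0 j)),
      x 0 = 0 /\ t 0 = 0,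
      x 1 = xof g /\ t 1 = tof g &
      {ae (@lebesgue_measure R), forall s, `[0, 1]%classic s ->
         (forall i, derivable (fun u => x u 0 i) s 1) /\
         (forall j, derivable (fun u => t u 0 j) s 1 /\
            derive1 (fun u => t u 0 j) s = 2^-1 * dot (mxapp (Umat j) (x s)) (dx x s))}].

Definition ccdistE (g : pt) : \bar R :=
  ereal_inf [set L | exists x t, horizontal_curve g x t /\
     L = (\int[@lebesgue_measure R]_(s in `[0%R, 1%R]%classic) (enorm (dx x s))%:E)%E].
Definition ccdist (g : pt) : R := fine (ccdistE g).

Definition cot (s : R) : R := cos s / sin s.
Definition fK (s : R) : R := if s == 0 then 0 else 1 - s * cot s.
Definition psiK (s : R) : R := if s == 0 then 3^-1 else fK s / s ^+ 2.
Definition ssin (s : R) : R := if s == 0 then 1 else s / sin s.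

Definition Omega (tau : 'rV[R]_n) : Prop := enorm tau < pi.

Definition phi (g : pt) (tau : 'rV[R]_n) : R :=
  let x := xof g in
  dot x x + 4 * dot (tof g) tau
  - (x1 x ^+ 2 * fK (enorm tau) + dot tau (xstar x) ^+ 2 * psiK (enorm tau)).

Definition Mset : set pt := [set g | exists tau, [/\ Omega tau,
   (forall i, derivable (phi g) tau (evec i) /\ 'D_(evec i) (phi g) tau = 0),
   (forall i j, derivable ('D_(evec j) (phi g)) tau (evec i)) &
   \det (\matrix_(i, j) 'D_(evec i) ('D_(evec j) (phi g)) tau) != 0]].

Fixpoint iterD (F : pt -> R) (vs : seq pt) : pt -> R :=
  if vs is v :: vs' then 'D_v (iterD F vs') else F.
Definition smooth_near (F : pt -> R) (g : pt) : Prop :=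
  exists U : set pt, [/\ open U, U g &
    forall vs : seq pt,
      (forall v p, U p -> derivable (iterD F vs) p v) /\
      (forall p, U p -> {for p, continuous (iterD F vs)})].

Definition Cut : set pt := ~` [set g | smooth_near (fun p => ccdist p ^+ 2) g].

Definition explicit_set : set pt := [set g |
  let xs := xstar (xof g) in let t := tof g in
  x1 (xof g) = 0 /\
  `|dot xs t| <= enorm xs ^+ 2 / Num.sqrt pi
                 * Num.sqrt (enorm (t - dot t (unitv xs) *: unitv xs))].

Definition Gfun (x : 'rV[R]_n.+1) (th : 'rV[R]_n) : R :=
  fK (enorm th) * x1 x ^+ 2 + psiK (enorm th) * dot th (xstar x) ^+ 2.

(* U(theta)/sin U(theta): U(theta) = i Asum theta is Hermitian with norm < pi;
   s/sin s = sum_k c_k s^(2k) (an even function), c_k = ssin^(2k)(0)/(2k)!,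
   and U(theta)^2 = - (Asum theta)^2 is a real matrix. *)
Definition ssin_coef (k : nat) : R := derive1n k.*2 ssin 0 / (k.*2)`!%:R.
Definition UsinU (th : 'rV[R]_n) : 'M[R]_n.+1 :=
  lim ((fun N => \sum_(k < N) ssin_coef k *: (- (Asum th ^+ 2)) ^+ k) @ \oo).

End K1n.

(* Main.v *)
Require Import Defs.
From HB Require Import structures.
From mathcomp Require Import all_boot all_order all_algebra.
From mathcomp Require Import all_classical all_reals all_analysis measurable_realfun.
From mathcomp Require Import ring lra zify.
Set Implicit Arguments. Unset Strict Implicit. Unset Printing Implicit Defensive.
Import Order.TTheory GRing.Theory Num.Theory.
Import numFieldNormedType.Exports.
Local Open Scope classical_set_scope.
Local Open Scope ring_scope.

(** Lower bound.  Let [c = |tau| < pi].  Along a horizontal curve parametrized on [0, 1] by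
    (a perturbation of) arc length, the quadratic form of [k = c cot (c s)] on
    span(e_0, tau), of [1 / s] on its orthogonal complement, plus [4 t . tau], is a
    calibration: [k] solves the Riccati equation [k' = - (k ^ 2 + c ^ 2)].  At the endpoint
    it takes the value [phi g tau], so [phi g tau <= d(g) ^ 2].

    Upper bound.  With [P (s ^ 2) = (1 - s cot s) / s ^ 2], a power series with nonnegative
    coefficients in [s ^ 2] by comparison of the Riccati equation [2 r P' + 3 P = 1 + r P ^ 2]
    with its truncations, one has
    [phi g tau = |x| ^ 2 + 4 t . tau - (x1 ^ 2 |tau| ^ 2 + (tau . xs) ^ 2) P (|tau| ^ 2)].
    At a critical point [theta] of [phi g] in the ball, an explicit helix from the identity
    to [g] has length [sqrt (phi g theta)], so equality holds.  The Hessian at [theta] is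
    negative definite unless [x1 = 0] and [theta . xs = 0]; when such a critical point
    does not exist, [phi g] has its supremum at the boundary of the ball, reached by helices
    with [|theta| = pi], and [g] lies in the explicit set.

    Cut locus.  On [Mset] the critical point [theta] is unique and stable, hence a continuous
    function of [g]; the mean value theorem applied to [d phi (g, theta g) = 0] yields its
    derivative, and [d ^ 2] is a smooth expression in [g] and [theta g].  At a generic point
    of the explicit set, [d (g + u e_0) ^ 2 <= d(g) ^ 2 + u ^ 2 - c |u|] with [c > 0], which
    excludes differentiability; such points are dense in the explicit set. *)

(** Competing curves are only absolutely continuous, so the calibration is not integrated
    classically. It enters through monotonicity: an absolutely continuous function whose derivative
    is nonnegative almost everywhere does not decrease from one end to the other. Its coefficients
    blow up at s = 0; the perturbation of arc length starts the parameter at a positive value and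
    costs an eps in the length. The Riccati equation of the cotangent serves three times: it makes
    the calibration monotone, it generates the coefficients of the series of psi together with their
    sign, and it reduces the strict concavity of s |-> 1 / psi(s) to a first-zero argument. This
    concavity is what definiteness of the Hessian requires in the radial direction. The constant in
    the explicit set comes from the simple pole of psi at pi: psi(s) is bounded below by 1 / (pi (pi
    - s)), and the reflection s |-> pi - s gives the matching upper bound. [smooth_near] asks for
    all iterated directional derivatives, so smoothness is read off a class of functions closed
    under differentiation. *)

(** * Absolutely continuous functions on [0, 1] *)

Section AbsCont.
Variable R : realType.
Implicit Types f g F : R -> R.

(** Cousin's lemma as an induction principle: every short enough interval around a tag x is a legal
    step. At the supremum of the reached points such a step leads from a reached point beyond the
    supremum, unless it arrives at 1. *)
Lemma cousin_induction (Q : R -> Prop) (step : R -> R -> Prop) :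
  (forall x, 0 <= x <= 1 -> exists2 eta : R, 0 < eta & forall a b,
     0 <= a -> a <= x -> x <= b -> b <= 1 -> x - eta < a -> b < x + eta ->
     step a b) ->
  Q 0 -> (forall a b, 0 <= a -> a <= b -> b <= 1 -> Q a -> step a b -> Q b) ->
  Q 1.
Proof.
move=> loc Q0 Qstep.
pose S := [set c : R | 0 <= c <= 1 /\ Q c].
have S0 : S 0 by split=> //; rewrite lexx ler01.
have ubS : ubound S 1 by move=> c [/andP[]].
have supS : has_sup S by split; [exists 0|exists 1].
have c01 : 0 <= sup S <= 1.
  by rewrite (ub_le_sup _ S0) ?ge_sup//=; [exists 0|exists 1].
set c := sup S in c01; have /andP[c0 c1] := c01.
have [eta eta0 st] := loc _ c01.
have [a [/andP[a0 a1] Qa] ca] := sup_adherent eta0 supS.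
have ac : a <= c by apply: ub_le_sup => //; [exists 1|split=> //; rewrite a0].
have [ce|ce] := leP 1 (c + eta / 2).
  apply: (Qstep a) => //; apply: st => //.
  by apply: le_lt_trans ce _; rewrite ltrD2l; lra.
have Sc : S (c + eta / 2).
  split; first by rewrite (ltW ce) andbT addr_ge0 // divr_ge0 // ltW.
  apply: (Qstep a) => //; [lra|exact: ltW|].
  by apply: st => //; [lra|exact: ltW|rewrite ltrD2l; lra].
have := ub_le_sup (ex_intro _ 1 ubS) Sc; rewrite -/c; lra.
Qed.

(* A finite family of nonoverlapping intervals, listed from right to left. *)
Definition nonoverlapping (s : seq (R * R)) :=
  pairwise (fun p q => q.2 <= p.1) s.

(** Lists can be extended by one interval at a time, which is the form needed in inductions along
    [0, 1]. *)
Lemma abs_cont_seq F : abs_cont 0 1 F -> forall eps : R, 0 < eps ->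
  exists2 delta : R, 0 < delta & forall s : seq (R * R), nonoverlapping s ->
    all (fun p => [&& 0 <= p.1, p.1 <= p.2 & p.2 <= 1]) s ->
    \sum_(p <- s) (p.2 - p.1) < delta ->
    \sum_(p <- s) `|F p.2 - F p.1| < eps.
Proof.
move=> acF eps eps0; have [delta delta0 H] := acF _ eps0.
exists delta => // s no al; rewrite !(big_nth (0, 0)) !big_mkord => sd.
have nthP (k : 'I_(size s)) := all_nthP (0, 0) al k (ltn_ord k).
apply: (H _ (fun k => (nth (0, 0) s k).1) (fun k => (nth (0, 0) s k).2)) => //.
- by move=> k; have /and3P[? ? ?] := nthP k.
- move=> k k' kk'; have /(pairwiseP (0, 0)) P := no.
  case: (ltngtP k k') => [lt|lt|e].
  + by right; apply: (P k k') => //; rewrite inE.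
  + by left; apply: (P k' k) => //; rewrite inE.
  + by move: kk'; rewrite (val_inj e) eqxx.
Qed.

(** On an interval shorter than the delta belonging to eps = 1 the function varies by less than 1,
    so each step of the induction raises the bound by 1. *)
Lemma abs_cont_bounded f : abs_cont 0 1 f ->
  exists2 K, 0 <= K & forall s, 0 <= s <= 1 -> `|f s| <= K.
Proof.
move=> /abs_cont_seq /(_ _ ltr01)[d d0 H].
suff: exists2 K, 0 <= K & forall s, 0 <= s -> s <= 1 -> `|f s| <= K.
  by move=> [K K0 fK]; exists K => // s /andP[]; exact: fK.
apply: (@cousin_induction (fun c => exists2 K, 0 <= K &
   forall s, 0 <= s -> s <= c -> `|f s| <= K) (fun a b => b - a < d)).
- by move=> x x01; exists (d / 2) => [|a b *]; lra.
- exists `|f 0| => // s s0 s0'; have -> : s = 0 by lra.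
  by [].
- move=> a b a0 ab b1 [K K0 Kf] bad; exists (K + 1) => [|s s0 sb]; first lra.
  have [sa|as_] := leP s a.
    by rewrite (le_trans (Kf _ s0 sa)) // lerDl.
  have := H [:: (a, s)] isT; rewrite !big_seq1 /= a0 (ltW as_) (le_trans sb b1).
  move=> /(_ isT) h; have {}h : `|f s - f a| < 1 by apply: h; lra.
  have fa := Kf _ a0 (lexx a).
  rewrite -[f s](subrK (f a)) (le_trans (ler_normD _ _)) //.
  by rewrite addrC lerD // ltW.
Qed.

(** Common source of the closure properties below: only the increments of F have to be compared with
    those of f and g. *)
Lemma abs_cont_dom f g F (C : R) : abs_cont 0 1 f -> abs_cont 0 1 g ->
  (forall u v, 0 <= u -> u <= v -> v <= 1 ->
     `|F v - F u| <= C * (`|f v - f u| + `|g v - g u|)) ->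
  abs_cont 0 1 F.
Proof.
move=> acf acg dom eps eps0.
pose K := `|C| + 1; have K0 : 0 < K by rewrite ltr_wpDl.
have e0 : 0 < eps / K / 2 by rewrite !divr_gt0.
have [d1 d10 H1] := acf _ e0; have [d2 d20 H2] := acg _ e0.
exists (Num.min d1 d2) => [|m l r lr no]; first by rewrite lt_min d10.
rewrite lt_min => /andP[s1 s2].
apply: (@le_lt_trans _ _ (\sum_(k < m)
   K * (`|f (r k) - f (l k)| + `|g (r k) - g (l k)|))).
  apply: ler_sum => k _; have [? [? ?]] := lr k.
  apply: (le_trans (dom _ _ _ _ _)) => //.
  rewrite ler_wpM2r ?addr_ge0 // (le_trans (ler_norm _)) // lerDl //.
rewrite -mulr_sumr big_split /= mulrC -ltr_pdivlMr //.
have := H1 _ _ _ lr no s1; have := H2 _ _ _ lr no s2; lra.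
Qed.

Lemma abs_contD f g : abs_cont 0 1 f -> abs_cont 0 1 g ->
  abs_cont 0 1 (fun s => f s + g s).
Proof.
move=> acf acg; apply: (abs_cont_dom (C := 1) acf acg) => u v *.
by rewrite mul1r (le_trans _ (ler_normD _ _)) // opprD addrACA.
Qed.

Lemma abs_contM f g : abs_cont 0 1 f -> abs_cont 0 1 g ->
  abs_cont 0 1 (fun s => f s * g s).
Proof.
move=> acf acg; have [K K0 Kf] := abs_cont_bounded acf.
have [K' K'0 Kg] := abs_cont_bounded acg.
apply: (abs_cont_dom (C := K + K') acf acg) => u v u0 uv v1.
have -> : f v * g v - f u * g u = f v * (g v - g u) + (f v - f u) * g u.
  by ring.
have fv : `|f v| <= K by apply: Kf; rewrite v1 (le_trans u0).
have gu : `|g u| <= K' by apply: Kg; rewrite u0 (le_trans uv).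
rewrite (le_trans (ler_normD _ _)) // !normrM mulrDr !mulrDl.
have := normr_ge0 (f v - f u); have := normr_ge0 (g v - g u).
move: `|f v| `|g u| `|g v - g u| `|f v - f u| fv gu => a b c d; nra.
Qed.

Lemma abs_cont_cst (k : R) : abs_cont 0 1 (fun=> k).
Proof.
move=> eps eps0; exists 1 => // m l r _ _ _.
by rewrite big1 // => i _; rewrite subrr normr0.
Qed.

Lemma abs_cont_sum (I : Type) (r : seq I) (h : I -> R -> R) :
  (forall i, abs_cont 0 1 (h i)) -> abs_cont 0 1 (fun s => \sum_(i <- r) h i s).
Proof.
move=> ach; elim: r => [|i r ih].
  under eq_fun do rewrite big_nil; exact: abs_cont_cst.
under eq_fun do rewrite big_cons.
exact: (abs_contD (ach i) ih).
Qed.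

Lemma abs_cont_lipschitz_comp f (h : R -> R) (C : R) : abs_cont 0 1 f ->
  (forall u v, 0 <= u <= 1 -> 0 <= v <= 1 ->
     `|h (f v) - h (f u)| <= C * `|f v - f u|) ->
  abs_cont 0 1 (h \o f).
Proof.
move=> acf lip; apply: (abs_cont_dom (C := C) acf (abs_cont_cst 0)).
move=> u v u0 uv v1; rewrite subrr normr0 addr0; apply: lip.
  by rewrite u0 (le_trans uv).
by rewrite v1 (le_trans u0).
Qed.

Lemma abs_cont_id : abs_cont 0 1 (@id R).
Proof.
move=> eps eps0; exists eps => // m l r lr no.
apply: le_lt_trans; apply: ler_sum => i _.
by have [_ [? _]] := lr i; rewrite ger0_norm // subr_ge0.
Qed.

Lemma lipschitz_on_of_derive (h dh : R -> R) (p q : R) : p <= q ->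
  (forall u, p <= u <= q -> is_derive u 1 h (dh u)) ->
  {within `[p, q], continuous dh} ->
  exists C : R, forall u v, p <= u <= q -> p <= v <= q ->
    `|h v - h u| <= C * `|v - u|.
Proof.
move=> pq dhP cdh.
have [cM cMpq dM] := EVT_max pq cdh; have [cm cmpq dm] := EVT_min pq cdh.
pose C := `|dh cM| + `|dh cm|.
have dC u : p <= u <= q -> `|dh u| <= C.
  move=> upq; have uI : u \in `[p, q] by rewrite in_itv.
  have := dM _ uI; have := dm _ uI.
  move=> h1 h2; have := ler_norm (dh cM); have := ler_norm (- dh cm).
  have := normr_ge0 (dh cM); have := normr_ge0 (dh cm).
  by rewrite normrN ler_norml /C; lra.
exists C.
suff main u v : p <= u -> u <= v -> v <= q -> `|h v - h u| <= C * `|v - u|.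
  move=> u v /andP[pu uq] /andP[pv vq]; have [uv|vu] := leP u v; first exact: main.
  by rewrite distrC (distrC v); apply: main => //; exact: ltW.
move=> pu uv vq; have [||x xuv ->] := @MVT_segment _ h dh u v uv.
- move=> x; rewrite in_itv /= => /andP[ux xv]; apply: dhP; lra.
- apply: derivable_within_continuous => x; rewrite in_itv /= => /andP[ux xv].
  by have [] : is_derive x 1 h (dh x) by apply: dhP; lra.
- by rewrite normrM ler_wpM2r // dC //; move: xuv; rewrite in_itv /= => /andP[]; lra.
Qed.

(** Composition with a function that is C^1 merely on an interval containing the range of f, as is
    the case for u |-> 1 / u and for scaled cotangents away from 0. *)
Lemma abs_cont_comp_derive f (h dh : R -> R) (p q : R) : p <= q ->
  abs_cont 0 1 f -> (forall s, 0 <= s <= 1 -> p <= f s <= q) ->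
  (forall u, p <= u <= q -> is_derive u 1 h (dh u)) ->
  (forall u, p <= u <= q -> {for u, continuous dh}) ->
  abs_cont 0 1 (h \o f).
Proof.
move=> pq acf fpq dhP cdh.
have cw : {within `[p, q], continuous dh}.
  apply: continuous_in_subspaceT => u; rewrite inE /= in_itv /=; exact: cdh.
have [C hC] := lipschitz_on_of_derive pq dhP cw.
by apply: (abs_cont_lipschitz_comp (C := C) acf) => u v u01 v01; apply: hC; apply: fpq.
Qed.

End AbsCont.

(** * Monotonicity from an almost everywhere derivative *)

Section AlmostEverywhere.
Variable R : realType.
Notation mu := (@lebesgue_measure R).
Implicit Types f g F : R -> R.

Lemma is_derive_dist F (x l : R) : is_derive x 1 F l -> forall eps : R, 0 < eps ->
  exists2 eta : R, 0 < eta &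
    forall h, `|h| < eta -> `|F (x + h) - F x - l * h| <= eps * `|h|.
Proof.
move=> [dF <-] eps eps0.
have /cvgrPdist_le /(_ _ eps0) := dF.
rewrite -[lim _]/('D_1 F x) => -[/= eta eta0 H]; exists eta => // h heta.
have [->|h0] := eqVneq h 0; first by rewrite addr0 subrr mulr0 subr0 normr0 mulr0.
have := H h; rewrite /ball_/= sub0r normrN => /(_ heta h0).
rewrite [h *: _]mulr1 => Hh.
have -> : F (x + h) - F x - 'D_1 F x * h =
    - (h * ('D_1 F x - h^-1 * (F (h + x) - F x))).
  by rewrite mulrBr mulrA divff // mul1r opprB (addrC h x) (mulrC h).
by rewrite normrN normrM mulrC ler_wpM2r.
Qed.

(** The bad null set is covered by an open O of measure below the delta of absolute continuity.
    Walking from 0 to 1, a step around a good point loses at most eps / 2 times its length, while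
    the steps inside O lose at most eps / 2 altogether. *)
Lemma le_of_abs_cont_derive_ge0 F : abs_cont 0 1 F ->
  {ae mu, forall s, `[0, 1]%classic s -> derivable F s 1 /\ 0 <= derive1 F s} ->
  F 0 <= F 1.
Proof.
move=> /abs_cont_seq acF [B [mB B0 sB]].
suff H (eps : R) : 0 < eps -> F 0 - eps <= F 1.
  apply/ler_addgt0Pr => eps eps0; rewrite -lerBlDr; exact: H.
move=> eps0; have e20 : 0 < eps / 2 by rewrite divr_gt0.
have [d d0 acFd] := acF _ e20.
have [|O [oO BO OB]] := lebesgue_regularity_outer mB _ d0.
  by rewrite [X in (X < _)%E]B0.
have mO : measurable O by exact: measurable_realfun.open_measurable.
have Od : (mu O < d%:E)%E.
  have -> : O = (O `\` B) `|` B by rewrite setUC setDUK.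
  apply: (le_lt_trans (measureU2 _ _ _)) => //; first exact: measurableD.
  by rewrite [X in (_ + X)%E]B0 adde0.
pose ok (p : R * R) := [&& 0 <= p.1, p.1 <= p.2 & p.2 <= 1].
(* The list records the steps made inside O. Comparing their total length with the measure of the
   part of O to the left of c keeps the invariant stable under further steps. *)
pose Q c := exists s : seq (R * R), [/\ nonoverlapping s, all ok s,
  all (fun p => p.2 <= c) s,
  ((\sum_(p <- s) (p.2 - p.1))%:E <= mu (O `&` `]-oo, c]))%E &
  F 0 - eps / 2 * c - \sum_(p <- s) `|F p.2 - F p.1| <= F c].
have [s [no al _ sO]] : Q 1.
  apply: (@cousin_induction _ Q (fun a b =>
      F a - eps / 2 * (b - a) <= F b \/ `[a, b] `<=` O)).
  - move=> x x01; have [Ox|nOx] := pselect (O x).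
      have /nbhs_ballP[eta /= eta0 sub] := oO _ Ox.
      exists eta => // a b a0 ax xb b1 etaa etab; right => y /=.
      rewrite in_itv /= => /andP[ay yb]; apply: sub.
      by rewrite /ball/= ltr_norml; apply/andP; split; lra.
    have [dF F0] : derivable F x 1 /\ 0 <= derive1 F x.
      apply: contrapT => nP; apply/nOx/BO/sB => /= K; apply: nP.
      by apply: K; rewrite in_itv.
    have isd : is_derive x 1 F (derive1 F x) by rewrite derive1E; exact: derivableP.
    have [eta eta0 H] := is_derive_dist isd e20.
    exists eta => // a b a0 ax xb b1 etaa etab; left.
    (* Straddling: since a <= x <= b, the errors at the two ends add up to eps / 2 times b - a. *)
    have /(_ _)/ler_normlP := H (a - x); rewrite ler0_norm ?subr_le0 //.
    have /(_ _)/ler_normlP := H (b - x); rewrite ger0_norm ?subr_ge0 //.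
    rewrite !(addrC x) !subrK => Hb Ha.
    have [|_ {}Ha] := Ha; first lra.
    have [|{}Hb _] := Hb; first lra.
    have : derive1 F x * (a - x) <= 0 by rewrite mulr_ge0_le0 // subr_le0.
    have : 0 <= derive1 F x * (b - x) by rewrite mulr_ge0 // subr_ge0.
    lra.
  - exists [::]; split => //; rewrite ?big_nil ?measure_ge0 //; lra.
  - move=> a b a0 ab b1 [s [no al sa sO Fa]] st.
    have le_mu : (mu (O `&` `]-oo, a]) <= mu (O `&` `]-oo, b]))%E.
      apply: le_measure; rewrite ?inE; [exact: measurableI|exact: measurableI|].
      by apply: setIS; apply: subset_itvl; rewrite bnd_simp.
    have sb : all (fun p : R * R => p.2 <= b) s.
      by apply: sub_all sa => p /= /le_trans; apply.
    case: st => [st|st].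
      exists s; split => //; first exact: le_trans le_mu.
      by move: Fa st; set S := \sum_(p <- s) _; lra.
    exists ((a, b) :: s); rewrite /nonoverlapping /= !big_cons /= lexx sb sa al /=.
    split => //; first by rewrite /ok /= a0 ab b1.
      have -> : O `&` `]-oo, b] = (O `&` `]-oo, a]) `|` `]a, b].
        apply/seteqP; split => y /=; rewrite !in_itv /=.
          by move=> [Oy yb]; have [ya|ay] := leP y a; [left|right].
        move=> [[Oy ya]|/andP[ay yb]]; first by split=> //; exact: le_trans ab.
        by split=> //; apply: st; rewrite /= in_itv /= (ltW ay).
      rewrite measureU //; [|exact: measurableI|].
        rewrite addrC EFinD; apply: leeD => //.
        rewrite [leRHS](_ : _ = (b - a)%:E) //.
        rewrite [LHS]lebesgue_measure_itv /= lte_fin EFinB; case: ltP => // ba.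
        have -> : b = a by apply/le_anti/andP.
        by rewrite subee.
      rewrite -subset0 => y /=; rewrite !in_itv /= => -[[_ ya] /andP[ay _]].
      by move: (lt_le_trans ay ya); rewrite ltxx.
    have : F b - F a <= `|F b - F a| by exact: ler_norm.
    have : F a - F b <= `|F b - F a| by rewrite distrC; exact: ler_norm.
    have : 0 <= eps / 2 * (b - a) by rewrite mulr_ge0 ?subr_ge0 // ltW.
    by move: Fa; set S := \sum_(p <- s) _; lra.
have := acFd _ no al; set V := \sum_(p <- s) `|_| => VE F1.
suff : V < eps / 2 by lra.
apply: VE; rewrite -lte_fin (le_lt_trans sO) //.
apply: le_lt_trans Od; apply: le_measure; rewrite ?inE //; exact: measurableI.
Qed.

End AlmostEverywhere.

(** * Arc length as the primitive of an integrable speed *)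

Section ArcLength.
Variable R : realType.
Notation mu := (@lebesgue_measure R).
Variable G : R -> R.
Hypothesis G0 : forall s, 0 <= G s.
Hypothesis intG : mu.-integrable setT (EFin \o G).

Definition primitive0 (s : R) : R := (\int[mu]_(u in `[0%R, s]) G u)%R.

Let intGA (A : set R) : measurable A -> mu.-integrable A (EFin \o G).
Proof. by move=> mA; apply: integrableS intG. Qed.

Let EFin_int (A : set R) : measurable A ->
  (\int[mu]_(u in A) G u)%R%:E = (\int[mu]_(u in A) (G u)%:E)%E.
Proof. by move=> mA; rewrite /Rintegral fineK //; exact: integrable_fin_num (intGA mA). Qed.

Lemma primitive0B (l r : R) : 0 <= l -> l <= r ->
  primitive0 r - primitive0 l = (\int[mu]_(u in `]l, r]) G u)%R.
Proof.
move=> l0 lr; rewrite /primitive0 Rintegral_itvB ?bnd_simp //.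
exact: intGA.
Qed.

Lemma primitive0_le (l r : R) : 0 <= l -> l <= r -> primitive0 l <= primitive0 r.
Proof.
by move=> l0 lr; rewrite -subr_ge0 primitive0B // Rintegral_ge0.
Qed.

Lemma primitive0_0 : primitive0 0 = 0.
Proof. by rewrite /primitive0 set_itv1 Rintegral_set1. Qed.

(** Increments over nonoverlapping intervals add up to the integral over the disjoint union of the
    half-open intervals, which is small by absolute continuity of the integral. *)
Lemma abs_cont_primitive0 : abs_cont 0 1 primitive0.
Proof.
move=> eps eps0; have [d [d0 H]] := integral_normr_continuous intG eps0.
exists d => // m l r lr no sd.
pose F (k : 'I_m) : set R := `]l k, r k]%classic.
pose D := \big[setU/set0]_(k < m) F k.
have mF k : measurable (F k) by exact: measurable_itv.
have mD : measurable D by apply: bigsetU_measurable => k _; exact: mF.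
have tF i j : F i `&` F j !=set0 -> i = j.
  move=> [y []]; rewrite /F /= !in_itv /= => /andP[ly yr] /andP[ly' yr'].
  apply/eqP/negPn/negP => ij; have [h|h] := no _ _ ij.
    by have := lt_le_trans ly' (le_trans yr h); rewrite ltxx.
  by have := lt_le_trans ly (le_trans yr' h); rewrite ltxx.
have us : uniq (index_enum 'I_m) by exact: index_enum_uniq.
have muF k : (mu (F k) = (r k - l k)%:E)%E.
  have [_ [lrk _]] := lr k.
  rewrite [LHS]lebesgue_measure_itv /= lte_fin EFinB; case: ltP => // rl.
  have -> : l k = r k by apply/le_anti/andP.
  by rewrite subee.
have muD : (mu D < d%:E)%E.
  rewrite /D measure_bigsetU_ord //; last by move=> i j _ _; exact: tF.
  by rewrite (eq_bigr (fun k => (r k - l k)%:E)) => [|k _]; [rewrite sumEFin lte_fin|exact: muF].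
rewrite (_ : \sum_(k < m) _ = (\int[mu]_(x in D) `|G x|)%R); first exact: H.
have -> : (\int[mu]_(x in D) `|G x|)%R = (\int[mu]_(x in D) G x)%R.
  by apply: eq_Rintegral => x _; rewrite ger0_norm.
apply: EFin_inj; rewrite EFin_int // ge0_integral_bigsetU //; last 3 first.
- by move=> i j _ _; exact: tF.
- by apply/measurable_int; exact: intGA.
- by move=> x _; rewrite lee_fin.
rewrite -sumEFin; apply: eq_bigr => k _; have [l0 [lrk _]] := lr k.
by rewrite primitive0B // ger0_norm ?Rintegral_ge0 // EFin_int.
Qed.

Lemma derive_primitive0 : {ae mu, forall s : R, 0 < s -> is_derive s (1 : R) primitive0 (G s)}.
Proof.
have lG : locally_integrable setT G by apply: open_integrable_locally => //; exact: openT.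
have /(_ (BLeft 0)) := @FTC1 R G _ _ lG.
move=> /(_ (fun y => intGA (measurable_itv _))).
apply: filterS; first exact: (ae_filter_ringOfSetsType mu).
move=> s H s0.
have [d <-] : derivable primitive0 s 1 /\ derive1 primitive0 s = G s.
  by apply: H; rewrite lte_fin.
by rewrite derive1E; exact: derivableP.
Qed.

End ArcLength.

(** * An integrable version of the speed of a curve *)

Section Speed.
Variable R : realType.
Notation mu := (@lebesgue_measure R).

(** Composing with the clamp extends a function on [0, 1] by constants, so that [abs_cont 0 1],
    silent outside [0, 1], yields a continuous function on the line. *)
Definition clamp01 (s : R) : R := Num.max 0 (Num.min s 1).

Lemma clamp01_itv s : 0 <= clamp01 s <= 1.
Proof.
by rewrite /clamp01 le_max lexx /= ge_max ler01 ge_min lexx orbT.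
Qed.

Lemma clamp01_id s : 0 <= s <= 1 -> clamp01 s = s.
Proof. by move=> /andP[s0 s1]; rewrite /clamp01 (min_idPl s1) (max_idPr s0). Qed.

Lemma clamp01_dist s t : `|clamp01 s - clamp01 t| <= `|s - t|.
Proof.
have h1 := ler_norm (s - t); have h2 := ler_norm (t - s); rewrite distrC in h2.
have h0 := normr_ge0 (s - t); rewrite /clamp01 ler_norml !maxEle !minEle.
by case: (leP s 1) => ?; case: (leP t 1) => ?; rewrite ?ler01;
  case: (leP 0 s) => ?; case: (leP 0 t) => ?; apply/andP; split; lra.
Qed.

Lemma abs_cont_continuous (f : R -> R) : abs_cont 0 1 f -> continuous (f \o clamp01).
Proof.
move=> acf s; apply/cvgrPdist_lt => e e0.
have [d d0 H] := abs_cont_seq acf e0.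
exists d => //= t std.
have {}H u v : 0 <= u <= 1 -> 0 <= v <= 1 -> u <= v -> `|v - u| < d -> `|f v - f u| < e.
  move=> /andP[u0 u1] /andP[v0 v1] uv; rewrite ger0_norm ?subr_ge0 // => vud.
  by have := H [:: (u, v)] isT; rewrite !big_seq1 /= u0 uv v1; apply.
have dd := le_lt_trans (clamp01_dist s t) std.
have [le|/ltW le] := leP (clamp01 t) (clamp01 s).
  by apply: H => //; exact: clamp01_itv.
by rewrite distrC; apply: H; rewrite ?clamp01_itv // distrC.
Qed.

(** The derivative is a pointwise limit of difference quotients with steps 1 / (m + 1), taken for
    the continuous clamped extension; near a point of ]0, 1[ the clamp is eventually invisible. *)
Lemma measurable_derive1 (f : R -> R) (D : set R) : measurable D -> abs_cont 0 1 f ->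
  (forall s, D s -> 0 < s < 1 /\ derivable f s 1) -> measurable_fun D (derive1 f).
Proof.
move=> mD acf DP.
pose g := f \o clamp01; have cg := abs_cont_continuous acf.
pose h (m : nat) s : R := m.+1%:R * (g (s + m.+1%:R^-1) - g s).
apply: (@measurable_fun_cvg _ _ _ D h).
  move=> m; apply: measurable_funTS; apply: continuous_measurable_fun.
  have cgm : continuous (fun s : R => g (s + m.+1%:R^-1) : R).
    move=> s; apply: (@cvg_comp _ _ _ (fun s : R => s + m.+1%:R^-1) g); last exact: cg.
    by apply: cvgD; [exact: cvg_id|exact: cvg_cst].
  move=> s; apply: cvgM; first exact: cvg_cst.
  by apply: cvgB; [exact: cgm|exact: cg].
move=> s /DP[/andP[s0 s1] ds].
have isd : is_derive s 1 f (derive1 f s) by rewrite derive1E; exact: derivableP.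
apply/cvgrPdist_le => e e0; have [eta eta0 H] := is_derive_dist isd e0.
have s1' : 0 < 1 - s by rewrite subr_gt0.
near=> m.
have keta : m.+1%:R^-1 < eta by near: m; exact: near_infty_natSinv_lt (PosNum eta0).
have ks : m.+1%:R^-1 < 1 - s by near: m; exact: near_infty_natSinv_lt (PosNum s1').
have k0 : 0 < m.+1%:R^-1 :> R by rewrite invr_gt0.
set k : R := m.+1%:R^-1 in keta ks k0.
have := H k; rewrite gtr0_norm // => /(_ keta).
rewrite /h /g /= !clamp01_id -/k; [|lra..].
have -> : m.+1%:R = k^-1 by rewrite invrK.
move=> Hk; have aux (d X r : R) : r != 0 -> d - r^-1 * X = - (r^-1 * (X - d * r)).
  by move=> r0; field.
rewrite aux ?gt_eqF //.
by rewrite normrN normrM gtr0_norm ?invr_gt0 // ler_pdivrMl // (mulrC k).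
Unshelve. all: by end_near. Qed.

(** The integral of a nonnegative function is a supremum over simple functions below it, so the
    comparison also covers a v that is not measurable. *)
Lemma le_integral_subset (D E : set R) (v : R -> R) : D `<=` E ->
  (forall s, 0 <= v s) ->
  (\int[mu]_s ((v \_ D) s)%:E <= \int[mu]_(s in E) (v s)%:E)%E.
Proof.
move=> DE v0; rewrite [leRHS]integral_mkcond.
have v0' s : (0 <= ((v \_ D) s)%:E)%E by rewrite lee_fin patchE; case: ifP.
have v0'' s : (0 <= ((fun s => (v s)%:E) \_ E) s)%E.
  by rewrite patchE; case: ifP => // _; rewrite lee_fin.
rewrite !ge0_integralTE //; apply: ereal_sup_le => _ [h hv <-]; exists h => //= s.
apply: le_trans (hv s) _; rewrite !patchE; case: ifPn => [/set_mem/DE/mem_set -> //|_].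
by case: ifP; rewrite lee_fin.
Qed.

Variable m : nat.

(** Measurability of [enorm (dx x s)] is only available where the curve is differentiable. The speed
    is therefore cut off to ]0, 1[ minus a measurable null set; the integral can only drop, which is
    the direction used for lower bounds on length. *)
Lemma exists_speed (x : R -> 'rV[R]_m.+1) :
  (forall i, abs_cont 0 1 (fun s => x s 0 i)) ->
  {ae mu, forall s, `[0, 1]%classic s -> forall i, derivable (fun u => x u 0 i) s 1} ->
  (\int[mu]_(s in `[0%R, 1%R]) (enorm (dx x s))%:E < +oo)%E ->
  exists G : R -> R, [/\ forall s, 0 <= G s, mu.-integrable setT (EFin \o G),
    (\int[mu]_s (G s)%:E <= \int[mu]_(s in `[0%R, 1%R]) (enorm (dx x s))%:E)%E &
    {ae mu, forall s, `[0, 1]%classic s -> G s = enorm (dx x s)}].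
Proof.
move=> acx [A [mA A0 sA]] Loo.
pose D : set R := `]0, 1[%classic `\` A.
have mD : measurable D by exact: measurableD.
pose v s := enorm (dx x s).
have v0 s : 0 <= v s by exact: sqrtr_ge0.
have DP s : D s -> 0 < s < 1 /\ forall i, derivable (fun u => x u 0 i) s 1.
  rewrite /D /= in_itv /= => -[/andP[s0 s1] nA]; split; first by rewrite s0.
  apply: contrapT => nP; apply/nA/sA => /= K; apply: nP; apply: K.
  by rewrite in_itv /= !ltW.
have mv : measurable_fun D v.
  apply: (@measurableT_comp _ _ _ _ _ _ (@Num.sqrt R)).
    by apply: continuous_measurable_fun; exact: sqrt_continuous.
  apply: measurable_sum => i.
  have md : measurable_fun D (fun s => (dx x s) 0 i).
    rewrite (_ : (fun s => _) = derive1 (fun u => x u 0 i)).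
      by apply: measurable_derive1 => // s Ds; have [? ?] := DP s Ds.
    by apply/funext => s; rewrite mxE.
  exact: measurable_funM.
exists (v \_ D).
have {}le : (\int[mu]_s ((v \_ D) s)%:E <= \int[mu]_(s in `[0%R, 1%R]) (v s)%:E)%E.
  by apply: le_integral_subset => // s [] /=; rewrite !in_itv /= => /andP[s0 s1] _; rewrite !ltW.
split => //.
- by move=> s; rewrite patchE; case: ifP.
- apply/integrableP; split.
    by apply/measurable_EFinP/(measurable_restrictT _ _).1.
  apply: le_lt_trans Loo; apply: le_trans le; apply: ge0_le_integral => //=.
  + by apply/measurable_EFinP; apply: measurableT_comp => //; apply/(measurable_restrictT _ _).1.
  + by apply/measurable_EFinP/(measurable_restrictT _ _).1.
  + by move=> s _; rewrite lee_fin ger0_norm // patchE; case: ifP.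
- exists (A `|` [set 0; 1]); split.
  + by apply: measurableU => //; apply: measurableU; exact: measurable_set1.
  + rewrite measureU0 //; [by apply: measurableU; exact: measurable_set1|].
    by rewrite measureU0 //; exact: lebesgue_measure_set1.
  + move=> s /= /not_implyP[]; rewrite in_itv /= => /andP[s0 s1] nG; have [As|nAs] := pselect (A s); first by left.
    right; apply: contrapT => /not_orP[ns0 ns1]; apply: nG.
    rewrite patchE mem_set //.
    split => //=; rewrite in_itv /= !lt_neqAle s0 s1 !andbT.
    apply/andP; split; apply/eqP => e; first by apply: ns0; rewrite -e.
    by apply: ns1.
Qed.

End Speed.

(** * Rules of differentiation for real functions along a direction *)

Section DeriveToolkit.
Variables (R : realType) (V : normedModType R).
Implicit Types f g : V -> R.

Lemma derD f g x v df dg : is_derive x v f df -> is_derive x v g dg ->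
  is_derive x v (fun s => f s + g s) (df + dg).
Proof. exact: is_deriveD. Qed.

Lemma derB f g x v df dg : is_derive x v f df -> is_derive x v g dg ->
  is_derive x v (fun s => f s - g s) (df - dg).
Proof. exact: is_deriveB. Qed.

Lemma derC (c : R) x v : is_derive x v (fun _ : V => c) 0.
Proof. exact: is_derive_cst. Qed.

Lemma derM f g x v df dg : is_derive x v f df -> is_derive x v g dg ->
  is_derive x v (fun s => f s * g s) (df * g x + f x * dg).
Proof.
move=> hf hg; have := is_deriveM hf hg.
by rewrite addrC [X in _ -> is_derive _ _ _ (X + _)]mulrC.
Qed.

Lemma derZ (c : R) f x v df : is_derive x v f df ->
  is_derive x v (fun s => c * f s) (c * df).
Proof. exact: is_deriveZ. Qed.

Lemma derX f n x v df : is_derive x v f df ->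
  is_derive x v (fun s => f s ^+ n.+1) (n.+1%:R * f x ^+ n * df).
Proof.
move=> hf; have -> : n.+1%:R * f x ^+ n * df = (n.+1%:R * f x ^+ n) *: df by [].
by rewrite -(exprfctE f); exact: is_deriveX.
Qed.

Lemma derV f x v df : f x != 0 -> is_derive x v f df ->
  is_derive x v (fun s => (f s)^-1) (- (f x) ^- 2 * df).
Proof.
move=> f0 [dfx <-]; split; first exact: derivableV.
by rewrite deriveV.
Qed.

Lemma der_sum (I : Type) (r : seq I) (h : I -> V -> R) (dh : I -> R) x v :
  (forall i, is_derive x v (h i) (dh i)) ->
  is_derive x v (fun s => \sum_(i <- r) h i s) (\sum_(i <- r) dh i).
Proof.
move=> H; elim: r => [|i r ih].
  under eq_fun do rewrite big_nil; rewrite big_nil; exact: derC.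
under eq_fun do rewrite big_cons; rewrite big_cons; exact: derD.
Qed.

Lemma der_eq f x v df dg : is_derive x v f df -> df = dg -> is_derive x v f dg.
Proof. by move=> + <-. Qed.

Lemma is_derive_lineP f x v df :
  is_derive x v f df <-> is_derive (0 : R) 1 (fun u : R => f (x + u *: v)) df.
Proof.
have E : (fun h : R => h^-1 *: (((fun u : R => f (x + u *: v)) \o shift (0 : R)) (h *: (1 : R)) -
     f (x + (0 : R) *: v))) = (fun h => h^-1 *: ((f \o shift x) (h *: v) - f x)).
  apply/funext => h /=; rewrite scale0r !addr0 (addrC x).
  by have -> : h *: (1 : R) = h by exact: mulr1.
split=> -[d <-]; split; rewrite /derivable /derive ?E //.
by move: d; rewrite /derivable E.
Qed.

Lemma der_comp (h : R -> R) f x v df dh :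
  is_derive (f x) 1 h dh -> is_derive x v f df ->
  is_derive x v (fun s => h (f s)) (dh * df).
Proof.
move=> hh /is_derive_lineP hf; apply/is_derive_lineP.
by apply: (is_derive1_comp _ hf); rewrite scale0r addr0.
Qed.

Lemma is_derive_near f g x v df : (\forall y \near x, f y = g y) ->
  is_derive x v f df -> is_derive x v g df.
Proof.
by move=> fg; exact: near_eq_is_derive.
Qed.

End DeriveToolkit.

(** * Continuity of sums, products and compositions *)

Section ContinuousSums.
Variables (R : realType) (T : topologicalType).

Lemma continuous_sum (I : Type) (r : seq I) (h : I -> T -> R) (x : T) :
  (forall i, {for x, continuous (h i)}) ->
  {for x, continuous (fun s => \sum_(i <- r) h i s)}.
Proof.
move=> H; elim: r => [|i r ih].
  have -> : (fun s => \sum_(i <- [::]) h i s) = cst 0 by apply/funext => s; rewrite big_nil.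
  exact: cvg_cst.
have -> : (fun s => \sum_(j <- i :: r) h j s) = (fun s => h i s + \sum_(j <- r) h j s).
  by apply/funext => s; rewrite big_cons.
by apply: cvgD; [exact: H|exact: ih].
Qed.

Lemma continuous_mul (f h : T -> R) (x : T) : {for x, continuous f} ->
  {for x, continuous h} -> {for x, continuous (fun s => f s * h s)}.
Proof. by move=> cf ch; apply: cvgM. Qed.

Lemma continuous_add (f h : T -> R) (x : T) : {for x, continuous f} ->
  {for x, continuous h} -> {for x, continuous (fun s => f s + h s)}.
Proof. by move=> cf ch; apply: cvgD. Qed.

Lemma continuous_comp1 (k : R -> R) (f : T -> R) (x : T) : {for x, continuous f} ->
  {for f x, continuous k} -> {for x, continuous (fun s => k (f s))}.
Proof. by move=> cf ck; exact: continuous_comp. Qed.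

End ContinuousSums.

(** * Euclidean scalar product and norm of row vectors *)

Section Dot.
Variables (R : realType).
Implicit Types m : nat.

Lemma dotC m (u v : 'rV[R]_m) : dot u v = dot v u.
Proof. by apply: eq_bigr => i _; rewrite mulrC. Qed.

Lemma dotDl m (u v w : 'rV[R]_m) : dot (u + v) w = dot u w + dot v w.
Proof. by rewrite /dot -big_split; apply: eq_bigr => i _; rewrite mxE mulrDl. Qed.

Lemma dotZl m a (u v : 'rV[R]_m) : dot (a *: u) v = a * dot u v.
Proof. by rewrite /dot mulr_sumr; apply: eq_bigr => i _; rewrite mxE mulrA. Qed.

Lemma dotDr m (u v w : 'rV[R]_m) : dot w (u + v) = dot w u + dot w v.
Proof. by rewrite !(dotC w) dotDl. Qed.

Lemma dotZr m a (u v : 'rV[R]_m) : dot u (a *: v) = a * dot u v.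
Proof. by rewrite !(dotC u) dotZl. Qed.

Lemma dotNl m (u v : 'rV[R]_m) : dot (- u) v = - dot u v.
Proof. by rewrite -scaleN1r dotZl mulN1r. Qed.

Lemma dotNr m (u v : 'rV[R]_m) : dot u (- v) = - dot u v.
Proof. by rewrite !(dotC u) dotNl. Qed.

Lemma dotBl m (u v w : 'rV[R]_m) : dot (u - v) w = dot u w - dot v w.
Proof. by rewrite dotDl dotNl. Qed.

Lemma dotBr m (u v w : 'rV[R]_m) : dot w (u - v) = dot w u - dot w v.
Proof. by rewrite dotDr dotNr. Qed.

Lemma dot0l m (u : 'rV[R]_m) : dot 0 u = 0.
Proof. by rewrite /dot big1 // => i _; rewrite mxE mul0r. Qed.

Lemma dot0r m (u : 'rV[R]_m) : dot u 0 = 0.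
Proof. by rewrite dotC dot0l. Qed.

Lemma dot_ge0 m (u : 'rV[R]_m) : 0 <= dot u u.
Proof. by apply: sumr_ge0 => i _; rewrite -expr2 sqr_ge0. Qed.

Lemma dot_eq0 m (u : 'rV[R]_m) : (dot u u == 0) = (u == 0).
Proof.
apply/eqP/eqP => [|->]; last exact: dot0l.
move=> /eqP; rewrite psumr_eq0 => [/allP H|i _]; last by rewrite -expr2 sqr_ge0.
apply/rowP => i; have := H i (mem_index_enum i).
by rewrite /= -expr2 sqrf_eq0 mxE => /eqP.
Qed.

Lemma enorm_sqr m (u : 'rV[R]_m) : enorm u ^+ 2 = dot u u.
Proof. by rewrite sqr_sqrtr // dot_ge0. Qed.

Lemma enorm_ge0 m (u : 'rV[R]_m) : 0 <= enorm u.
Proof. exact: sqrtr_ge0. Qed.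

Lemma enorm_eq0 m (u : 'rV[R]_m) : (enorm u == 0) = (u == 0).
Proof. by rewrite -sqrf_eq0 enorm_sqr dot_eq0. Qed.

Lemma enorm_gt0 m (u : 'rV[R]_m) : (0 < enorm u) = (u != 0).
Proof. by rewrite lt_def enorm_ge0 andbT enorm_eq0. Qed.

Lemma enormZ m a (u : 'rV[R]_m) : enorm (a *: u) = `|a| * enorm u.
Proof. by rewrite /enorm dotZl dotZr mulrA -expr2 sqrtrM ?sqr_ge0 // sqrtr_sqr. Qed.

Lemma enorm0 m : enorm (0 : 'rV[R]_m) = 0.
Proof. by apply/eqP; rewrite enorm_eq0. Qed.

Lemma dot_sqr_le m (u v : 'rV[R]_m) : dot u v ^+ 2 <= dot u u * dot v v.
Proof.
have [->|v0] := eqVneq v 0; first by rewrite !dot0r expr0n mulr0.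
have vv : 0 < dot v v by rewrite lt_def dot_ge0 dot_eq0 v0.
have := dot_ge0 (dot v v *: u - dot u v *: v).
rewrite !(dotBl, dotBr, dotZl, dotZr) (dotC v u) => H.
by rewrite -subr_ge0 -(pmulr_rge0 _ vv); move: H; congr (0 <= _); ring.
Qed.

Lemma dot_le m (u v : 'rV[R]_m) : dot u v <= enorm u * enorm v.
Proof.
have h : 0 <= enorm u * enorm v by rewrite mulr_ge0 // enorm_ge0.
rewrite (le_trans (ler_norm _)) // -(ler_pXn2r (_ : 0 < 2)%N) ?nnegrE //.
by rewrite real_normK ?num_real // exprMn !enorm_sqr dot_sqr_le.
Qed.

Lemma dotS n (x y : 'rV[R]_n.+1) :
  dot x y = x1 x * x1 y + dot (xstar x) (xstar y).
Proof.
by rewrite /dot big_ord_recl /x1; congr (_ + _); apply: eq_bigr => i _; rewrite !mxE.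
Qed.

Lemma unitvK m (u : 'rV[R]_m) : enorm u *: unitv u = u.
Proof.
rewrite /unitv; case: eqVneq => [->|u0]; first by rewrite scaler0.
by rewrite scalerA divff ?scale1r // enorm_eq0.
Qed.

Lemma dot_unitv m (u : 'rV[R]_m) : u != 0 -> dot (unitv u) (unitv u) = 1.
Proof.
move=> u0; rewrite /unitv (negbTE u0) dotZl dotZr -enorm_sqr.
by field; rewrite enorm_eq0.
Qed.

Lemma continuous_dot m (u : 'rV[R]_m) :
  {for u, continuous (fun s : 'rV[R]_m => dot s s)}.
Proof.
apply: continuous_sum => i.
by apply: continuous_mul; exact: (@coord_continuous R 1 m 0 i).
Qed.

End Dot.

(** * The calibration inequality *)

Section LowerBound.
Variables (R : realType) (n : nat).
Notation mu := (@lebesgue_measure R).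

Local Instance ae_lebesgue_filter : Filter (nbhs (almost_everywhere mu)).
Proof. exact: ae_filter_ringOfSetsType. Qed.

Implicit Types (e tau : 'rV[R]_n) (y w : 'rV[R]_n.+1).

(** Hence the j-th component of t is, up to orientation, the area swept by the projection of the
    curve to the plane of the coordinates [x1] and [xstar] number j. *)
Lemma dot_Umat (j : 'I_n) y w :
  dot (mxapp (Umat R j) y) w = xstar y 0 j * x1 w - x1 y * xstar w 0 j.
Proof.
have E b : mxapp (Umat R j) y 0 b =
    (b == ord0)%:R * xstar y 0 j - (b == lift ord0 j)%:R * x1 y.
  rewrite /mxapp mxE (eq_bigr (fun a => y 0 a * ((b == ord0) && (a == lift ord0 j))%:R -
     y 0 a * ((b == lift ord0 j) && (a == ord0))%:R)); last first.
    by move=> a _; rewrite !mxE mulrBr.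
  rewrite big_split /= sumrN (bigD1 (lift ord0 j)) //= eqxx andbT big1 ?addr0; last first.
    by move=> a /negbTE ->; rewrite andbF mulr0.
  rewrite (bigD1 ord0) //= eqxx andbT big1 ?addr0; last first.
    by move=> a /negbTE ->; rewrite andbF mulr0.
  by rewrite /xstar /x1 mxE; congr (_ - _); exact: mulrC.
rewrite dotS /x1 E eqxx /= mul1r mul0r subr0; congr (_ + _).
rewrite /dot (bigD1 j) //= big1 ?addr0.
  by rewrite [xstar (mxapp _ _) 0 j]mxE E eqxx /= mul0r mul1r sub0r mulNr.
move=> i /negbTE ij; rewrite [xstar (mxapp _ _) 0 i]mxE E /= mul0r.
by rewrite (inj_eq lift_inj) ij mul0r subrr mul0r.
Qed.

(* Cauchy-Schwarz against the vector [B] reduces the expression to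
   [enorm w / M * (M - enorm B) ^+ 2]. *)
Lemma calibration_derive_ge0 y w e (s0 k nu M : R) : 0 < M ->
  dot e e = 1 \/ e = 0 /\ s0 = 0 ->
  let a := x1 y in let b := dot (xstar y) e in
  let a' := x1 w in let b' := dot (xstar w) e in
  0 <= M * enorm w - 2 * s0 * (b * a' - a * b')
       - 2 * k * (a * a' + b * b') - 2 * nu * (dot y w - (a * a' + b * b'))
       + enorm w / M * ((k ^+ 2 + s0 ^+ 2) * (a ^+ 2 + b ^+ 2)
                        + nu ^+ 2 * (dot y y - (a ^+ 2 + b ^+ 2))).
Proof.
move=> M0 He; cbv zeta.
set a := x1 y; set b := dot (xstar y) e; set a' := x1 w; set b' := dot (xstar w) e.
(* Twice B is the covector collecting all terms linear in w. On span(e_0, e) it is k times the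
   position plus a rotation scaled by s0, and these two parts are orthogonal, whence the factor k^2
   + s0^2 in its square. *)
pose Bs : 'rV[R]_n := (k * b - s0 * a) *: e + nu *: (xstar y - b *: e).
pose B : 'rV[R]_n.+1 := \row_i (if unlift ord0 i is Some j then Bs 0 j else k * a + s0 * b).
have B1 : x1 B = k * a + s0 * b by rewrite /x1 mxE unlift_none.
have BsE : xstar B = Bs by apply/rowP => j; rewrite !mxE liftK !mxE.
have -> : M * enorm w - 2 * s0 * (b * a' - a * b')
       - 2 * k * (a * a' + b * b') - 2 * nu * (dot y w - (a * a' + b * b')) =
       M * enorm w - 2 * dot B w.
  rewrite (dotS B) (dotS y) B1 BsE /Bs dotDl !dotZl dotBl dotZl (dotC e) -/a -/a' -/b'.
  by ring.
have -> : (k ^+ 2 + s0 ^+ 2) * (a ^+ 2 + b ^+ 2)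
     + nu ^+ 2 * (dot y y - (a ^+ 2 + b ^+ 2)) = enorm B ^+ 2.
  rewrite enorm_sqr (dotS B) (dotS y) B1 BsE /Bs !(dotDl, dotDr, dotZl, dotZr, dotNl, dotNr).
  rewrite (dotC e) -/a -/b.
  case: He => [->|[e0 ->]]; first by ring.
  by rewrite /b e0 !dot0r; ring.
have CS := dot_le B w.
have -> : M * enorm w - 2 * dot B w + enorm w / M * enorm B ^+ 2 =
   enorm w / M * (M - enorm B) ^+ 2 + 2 * (enorm B * enorm w - dot B w).
  by field; rewrite gt_eqF.
apply: addr_ge0; apply: mulr_ge0; rewrite ?sqr_ge0 ?subr_ge0 //.
by rewrite divr_ge0 ?enorm_ge0 // ltW.
Qed.

(** The function F below does not decrease along the curve and vanishes at 0, and at 1 its first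
    term is at most (L + eps)^2. The Riccati equation for [kap] cancels the quadratic terms left by
    [calibration_derive_ge0]. The alternative e = 0, s0 = 0 covers tau = 0, which has no
    direction. *)
Lemma calibrated_length_bound (g : pt R n) (x : R -> 'rV[R]_n.+1) (t : R -> 'rV[R]_n)
    tau e (s0 L eps : R) (kap : R -> R) :
  horizontal_curve g x t ->
  (\int[mu]_(s in `[0%R, 1%R]) (enorm (dx x s))%:E)%E = L%:E -> 0 < eps ->
  tau = s0 *: e -> dot e e = 1 \/ e = 0 /\ s0 = 0 ->
  (forall u : R, 0 < u <= 1 -> is_derive u (1 : R) kap (- (kap u ^+ 2 + s0 ^+ 2))) ->
  let a := x1 (xof g) in let b := dot (xstar (xof g)) e in
  4 * dot (tof g) tau + (kap 1 * (a ^+ 2 + b ^+ 2)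
    + (dot (xof g) (xof g) - (a ^+ 2 + b ^+ 2))) <= (L + eps) ^+ 2.
Proof.
move=> [acx act [x0 t0] [xg tg] hor] LE eps0 tauE He kapP.
have [G [G0 intG GL aeG]] : exists G : R -> R, [/\ forall s, 0 <= G s,
    mu.-integrable setT (EFin \o G),
    (\int[mu]_s (G s)%:E <= \int[mu]_(s in `[0%R, 1%R]) (enorm (dx x s))%:E)%E &
    {ae mu, forall s, `[0, 1]%classic s -> G s = enorm (dx x s)}].
  apply: exists_speed => //; last by rewrite LE ltry.
  by apply: filterS hor => s H s01; have [] := H s01.
pose l := primitive0 G.
have L0 : 0 <= L.
  by rewrite -lee_fin -LE integral_ge0 // => s _; rewrite lee_fin enorm_ge0.
have l1L : l 1 <= L.
  rewrite -lee_fin -LE; apply: le_trans GL.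
  rewrite /l /primitive0 /Rintegral fineK; last first.
    by apply: integrable_fin_num => //; exact: integrableS intG.
  apply: ge0_subset_integral => //=; first exact: measurable_int intG.
  by move=> s _; rewrite lee_fin.
set M := L + eps; have M0 : 0 < M by rewrite ltr_wpDl.
(* Normalized arc length, shifted to end at 1. As M exceeds the length by at least eps, it starts at
   p > 0, away from the singularities of [kap] and of 1 / u. *)
pose u s := l s * M^-1 + (1 - l 1 * M^-1).
pose p := 1 - l 1 * M^-1.
have p0 : 0 < p by rewrite subr_gt0 ltr_pdivrMr // mul1r (le_lt_trans l1L) // ltrDl.
have l_ge0 s : 0 <= s -> 0 <= l s.
  by move=> s0'; rewrite -(primitive0_0 G); exact: primitive0_le.
have up s : 0 <= s <= 1 -> p <= u s <= 1.
  move=> /andP[s0' s1]; rewrite /u /p lerDr mulr_ge0 ?l_ge0 ?invr_ge0 ?(ltW M0) //=.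
  by rewrite addrCA gerDl subr_le0 ler_wpM2r ?invr_ge0 ?(ltW M0) // primitive0_le.
have acl : abs_cont 0 1 l by exact: abs_cont_primitive0.
have acu : abs_cont 0 1 u.
  apply: abs_contD; last exact: abs_cont_cst.
  by apply: abs_contM => //; exact: abs_cont_cst.
pose a s := x s 0 ord0.
pose b s := \sum_(j < n) x s 0 (lift ord0 j) * e 0 j.
pose N s := \sum_(i < n.+1) x s 0 i * x s 0 i.
pose T s := \sum_(j < n) t s 0 j * tau 0 j.
pose F s := M * l s + (- 4) * T s + (- 1) * (kap (u s) * (a s * a s + b s * b s)
    + (u s)^-1 * (N s + (- 1) * (a s * a s + b s * b s))).
have bE s : b s = dot (xstar (x s)) e by apply: eq_bigr => j _; rewrite mxE.
have aca : abs_cont 0 1 a by exact: acx.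
have acb : abs_cont 0 1 b.
  by apply: abs_cont_sum => j; apply: abs_contM; [exact: acx|exact: abs_cont_cst].
have acN : abs_cont 0 1 N by apply: abs_cont_sum => i; exact: abs_contM.
have acT : abs_cont 0 1 T.
  by apply: abs_cont_sum => j; apply: abs_contM; [exact: act|exact: abs_cont_cst].
have p1 : p <= 1 by rewrite gerBl mulr_ge0 ?l_ge0 ?invr_ge0 ?(ltW M0).
have ack : abs_cont 0 1 (fun s => kap (u s)).
  apply: (abs_cont_comp_derive p1 acu up) => [v /andP[pv v1]|v /andP[pv v1]].
    by apply: kapP; rewrite (lt_le_trans p0).
  have v0 : 0 < v <= 1 by rewrite (lt_le_trans p0).
  have ck : {for v, continuous kap}.
    apply/differentiable_continuous/derivable1_diffP.
    by have [] := kapP _ v0.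
  apply: cvgN; apply: cvgD; last exact: cvg_cst.
  by rewrite expr2; apply: cvgM.
have acv : abs_cont 0 1 (fun s => (u s)^-1).
  apply: (abs_cont_comp_derive (h := fun v => v^-1) (dh := fun v => - v ^- 2 * 1) p1 acu up)
     => [v /andP[pv v1]|v /andP[pv v1]]; have v0 : v != 0 by rewrite gt_eqF ?(lt_le_trans p0).
    exact: (derV v0 (is_derive_id _ _)).
  apply: cvgM; last exact: cvg_cst.
  apply: cvgN; apply: cvgV; first by rewrite expf_eq0.
  by rewrite expr2; apply: cvgM; exact: cvg_id.
have acF : abs_cont 0 1 F.
  have cst k : abs_cont 0 1 (fun _ : R => k) by exact: abs_cont_cst.
  have acab : abs_cont 0 1 (fun s => a s * a s + b s * b s).
    by apply: abs_contD; exact: abs_contM.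
  apply: abs_contD; first by apply: abs_contD; exact: abs_contM.
  apply: abs_contM => //; apply: abs_contD; first exact: abs_contM.
  apply: abs_contM => //; apply: abs_contD => //; exact: abs_contM.
have : F 0 <= F 1.
  apply: (le_of_abs_cont_derive_ge0 acF).
  (* The primitive of the speed is known to be differentiable for s > 0 only, so the point 0 is put
     into the exceptional set. *)
  have ae0 : {ae mu, forall s, s != 0}.
    exists [set 0]; split => //; first exact: lebesgue_measure_set1.
    by move=> s /= /negP; rewrite negbK => /eqP.
  have aeF := ae_filter_ringOfSetsType mu.
  have aeH := @filterI _ _ aeF _ _ (@filterI _ _ aeF _ _ ae0 aeG)
    (@filterI _ _ aeF _ _ (derive_primitive0 intG) hor).
  apply: (@filterS _ _ aeF _ _ _ aeH) => s [[sn0 GE] [dl Hh]] s01; move: (s01); rewrite /= in_itv /= => /andP[s0' s1].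
  have {}sn0 : 0 < s by rewrite lt_neqAle eq_sym sn0.
  have {}dl := dl sn0; have {}GE := GE s01; have [dxs dts] := Hh s01.
  set w := dx x s in GE dts.
  have dxi i : is_derive s 1 (fun s => x s 0 i) (w 0 i).
    by rewrite mxE derive1E; exact: derivableP.
  have dti j : is_derive s 1 (fun s => t s 0 j) (2^-1 * dot (mxapp (Umat R j) (x s)) w).
    by have [d <-] := dts j; rewrite derive1E; exact: derivableP.
  have da : is_derive s 1 a (x1 w) by exact: dxi.
  have db : is_derive s 1 b (dot (xstar w) e).
    have := @der_sum _ _ _ (index_enum 'I_n) (fun j s => x s 0 (lift ord0 j) * e 0 j)
       (fun j => w 0 (lift ord0 j) * e 0 j + x s 0 (lift ord0 j) * 0) s 1.
    move=> /(_ (fun j => derM (dxi _) (derC _ _ _))); move/der_eq; apply.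
    by apply: eq_bigr => j _; rewrite !mxE mulr0 addr0.
  have dN : is_derive s 1 N (2 * dot (x s) w).
    have := @der_sum _ _ _ (index_enum 'I_n.+1) (fun j s => x s 0 j * x s 0 j)
       (fun j => w 0 j * x s 0 j + x s 0 j * w 0 j) s 1.
    move=> /(_ (fun j => derM (dxi _) (dxi _))); move/der_eq; apply.
    by rewrite /dot mulr_sumr; apply: eq_bigr => j _; ring.
  have dT : is_derive s 1 T (2^-1 * s0 * (b s * x1 w - a s * dot (xstar w) e)).
    have := @der_sum _ _ _ (index_enum 'I_n) (fun j s => t s 0 j * tau 0 j)
       (fun j => (2^-1 * dot (mxapp (Umat R j) (x s)) w) * tau 0 j + t s 0 j * 0) s 1.
    move=> /(_ (fun j => derM (dti _) (derC _ _ _))); move/der_eq; apply.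
    rewrite (eq_bigr (fun j => 2^-1 * s0 * x1 w * (xstar (x s) 0 j * e 0 j) -
       2^-1 * s0 * a s * (xstar w 0 j * e 0 j))).
      by rewrite sumrB -!mulr_sumr bE /dot; ring.
    by move=> j _; rewrite dot_Umat tauE [(s0 *: e) 0 j]mxE /x1 /a; ring.
  have du : is_derive s 1 u (G s * M^-1).
    apply: der_eq (derD (derM dl (derC _ _ _)) (derC _ _ _)) _.
    by rewrite mulr0 !addr0.
  have us : 0 < u s <= 1.
    have /andP[h1 h2] : p <= u s <= 1 by apply: up; rewrite s0'.
    by rewrite (lt_le_trans p0).
  have un0 : u s != 0 by case/andP: us => /gt_eqF ->.
  have dk := der_comp (kapP _ us) du.
  have dv := derV un0 du.
  have dab := derD (derM da da) (derM db db).
  have dF := derD (derD (derZ M dl) (derZ (- 4) dT))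
     (derZ (- 1) (derD (derM dk dab) (derM dv (derD dN (derZ (- 1) dab))))).
  have {}dF : is_derive s 1 F _ := dF.
  have [dFs dFE] := dF; split => //; rewrite derive1E dFE.
  have := calibration_derive_ge0 (x s) w (kap (u s)) (u s)^-1 M0 He.
  have aE : x1 (x s) = a s by [].
  rewrite /= aE -bE -GE; congr (0 <= _).
  have -> : dot (x s) (x s) = N s by [].
  by rewrite exprVn; field; rewrite ?un0 ?gt_eqF.
have F0 : F 0 = 0.
  rewrite /F.
  have -> : l 0 = 0 by exact: primitive0_0.
  have -> : T 0 = 0 by rewrite /T big1 // => j _; rewrite t0 mxE mul0r.
  have -> : N 0 = 0 by rewrite /N big1 // => j _; rewrite x0 mxE mul0r.
  have -> : b 0 = 0 by rewrite /b big1 // => j _; rewrite x0 mxE mul0r.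
  have -> : a 0 = 0 by rewrite /a x0 mxE.
  by ring.
have u1 : u 1 = 1 by rewrite /u addrC subrK.
rewrite F0 /F u1 invr1.
have -> : T 1 = dot (tof g) tau by rewrite -tg.
have -> : N 1 = dot (xof g) (xof g) by rewrite -xg.
rewrite bE xg; have -> : a 1 = x1 (xof g) by rewrite /a xg.
have : M * l 1 <= M ^+ 2.
  by rewrite expr2 ler_wpM2l ?(ltW M0) // (le_trans l1L) // lerDl ltW.
rewrite /= !expr2; set ab := _ * _ + _ * _; set NN := dot _ _; lra.
Qed.

End LowerBound.

(** * The function phi stays below the squared distance *)

Section PhiBound.
Variables (R : realType) (n : nat).
Notation mu := (@lebesgue_measure R).
Implicit Types (g : pt R n) (tau : 'rV[R]_n).

Lemma is_derive_cot_scaled (c u : R) : sin (u * c) != 0 ->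
  is_derive u 1 (fun v => c * (cos (v * c) / sin (v * c)))
    (- ((c * (cos (u * c) / sin (u * c))) ^+ 2 + c ^+ 2)).
Proof.
move=> sn0.
have dm : is_derive u 1 (fun v => v * c) (1 * c + u * 0) by exact: derM (is_derive_id _ _) (derC _ _ _).
have dc := der_comp (is_derive_cos _) dm.
have ds := der_comp (is_derive_sin _) dm.
have dd := derZ c (derM dc (derV sn0 ds)).
apply: der_eq dd _ => /=.
by field.
Qed.

Lemma le_sqr_of_le_sqrD (a r : R) : 0 <= r ->
  (forall eps, 0 < eps -> a <= (r + eps) ^+ 2) -> a <= r ^+ 2.
Proof.
move=> r0 H; apply/ler_addgt0Pr => e e0.
pose d := Num.min 1 (e / (2 * r + 1)).
have r1 : 0 < 2 * r + 1 by lra.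
have d0 : 0 < d by rewrite lt_min ltr01 divr_gt0.
have d1 : d <= 1 by rewrite ge_min lexx.
have de : d * (2 * r + 1) <= e by rewrite -ler_pdivlMr // ge_min lexx orbT.
apply: (le_trans (H _ d0)); nra.
Qed.

(** For tau nonzero, k(u) = c cot(c u) takes at 1 the value c cot c = 1 - [fK c], and c < pi keeps
    sin(c u) positive on ]0, 1]. For tau = 0 its limit 1 / u is used with e = 0. *)
Lemma phi_le_curve_length g x t tau (L eps : R) :
  horizontal_curve g x t ->
  (\int[mu]_(s in `[0%R, 1%R]) (enorm (dx x s))%:E)%E = L%:E -> 0 < eps ->
  Omega tau -> phi g tau <= (L + eps) ^+ 2.
Proof.
move=> hor LE eps0 Om; set c := enorm tau.
have [tau0|tau0] := eqVneq tau 0.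
  have := @calibrated_length_bound _ _ g x t tau 0 0 L eps (fun u => u^-1) hor LE eps0.
  rewrite scale0r => /(_ tau0 (or_intror (conj erefl erefl))).
  have H (u : R) : 0 < u <= 1 -> is_derive u (1 : R) (fun v => v^-1) (- ((u^-1) ^+ 2 + 0 ^+ 2)).
    move=> /andP[u0 _]; have un0 : u != 0 by rewrite gt_eqF.
    apply: der_eq (derV un0 (is_derive_id _ _)) _.
    by rewrite expr0n addr0 exprVn [LHS]mulr1.
  move=> /(_ H); cbv zeta; apply: le_trans.
  rewrite /phi tau0 !dot0r dot0l enorm0 /fK eqxx invr1; lra.
have c0 : 0 < c by rewrite enorm_gt0.
have cpi : c < pi by [].
have sinp u : 0 < u <= 1 -> 0 < sin (u * c).
  move=> /andP[u0 u1]; apply: sin_gt0_pi; rewrite ?mulr_gt0 //=.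
  by rewrite (le_lt_trans _ cpi) // ger_pMl.
have ee : dot (unitv tau) (unitv tau) = 1 by exact: dot_unitv.
have := @calibrated_length_bound _ _ g x t tau (unitv tau) c L eps
  (fun u => c * (cos (u * c) / sin (u * c))) hor LE eps0.
rewrite unitvK => /(_ erefl (or_introl ee)).
have H (u : R) : 0 < u <= 1 -> is_derive u (1 : R) (fun u => c * (cos (u * c) / sin (u * c)))
   (- ((c * (cos (u * c) / sin (u * c))) ^+ 2 + c ^+ 2)).
  by move=> /sinp s0; apply: is_derive_cot_scaled; rewrite gt_eqF.
move=> /(_ H); cbv zeta; apply: le_trans; rewrite mul1r.
set b := dot (xstar (xof g)) (unitv tau).
have bE : dot tau (xstar (xof g)) = c * b by rewrite dotC -{1}(unitvK tau) dotZr.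
rewrite /phi bE /psiK /fK -/c gt_eqF // /cot.
have s1 : sin c != 0 by rewrite gt_eqF // -(mul1r c) sinp // ltr01 lexx.
have -> : (c * b) ^+ 2 * ((1 - c * (cos c / sin c)) / c ^+ 2) =
          b ^+ 2 * (1 - c * (cos c / sin c)) by field; rewrite s1 gt_eqF.
set k := c * (cos c / sin c); lra.
Qed.

Lemma horizontal_length_ge0 x :
  (0 <= \int[mu]_(s in `[0%R, 1%R]) (enorm (@dx R n x s))%:E)%E.
Proof. by apply: integral_ge0 => s _; rewrite lee_fin enorm_ge0. Qed.

Lemma ccdistE_ge0 g : (0 <= ccdistE g)%E.
Proof.
by apply: le_ereal_inf_tmp => _ [x [t [_ ->]]]; exact: horizontal_length_ge0.
Qed.

(** Stated in the extended reals, as no horizontal curve ending at g has been exhibited at this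
    stage. *)
Lemma phi_le_ccdistE g tau : Omega tau ->
  ((phi g tau)%:E <= ccdistE g * ccdistE g)%E.
Proof.
move=> Om; have := ccdistE_ge0 g.
case E : (ccdistE g) => [r| |] // r0; last by rewrite mulyy leey.
rewrite -EFinM lee_fin -expr2; apply: le_sqr_of_le_sqrD => // eps eps0.
have e2 : 0 < eps / 2 by rewrite divr_gt0.
have : (ccdistE g < (r + eps / 2)%:E)%E by rewrite E lte_fin ltrDl.
move=> /ereal_inf_lt[_ [x [t [hor ->]]]].
have := horizontal_length_ge0 x.
case LE : integral => [L| |] //; rewrite lee_fin lte_fin => L0 Lr.
apply: (le_trans (phi_le_curve_length hor LE e2 Om)).
rewrite ler_sqr ?nnegrE //; lra.
Qed.

End PhiBound.

(** * Helices with explicit end point and length *)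

Section Helix.
Variables (R : realType) (n : nat).
Notation mu := (@lebesgue_measure R).
Variables (w P Q : R) (e p : 'rV[R]_n).
Hypothesis w0 : w != 0.
Implicit Types (s : R) (g : pt R n).

(** The velocity in the plane of e_0 and e starts at (P, Q) and rotates at rate w, with the constant
    drift p added. [helix_a] and [helix_b] are the planar coordinates, [helix_A] is the primitive of
    [helix_a], and [helix_te], [helix_tp] are the components of t along e and p that horizontality
    forces. *)
Definition helix_a s := w^-1 * (P * sin (w * s) + Q * (1 - cos (w * s))).
Definition helix_b s := w^-1 * (P * (cos (w * s) - 1) + Q * sin (w * s)).
Definition helix_A s := w^-1 * (P * (w^-1 * (1 - cos (w * s))) + Q * (s - w^-1 * sin (w * s))).
Definition helix_x s : 'rV[R]_n.+1 :=
  \row_i (if unlift ord0 i is Some j then helix_b s * e 0 j + s * p 0 j else helix_a s).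
Definition helix_te s := 2^-1 * ((P ^+ 2 + Q ^+ 2) * (w^-1 * (s - w^-1 * sin (w * s)))).
Definition helix_tp s := 2^-1 * (s * helix_a s - 2 * helix_A s).
Definition helix_t s : 'rV[R]_n := \row_j (helix_te s * e 0 j + helix_tp s * p 0 j).

Let da s := P * cos (w * s) + Q * sin (w * s).
Let db s := Q * cos (w * s) - P * sin (w * s).

Let dC (c : R) s : is_derive s (1 : R) (fun _ : R => c) 0.
Proof. exact: derC. Qed.

Let dI s : is_derive s (1 : R) (fun s : R => s) 1.
Proof. exact: is_derive_id. Qed.

Let dw s : is_derive s 1 (fun s => w * s) w.
Proof. by apply: der_eq (derZ w (dI s)) _; rewrite mulr1. Qed.

Let dsin s : is_derive s 1 (fun s => sin (w * s)) (cos (w * s) * w).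
Proof. exact: (der_comp (is_derive_sin _) (dw s)). Qed.

Let dcos s : is_derive s 1 (fun s => cos (w * s)) (- sin (w * s) * w).
Proof. exact: (der_comp (is_derive_cos _) (dw s)). Qed.

Lemma derive_helix_a s : is_derive s 1 helix_a (da s).
Proof.
have := derZ w^-1 (derD (derZ P (dsin s)) (derZ Q (derB (dC 1 s) (dcos s)))).
by move/der_eq; apply; rewrite /da; field.
Qed.

Lemma derive_helix_b s : is_derive s 1 helix_b (db s).
Proof.
have := derZ w^-1 (derD (derZ P (derB (dcos s) (dC 1 s))) (derZ Q (dsin s))).
by move/der_eq; apply; rewrite /db; field.
Qed.

Lemma derive_helix_A s : is_derive s 1 helix_A (helix_a s).
Proof.
have := derZ w^-1 (derD (derZ P (derZ w^-1 (derB (dC 1 s) (dcos s))))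
  (derZ Q (derB (dI s) (derZ w^-1 (dsin s))))).
by move/der_eq; apply; rewrite /helix_a; field.
Qed.

Lemma derive_helix_te s : is_derive s 1 helix_te
  (2^-1 * (helix_b s * da s - helix_a s * db s)).
Proof.
have := derZ 2^-1 (derZ (P ^+ 2 + Q ^+ 2) (derZ w^-1 (derB (dI s) (derZ w^-1 (dsin s))))).
move/der_eq; apply; rewrite /helix_a /helix_b /da /db.
set S := sin _; set C := cos _.
have CS : S ^+ 2 = 1 - C ^+ 2 by rewrite sin2cos2.
transitivity (2^-1 * (w^-1 * ((P ^+ 2 + Q ^+ 2) * (1 - C)))); first by field.
congr (_ * _); have -> : w^-1 * (P * (C - 1) + Q * S) * (P * C + Q * S) -
  w^-1 * (P * S + Q * (1 - C)) * (Q * C - P * S) =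
  w^-1 * ((P ^+ 2 + Q ^+ 2) * (C ^+ 2 + S ^+ 2 - C)) by ring.
by rewrite CS; ring.
Qed.

Lemma derive_helix_tp s : is_derive s 1 helix_tp (2^-1 * (s * da s - helix_a s)).
Proof.
have := derZ 2^-1 (derB (derM (dI s) (derive_helix_a s)) (derZ 2 (derive_helix_A s))).
by move/der_eq; apply; ring.
Qed.

Let dxi i s : is_derive s 1 (fun s => helix_x s 0 i)
  (if unlift ord0 i is Some j then db s * e 0 j + p 0 j else da s).
Proof.
rewrite /helix_x; under eq_fun do rewrite mxE.
case: unlift => [j|]; last exact: derive_helix_a.
have := derD (derM (derive_helix_b s) (dC (e 0 j) s))
  (derM (dI s) (dC (p 0 j) s)).
by move/der_eq; apply; ring.
Qed.

Let dti j s : is_derive s 1 (fun s => helix_t s 0 j)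
  (2^-1 * (helix_b s * da s - helix_a s * db s) * e 0 j
   + 2^-1 * (s * da s - helix_a s) * p 0 j).
Proof.
rewrite /helix_t; under eq_fun do rewrite mxE.
have := derD (derM (derive_helix_te s) (dC (e 0 j) s))
  (derM (derive_helix_tp s) (dC (p 0 j) s)).
by move/der_eq; apply; ring.
Qed.

Let dxE s : dx helix_x s =
  \row_i (if unlift ord0 i is Some j then db s * e 0 j + p 0 j else da s).
Proof.
by apply/rowP => i; rewrite !mxE derive1E; have [_ ->] := dxi i s.
Qed.

Let x1_dx s : x1 (dx helix_x s) = da s.
Proof. by rewrite /x1 dxE mxE unlift_none. Qed.

Let xs_dx s : xstar (dx helix_x s) = db s *: e + p.
Proof. by apply/rowP => j; rewrite mxE dxE mxE liftK !mxE. Qed.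

Let ac_sin : abs_cont 0 1 (fun s => sin (w * s)).
Proof.
apply: (abs_cont_comp_derive (h := fun s => sin (w * s)) (dh := fun s => cos (w * s) * w)
   ler01 (@abs_cont_id R)) => // u _.
by apply: cvgM; [apply: (cvg_comp _ _ (cvgM (cvg_cst _) cvg_id)); exact: continuous_cos|exact: cvg_cst].
Qed.

Let ac_cos : abs_cont 0 1 (fun s => cos (w * s)).
Proof.
apply: (abs_cont_comp_derive (h := fun s => cos (w * s)) (dh := fun s => - sin (w * s) * w)
   ler01 (@abs_cont_id R)) => // u _.
by apply: cvgM; [apply: cvgN; apply: (cvg_comp _ _ (cvgM (cvg_cst _) cvg_id)); exact: continuous_sin|exact: cvg_cst].
Qed.

Let acZ (c : R) f : abs_cont 0 1 f -> abs_cont 0 1 (fun s => c * f s).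
Proof. by move=> acf; apply: abs_contM => //; exact: abs_cont_cst. Qed.

Let acB f h : abs_cont 0 1 f -> abs_cont 0 1 h -> abs_cont 0 1 (fun s => f s - h s).
Proof.
move=> acf ach; have := abs_contD acf (acZ (-1) ach).
by under eq_fun do rewrite mulN1r.
Qed.

Let aca : abs_cont 0 1 helix_a.
Proof.
by apply: acZ; apply: abs_contD; apply: acZ => //; apply: acB => //; exact: abs_cont_cst.
Qed.

Let acb : abs_cont 0 1 helix_b.
Proof.
by apply: acZ; apply: abs_contD; apply: acZ => //; apply: acB => //; exact: abs_cont_cst.
Qed.

Let acA : abs_cont 0 1 helix_A.
Proof.
apply: acZ; apply: abs_contD; apply: acZ.
  by apply: acZ; apply: acB => //; exact: abs_cont_cst.
by apply: acB; [exact: abs_cont_id|exact: acZ].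
Qed.

Let acte : abs_cont 0 1 helix_te.
Proof.
by apply: acZ; apply: acZ; apply: acZ; apply: acB; [exact: abs_cont_id|exact: (acZ _ ac_sin)].
Qed.

Let actp : abs_cont 0 1 helix_tp.
Proof.
by apply: acZ; apply: acB; [exact: (abs_contM (@abs_cont_id R) aca)|exact: (acZ _ acA)].
Qed.

Lemma helix_horizontal g : xof g = helix_x 1 -> tof g = helix_t 1 ->
  horizontal_curve g helix_x helix_t.
Proof.
have acC (c : R) : abs_cont 0 1 (fun=> c) by exact: abs_cont_cst.
have acI : abs_cont 0 1 (@id R) by exact: abs_cont_id.
move=> xg tg; split => //.
- move=> i; rewrite /helix_x; under eq_fun do rewrite mxE.
  case: unlift => [j|] //=.
  exact: (abs_contD (abs_contM acb (acC _)) (abs_contM acI (acC _))).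
- move=> j; rewrite /helix_t; under eq_fun do rewrite mxE.
  exact: (abs_contD (abs_contM acte (acC _)) (abs_contM actp (acC _))).
- have a0 : helix_a 0 = 0 by rewrite /helix_a mulr0 sin0 cos0; ring.
  have b0 : helix_b 0 = 0 by rewrite /helix_b mulr0 sin0 cos0; ring.
  have A0 : helix_A 0 = 0 by rewrite /helix_A mulr0 sin0 cos0; ring.
  split; apply/rowP => i; rewrite !mxE.
    by case: unlift => [j|//]; rewrite b0 !mul0r addr0.
  by rewrite /helix_te /helix_tp A0 mulr0 sin0; ring.
- apply: aeW => s _; split; first by move=> i; have [] := dxi i s.
  move=> j; have [d1 d2] := dti j s; split => //; rewrite derive1E d2 dot_Umat x1_dx xs_dx.
  by rewrite !mxE liftK /x1 mxE unlift_none; ring.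
Qed.

(** With e a unit vector orthogonal to p the speed is constant. The alternative P = Q = 0 is a
    straight line, needed when no direction e is at hand. *)
Lemma ccdistE_le_helix g : xof g = helix_x 1 -> tof g = helix_t 1 ->
  dot e p = 0 -> dot e e = 1 \/ P = 0 /\ Q = 0 ->
  (ccdistE g <= (Num.sqrt (P ^+ 2 + Q ^+ 2 + dot p p))%:E)%E.
Proof.
move=> xg tg ep He.
apply: ereal_inf_lbound; exists helix_x, helix_t; split; first exact: helix_horizontal.
have speed s : enorm (dx helix_x s) = Num.sqrt (P ^+ 2 + Q ^+ 2 + dot p p).
  rewrite /enorm dotS x1_dx xs_dx !(dotDl, dotDr, dotZl, dotZr) (dotC p e) ep.
  congr Num.sqrt; rewrite /da /db.
  set S := sin _; set C := cos _.
  have CS : S ^+ 2 = 1 - C ^+ 2 by rewrite sin2cos2.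
  case: He => [->|[-> ->]]; last by ring.
  transitivity ((P ^+ 2 + Q ^+ 2) * (C ^+ 2 + S ^+ 2) + dot p p); last by rewrite CS; ring.
  by ring.
rewrite (eq_integral (cst (Num.sqrt (P ^+ 2 + Q ^+ 2 + dot p p))%:E)) => [|s _]; last by rewrite speed.
rewrite integral_cst //= [X in (_ * X)%E](_ : _ = 1%E) ?mule1 //.
by rewrite [LHS]lebesgue_measure_itv /= lte_fin ltr01 oppr0 adde0.
Qed.

End Helix.

(** * Curves attached to parameters inside the ball *)

Section Geodesics.
Variables (R : realType) (n : nat).
Notation mu := (@lebesgue_measure R).
Implicit Types (g : pt R n) (e : 'rV[R]_n).

Lemma ccdistE_le_line g : tof g = 0 -> (ccdistE g <= (enorm (xof g))%:E)%E.
Proof.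
move=> tg; apply: ereal_inf_lbound.
pose x (s : R) := s *: xof g; pose t (s : R) : 'rV[R]_n := 0.
have dxi i s : is_derive s (1 : R) (fun s => x s 0 i) (xof g 0 i).
  rewrite /x; under eq_fun do rewrite mxE.
  apply: der_eq (derM (is_derive_id s (1 : R)) (derC (xof g 0 i) s (1 : R))) _.
  by rewrite mulr0 addr0 [LHS]mul1r.
have dt j s : is_derive s (1 : R) (fun s => t s 0 j) 0.
  by rewrite /t; under eq_fun do rewrite mxE; exact: derC.
have dxE s : dx x s = xof g.
  by apply/rowP => i; rewrite mxE derive1E; have [_ ->] := dxi i s.
exists x, t; split; last first.
  rewrite (eq_integral (cst (enorm (xof g))%:E)) => [|s _]; last by rewrite dxE.
  rewrite integral_cst //= [X in (_ * X)%E](_ : _ = 1%E) ?mule1 //.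
  by rewrite [LHS]lebesgue_measure_itv /= lte_fin ltr01 oppr0 adde0.
split.
- move=> i; rewrite /x; under eq_fun do rewrite mxE.
  exact: (abs_contM (@abs_cont_id R) (abs_cont_cst _)).
- by move=> j; exact: abs_cont_cst.
- by rewrite /x scale0r.
- by rewrite /x scale1r tg.
- apply: aeW => s _; split; first by move=> i; have [] := dxi i s.
  move=> j; have [d1 d2] := dt j s; split => //; rewrite derive1E d2 dot_Umat dxE.
  by rewrite /x /x1 !mxE; ring.
Qed.

Lemma ccdistE_le_geodesic g e (c : R) : 0 < c < pi -> dot e e = 1 ->
  let X := x1 (xof g) in let xs := xstar (xof g) in let b := dot e xs in
  tof g = (4^-1 * (X ^+ 2 + b ^+ 2) * ((c - sin c * cos c) / sin c ^+ 2)) *: e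
    + (2^-1 * b * ((1 - c * cot c) / c)) *: (xs - b *: e) ->
  (ccdistE g <= (Num.sqrt ((c / sin c) ^+ 2 * (X ^+ 2 + b ^+ 2)
     + (dot xs xs - b ^+ 2)))%:E)%E.
Proof.
move=> c0pi ee X xs b tg; have /andP[c0 cpi] := c0pi.
have S0 : sin c != 0 by rewrite gt_eqF // sin_gt0_pi.
have cn0 : c != 0 by rewrite gt_eqF.
set S := sin c in S0 *; pose C := cos c.
have CS : C ^+ 2 + S ^+ 2 = 1 by exact: cos2Dsin2.
have s2 : sin (2 * c * 1) = 2 * (C * S).
  by rewrite mulr1 mulr_natl sin_mulr2n -mulr_natl.
have c2 : cos (2 * c * 1) = 1 - 2 * S ^+ 2.
  rewrite mulr1 mulr_natl cos_mulr2n -mulr_natl -/C.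
  have -> : C ^+ 2 = 1 - S ^+ 2 by rewrite -CS addrK.
  ring.
pose P := c / S * (X * C - b * S); pose Q := c / S * (X * S + b * C).
pose p := xs - b *: e.
have w0 : 2 * c != 0 by rewrite mulf_neq0.
have ep : dot e p = 0 by rewrite dotBr dotZr ee mulr1 subrr.
have pp : dot p p = dot xs xs - b ^+ 2.
  by rewrite !(dotBl, dotBr, dotZl, dotZr) ee (dotC xs) -/b; ring.
have PQ : P ^+ 2 + Q ^+ 2 = (c / S) ^+ 2 * (X ^+ 2 + b ^+ 2).
  rewrite -[RHS]mulr1 -CS; rewrite /P /Q; ring.
have a1 : helix_a (2 * c) P Q 1 = X.
  rewrite /helix_a s2 c2; transitivity (X * (C ^+ 2 + S ^+ 2)); last by rewrite CS mulr1.
  by rewrite /P /Q; field; rewrite S0 cn0.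
have b1 : helix_b (2 * c) P Q 1 = b.
  rewrite /helix_b s2 c2; transitivity (b * (C ^+ 2 + S ^+ 2)); last by rewrite CS mulr1.
  by rewrite /P /Q; field; rewrite S0 cn0.
have te1 : helix_te (2 * c) P Q 1 = 4^-1 * (X ^+ 2 + b ^+ 2) * ((c - S * C) / S ^+ 2).
  rewrite /helix_te s2 PQ; by field; rewrite S0 cn0.
have tp1 : helix_tp (2 * c) P Q 1 = 2^-1 * b * ((1 - c * cot c) / c).
  rewrite /helix_tp a1 /helix_A s2 c2 /cot -/C -/S.
  transitivity (2^-1 * (b * ((C ^+ 2 + S ^+ 2) - c * (C / S)) / c)); last by rewrite CS; ring.
  by rewrite /P /Q; field; rewrite S0 cn0.
have xg : xof g = helix_x (2 * c) P Q e p 1.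
  apply/rowP => i; rewrite [RHS]mxE; case: (unliftP ord0 i) => [j ->|->] /=; last by rewrite a1.
  by rewrite b1 /p /xs !mxE; ring.
have {}tg : tof g = helix_t (2 * c) P Q e p 1.
  by rewrite tg; apply/rowP => j; rewrite [RHS]mxE te1 tp1 !mxE.
have := ccdistE_le_helix w0 xg tg ep (or_introl ee).
by rewrite PQ pp.
Qed.

End Geodesics.

(** * Closed helices for the points of the explicit set *)

Section CutCurves.
Variables (R : realType) (n : nat).
Implicit Types (g : pt R n) (t xs : 'rV[R]_n).

Definition tperp xs t : 'rV[R]_n := t - dot t (unitv xs) *: unitv xs.

Lemma unitv_eq0 m (u : 'rV[R]_m) : (unitv u == 0) = (u == 0).
Proof.
rewrite /unitv; case: (eqVneq u 0) => [_|u0]; first by rewrite eqxx.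
by rewrite scaler_eq0 invr_eq0 enorm_eq0 !(negbTE u0).
Qed.

Lemma unitv0 m : unitv (0 : 'rV[R]_m) = 0.
Proof. by apply/eqP; rewrite unitv_eq0. Qed.

Lemma dot_unitvE m (u v : 'rV[R]_m) : dot u (unitv v) = dot u v / enorm v.
Proof.
rewrite /unitv; case: eqVneq => [->|_]; first by rewrite !dot0r mul0r.
by rewrite dotZr mulrC.
Qed.

Lemma tperpE xs t : tperp xs t = t - (dot xs t / dot xs xs) *: xs.
Proof.
rewrite /tperp dot_unitvE /unitv; case: eqVneq => [->|x0]; first by rewrite !scaler0.
by rewrite scalerA -mulrA -invfM -expr2 enorm_sqr (dotC t).
Qed.

Lemma dot_tperp xs t : dot (tperp xs t) xs = 0.
Proof.
rewrite tperpE dotBl dotZl (dotC t); have [->|x0] := eqVneq xs 0.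
  by rewrite dot0l mul0r mul0r subrr.
by rewrite divfK ?subrr // dot_eq0.
Qed.

Lemma explicit_setP g : explicit_set g <->
  let xs := xstar (xof g) in let t := tof g in
  x1 (xof g) = 0 /\ pi * dot xs t ^+ 2 <= dot xs xs ^+ 2 * enorm (tperp xs t).
Proof.
rewrite /explicit_set /=; set xs := xstar _; set t := tof g; rewrite -/(tperp xs t).
have pi0 : 0 < pi :> R by exact: pi_gt0.
have T0 := enorm_ge0 (tperp xs t); have X0 := dot_ge0 xs.
suff -> : (`|dot xs t| <= enorm xs ^+ 2 / Num.sqrt pi * Num.sqrt (enorm (tperp xs t))) =
   (pi * dot xs t ^+ 2 <= dot xs xs ^+ 2 * enorm (tperp xs t)) by [].
rewrite enorm_sqr -[LHS]ler_sqr ?nnegrE ?mulr_ge0 ?sqrtr_ge0 ?invr_ge0 //.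
rewrite real_normK ?num_real // !exprMn exprVn !sqr_sqrtr //; last exact: ltW.
by rewrite mulrAC ler_pdivlMr // mulrC.
Qed.

(** A full turn, w = 2 pi, closes the planar part. The component of t orthogonal to [xs] fixes P^2 +
    Q^2 = 4 pi T, and the component along [xs] fixes Q through the phase of the circle. A real P
    exists if and only if Q^2 <= 4 pi T, which is the inequality defining the set. *)
Lemma ccdistE_le_cut g : explicit_set g ->
  let xs := xstar (xof g) in let t := tof g in
  (ccdistE g <= (Num.sqrt (dot xs xs + 4 * pi * enorm (tperp xs t)))%:E)%E.
Proof.
move=> /explicit_setP; cbv zeta; set xs := xstar _; set t := tof g => -[x10 le].
set T := enorm (tperp xs t) in le *.
have [q qE] : exists q : R, q = pi by exists pi.
rewrite -qE in le *.
have pi0 : 0 < q by rewrite qE; exact: pi_gt0.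
have pin0 : q != 0 by rewrite gt_eqF.
pose tt := dot xs t / dot xs xs.
pose Q := - 2 * q * tt.
have QT : Q ^+ 2 <= 4 * q * T.
  have [x0|x0] := eqVneq xs 0.
    by rewrite /Q /tt x0 !dot0l mul0r mulr0 expr0n !mulr_ge0 ?enorm_ge0 ?ltW.
  have xx : 0 < dot xs xs by rewrite lt_def dot_eq0 x0 dot_ge0.
  have -> : Q ^+ 2 = 4 * q * (q * dot xs t ^+ 2 / dot xs xs ^+ 2).
    by rewrite /Q /tt; field; rewrite gt_eqF.
  by rewrite ler_pM2l ?mulr_gt0 // ler_pdivrMr ?exprn_gt0 // (mulrC T).
pose P := Num.sqrt (4 * q * T - Q ^+ 2).
have PQ : P ^+ 2 + Q ^+ 2 = 4 * q * T by rewrite sqr_sqrtr ?subrK // subr_ge0.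
pose e := unitv (tperp xs t).
have w0 : 2 * q != 0 by rewrite mulf_neq0.
have s2 : sin (2 * q * 1) = 0 :> R by rewrite qE mulr1 mulr_natl sin2pi.
have c2 : cos (2 * q * 1) = 1 :> R by rewrite qE mulr1 mulr_natl cos2pi.
have a1 : helix_a (2 * q) P Q 1 = 0 by rewrite /helix_a s2 c2; ring.
have b1 : helix_b (2 * q) P Q 1 = 0 by rewrite /helix_b s2 c2; ring.
have te1 : helix_te (2 * q) P Q 1 = T by rewrite /helix_te s2 PQ; field.
have tp1 : helix_tp (2 * q) P Q 1 = tt.
  by rewrite /helix_tp a1 /helix_A s2 c2 /Q; field.
have xg : xof g = helix_x (2 * q) P Q e xs 1.
  apply/rowP => i; rewrite [RHS]mxE; case: (unliftP ord0 i) => [j ->|->] /=.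
    by rewrite b1 /xs !mxE; ring.
  by rewrite a1 -x10.
have tg : tof g = helix_t (2 * q) P Q e xs 1.
  apply/rowP => j; rewrite [RHS]mxE te1 tp1.
  have -> : T * e 0 j = tperp xs t 0 j by rewrite -[in RHS](unitvK (tperp xs t)) mxE.
  by rewrite tperpE !mxE /tt; ring.
have ep : dot e xs = 0 by rewrite dotC dot_unitvE dotC dot_tperp mul0r.
have He : dot e e = 1 \/ P = 0 /\ Q = 0.
  have [t0|t0] := eqVneq (tperp xs t) 0; last by left; exact: dot_unitv.
  right; have T0 : T = 0 by rewrite /T t0 enorm0.
  have := PQ; rewrite T0 mulr0 => /eqP; rewrite paddr_eq0 ?sqr_ge0 // !sqrf_eq0.
  by move=> /andP[/eqP ? /eqP ?].
by have := ccdistE_le_helix w0 xg tg ep He; rewrite PQ addrC.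
Qed.

End CutCurves.

(** * Power series with nonnegative coefficients *)

Section NonnegPseries.
Variables (R : realType).
Implicit Types (c : R^nat) (x z K : R).

Lemma nondecreasing_pseries c x : (forall k, 0 <= c k) -> 0 <= x ->
  nondecreasing_seq (pseries c x).
Proof.
move=> c0 x0; apply/nondecreasing_seqP => k.
by rewrite /pseries /series /= big_nat_recr //= lerDl mulr_ge0 ?exprn_ge0.
Qed.

Lemma is_cvg_pseries_bounded c x (B : R) : (forall k, 0 <= c k) -> 0 <= x ->
  (forall N, pseries c x N <= B) -> cvgn (pseries c x).
Proof.
move=> c0 x0 HB; apply: nondecreasing_is_cvgn; first exact: nondecreasing_pseries.
by exists B => _ [N _ <-].
Qed.

Lemma pseries_le_lim c x N : (forall k, 0 <= c k) -> 0 <= x ->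
  cvgn (pseries c x) -> pseries c x N <= limn (pseries c x).
Proof. by move=> c0 x0 cx; apply: nondecreasing_cvgn_le => //; exact: nondecreasing_pseries. Qed.

Lemma pseries_diffs_ge0 c : (forall k, 0 <= c k) -> forall k, 0 <= pseries_diffs c k.
Proof. by move=> c0 k; rewrite mulr_ge0. Qed.

(** From (k + 1) z^k (K - z) <= K^(k+1) - z^(k+1), the partial sums of the differentiated series at
    z are at most the sum at K divided by K - z. *)
Lemma is_cvg_pseries_diffs_nonneg c z K : (forall k, 0 <= c k) -> 0 <= z -> z < K ->
  cvgn (pseries c K) -> cvgn (pseries (pseries_diffs c) z).
Proof.
move=> c0 z0 zK cK; have K0 : 0 <= K by rewrite (le_trans z0) // ltW.
have Kz : 0 < K - z by rewrite subr_gt0.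
apply: (@is_cvg_pseries_bounded _ _ (limn (pseries c K) / (K - z))) => // [|N].
  exact: pseries_diffs_ge0.
rewrite ler_pdivlMr //; apply: (le_trans _ (pseries_le_lim N.+1 c0 K0 cK)).
rewrite /pseries /series /= big_nat_recl // mulr_suml -[leLHS]add0r.
apply: lerD; first by rewrite mulr_ge0 ?exprn_ge0.
apply: ler_sum_nat => k _; rewrite /pseries_diffs.
rewrite (mulrC _ (c k.+1)) -!mulrA ler_wpM2l //.
apply: (@le_trans _ _ (K ^+ k.+1 - z ^+ k.+1)); last by rewrite gerBl exprn_ge0.
rewrite subrXX mulrA mulrC ler_wpM2l ?(ltW Kz) //.
rewrite mulr_natl -[X in _ *+ X]card_ord -sumr_const.
apply: ler_sum => i _; have ik : (i <= k)%N by rewrite -ltnS.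
have -> : z ^+ k = z ^+ (k - i) * z ^+ i by rewrite -exprD subnK.
by rewrite ler_wpM2r ?exprn_ge0 // lerXn2r ?nnegrE // ltW.
Qed.

Section Family.
Variables (c : R^nat) (rho : R).
Hypothesis c0 : forall k, 0 <= c k.
Hypothesis cvg_c : forall x, 0 <= x < rho -> cvgn (pseries c x).

Definition pser (m : nat) x : R := limn (pseries (iter m (@pseries_diffs R) c) x).

Let cm m := iter m (@pseries_diffs R) c.

Let cm_ge0 m k : 0 <= cm m k.
Proof. by elim: m k => [|m ih] k; [exact: c0|exact: pseries_diffs_ge0]. Qed.

Lemma pser_cvg m x : 0 <= x < rho -> cvgn (pseries (cm m) x).
Proof.
elim: m x => [|m ih] x; first exact: cvg_c.
move=> /andP[x0 xr]; pose K := (x + rho) / 2.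
apply: (@is_cvg_pseries_diffs_nonneg _ x K) => //; first by rewrite /K; lra.
by apply: ih; rewrite /K; lra.
Qed.

Lemma pser_derive m x : `|x| < rho -> is_derive x 1 (pser m) (pser m.+1 x).
Proof.
move=> xr; pose K := (`|x| + rho) / 2; have nx := normr_ge0 x.
have K0 : 0 <= K < rho by rewrite /K; lra.
apply: (@pseries_snd_diffs _ _ K); [exact: pser_cvg|exact: (@pser_cvg m.+1 K)|exact: (@pser_cvg m.+2 K)|].
by rewrite [`|K|]ger0_norm /K; lra.
Qed.

Lemma pser_ge0 m x : 0 <= x < rho -> 0 <= pser m x.
Proof.
move=> x0r; have /andP[x0 _] := x0r.
have := pseries_le_lim 0 (cm_ge0 m) x0 (pser_cvg (m := m) x0r).
by rewrite /pseries /series /= big_nil.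
Qed.

Lemma pser_le m x z : 0 <= x -> x <= z -> z < rho -> pser m x <= pser m z.
Proof.
move=> x0 xz zr; apply: ler_lim; [apply: pser_cvg; lra|apply: pser_cvg; lra|].
apply: nearW => N; apply: ler_sum_nat => k _; rewrite ler_wpM2l ?cm_ge0 //.
by rewrite lerXn2r ?nnegrE // (le_trans x0).
Qed.

Lemma pser_0 m : pser m 0 = m`!%:R * c m.
Proof.
have -> : pser m 0 = cm m 0.
  apply: lim_near_cst => //.
  near=> N; rewrite /pseries /series /=.
  have -> : N = N.-1.+1 by rewrite prednK //; near: N; exact: nbhs_infty_gt.
  rewrite big_nat_recl // expr0 mulr1 big1 ?addr0 // => i _.
  by rewrite exprS mul0r mulr0.
suff H k : cm m k * k`!%:R = (k + m)`!%:R * c (k + m)%N.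
  by have := H 0%N; rewrite fact0 mulr1.
elim: m k => [|m ih] k; first by rewrite addn0 mulrC.
rewrite addnS -addSn -ih /cm /= /pseries_diffs factS natrM; ring.
Unshelve. all: by end_near. Qed.

End Family.
End NonnegPseries.

(** * A linear differential inequality *)

Section Comparison.
Variable R : realType.
Implicit Types (Z dZ b : R -> R).

(** If Z a < 0, then Z < 0 after its last nonnegative point s0. There Z' >= b Z >= K Z, so Z exp(- K
    s) does not decrease on [s0, a], which contradicts the signs at the ends. *)
Lemma comparison_ge0 Z dZ b (a K : R) : 0 <= a ->
  (forall s, 0 <= s <= a -> is_derive s 1 Z (dZ s)) -> 0 <= Z 0 ->
  (forall s, 0 < s < a -> b s * Z s <= dZ s) ->
  (forall s, 0 < s < a -> b s <= K) -> 0 <= Z a.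
Proof.
move=> a0 dZP Z0 bZ bK; rewrite leNgt; apply/negP => Za.
pose S := [set s : R | 0 <= s <= a /\ 0 <= Z s].
have S0 : S 0 by split=> //; rewrite lexx.
have ubS : ubound S a by move=> s [/andP[]].
have supS : has_sup S by split; [exists 0|exists a].
set s0 := sup S.
have s0a : 0 <= s0 <= a by rewrite (ub_le_sup _ S0) ?ge_sup //=; [exists 0|exists a].
have /andP[s00 s0a'] := s0a.
have Zs0 : 0 <= Z s0.
  rewrite leNgt; apply/negP => Zn.
  have [eta eta0 H] := is_derive_dist (dZP _ s0a) ltr01.
  have cZ : {for s0, continuous Z}.
    by apply/differentiable_continuous/derivable1_diffP; have [] := dZP _ s0a.
  have /cvgrPdist_lt/(_ (- Z s0)) := cZ; rewrite oppr_gt0 => /(_ Zn)[d /= d0 Hd].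
  have [s Ss sd] := sup_adherent d0 supS.
  have ss0 : s <= s0 by apply: ub_le_sup => //; exists a.
  have := Hd s; rewrite /ball_/= ger0_norm ?subr_ge0 // ltrBlDl -ltrBlDr => /(_ sd).
  case: Ss => _ Zs; rewrite distrC ltr_norml => /andP[_]; lra.
have s0lt : s0 < a.
  rewrite lt_neqAle s0a' andbT; apply/eqP => e; move: Zs0; rewrite e; lra.
have Zneg s : s0 < s -> s < a -> Z s < 0.
  move=> h1 h2; rewrite ltNge; apply/negP => Zs.
  have : s <= s0 by apply: ub_le_sup; [exists a|split=> //; lra].
  lra.
pose W s := Z s * expR (- K * s).
pose dW s := dZ s * expR (- K * s) + Z s * (expR (- K * s) * (- K)).
have dWP s : s0 <= s <= a -> is_derive s 1 W (dW s).
  move=> h; apply: derM; first by apply: dZP; lra.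
  apply: (der_comp (is_derive_expR _)).
  by apply: der_eq (derZ (- K) (is_derive_id s (1 : R))) _; rewrite mulr1.
have cW : {within `[s0, a], continuous W}.
  apply: derivable_within_continuous => s; rewrite in_itv /= => h.
  by have [] := dWP _ h.
have [|s] := MVT s0lt _ cW (df := dW).
  by move=> s; rewrite in_itv /= => /andP[h1 h2]; apply: dWP; lra.
rewrite in_itv /= => /andP[h1 h2] WE.
have : 0 <= W a - W s0.
  rewrite WE mulr_ge0 ?subr_ge0 // /dW.
  have -> : dZ s * expR (- K * s) + Z s * (expR (- K * s) * - K) =
     (dZ s - K * Z s) * expR (- K * s) by ring.
  rewrite mulr_ge0 ?expR_ge0 // subr_ge0.
  have s0' : 0 < s < a by lra.
  apply: le_trans (bZ _ s0'); rewrite ler_wnM2r ?bK //.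
  by apply: ltW; exact: Zneg.
have : W a < 0 by rewrite nmulr_rlt0 ?expR_gt0.
have : 0 <= W s0 by rewrite mulr_ge0 ?expR_ge0.
lra.
Qed.

End Comparison.

(** * The power series of psi in the variable s^2 *)

Section PsiSeries.
Variable R : realType.
Implicit Types (r s a : R).

(** Each coefficient depends on all earlier ones, so the recursion carries the list of the first k
    of them. *)
Fixpoint psi_coefs (k : nat) : seq R :=
  if k is k'.+1 then
    let q := psi_coefs k' in
    rcons q (((k' == 0%N)%:R + \sum_(i < k') q`_i * q`_(k'.-1 - i)) / (2 * k'%:R + 3))
  else [::].
Definition psi_coef (k : nat) : R := (psi_coefs k.+1)`_k.

Lemma size_psi_coefs k : size (psi_coefs k) = k.
Proof. by elim: k => //= k ih; rewrite size_rcons ih. Qed.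

Lemma nth_psi_coefs N k : (k < N)%N -> (psi_coefs N)`_k = psi_coef k.
Proof.
elim: N => // N ih; rewrite ltnS leq_eqVlt => /orP[/eqP -> //|kN].
by rewrite [LHS]/= nth_rcons size_psi_coefs kN ih.
Qed.

(* Coefficientwise form of the Riccati equation [2 r P' + 3 P = 1 + r P ^ 2]. *)
Lemma psi_coef_rec k : (2 * k%:R + 3) * psi_coef k =
  (k == 0%N)%:R + \sum_(i < k) psi_coef i * psi_coef (k.-1 - i).
Proof.
rewrite {1}/psi_coef /= nth_rcons size_psi_coefs ltnn eqxx mulrC divfK; last first.
  by rewrite gt_eqF // ltr_wpDl ?mulr_ge0.
congr (_ + _); apply: eq_bigr => i _; rewrite !nth_psi_coefs //.
by case: k i => [[]//|k] i; rewrite /= ltnS leq_subr.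
Qed.

Lemma psi_coef_ge0 k : 0 <= psi_coef k.
Proof.
elim/ltn_ind: k => k ih; have k0 : 0 < 2 * k%:R + 3 :> R by rewrite ltr_wpDl ?mulr_ge0.
rewrite -(pmulr_rge0 _ k0) psi_coef_rec addr_ge0 //.
apply: sumr_ge0 => i _; rewrite mulr_ge0 ?ih //.
by case: k i {ih k0} => [[]//|k] i; rewrite /= ltnS leq_subr.
Qed.

Lemma psi_coef0 : psi_coef 0 = 3^-1.
Proof.
have := psi_coef_rec 0; rewrite big_ord0 mulr0 add0r addr0 /= => H.
by apply: (mulfI (_ : 3 != 0 :> R)); rewrite ?H ?divff.
Qed.

Lemma psi_coef1 : psi_coef 1 = 45^-1.
Proof.
have := psi_coef_rec 1; rewrite big_ord1 /= psi_coef0 => H.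
by apply: (mulfI (_ : 5 != 0 :> R)) => //; move: H; lra.
Qed.

Definition psi_poly N : {poly R} := \poly_(k < N) psi_coef k.

Lemma psi_polyE N r : (psi_poly N).[r] = pseries psi_coef r N.
Proof. by rewrite horner_poly /pseries /series /= big_mkord. Qed.

Lemma deriv_psi_polyE N r :
  (psi_poly N.+1)^`().[r] = pseries (pseries_diffs psi_coef) r N.
Proof.
rewrite (@horner_coef_wide _ N) ?/pseries ?/series /= ?big_mkord; last first.
  have [->|p0] := eqVneq (psi_poly N.+1) 0; first by rewrite deriv0 size_poly0.
  by rewrite -ltnS (leq_trans (lt_size_deriv p0)) // size_poly.
apply: eq_bigr => i _; rewrite coef_deriv coef_poly ltnS ltn_ord /pseries_diffs.
by rewrite mulr_natl.
Qed.

Lemma horner_le (p q : {poly R}) r : 0 <= r -> (forall k, p`_k <= q`_k) -> p.[r] <= q.[r].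
Proof.
move=> r0 pq; rewrite -subr_ge0 -hornerN -hornerD horner_coef.
by apply: sumr_ge0 => i _; rewrite mulr_ge0 ?exprn_ge0 // coefD coefN subr_ge0.
Qed.

Let lhs N : {poly R} := 2 *: ('X * (psi_poly N)^`()) + 3 *: psi_poly N.
Let rhs N : {poly R} := 1 + 'X * (psi_poly N * psi_poly N).

Let lhs_coef N k : (lhs N)`_k = if (k < N)%N then
   (k == 0%N)%:R + \sum_(i < k) psi_coef i * psi_coef (k.-1 - i) else 0.
Proof.
rewrite coefD !coefZ coefXM -psi_coef_rec.
have -> : (if k == 0 then 0 else (psi_poly N)^`()`_k.-1) = k%:R * (psi_poly N)`_k.
  by case: k => [|k] /=; rewrite ?mul0r // coef_deriv mulr_natl.
by rewrite coef_poly; case: ifP => _; ring.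
Qed.

Let rhs_coef N k : (rhs N)`_k = (k == 0%N)%:R +
  \sum_(i < k) (psi_poly N)`_i * (psi_poly N)`_(k.-1 - i).
Proof.
rewrite coefD coef1 coefXM; congr (_ + _).
by case: k => [|k] /=; rewrite ?big_ord0 // coefM.
Qed.

Let psi_poly_le N k : (psi_poly N)`_k <= psi_coef k.
Proof. by rewrite coef_poly; case: ifP => // _; exact: psi_coef_ge0. Qed.

Let psi_poly_ge0 N k : 0 <= (psi_poly N)`_k.
Proof. by rewrite coef_poly; case: ifP => // _; exact: psi_coef_ge0. Qed.

Let lhsE N r : (lhs N).[r] = 2 * (r * (psi_poly N)^`().[r]) + 3 * (psi_poly N).[r].
Proof. by rewrite /lhs !hornerE. Qed.

Let rhsE N r : (rhs N).[r] = 1 + r * (psi_poly N).[r] ^+ 2.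
Proof. by rewrite /rhs !hornerE ?expr2. Qed.

(** Below degree N both sides have the same coefficients; from degree N on the left side has none
    and those of the right are nonnegative. *)
Lemma psi_poly_subsolution N r : 0 <= r ->
  2 * (r * (psi_poly N)^`().[r]) + 3 * (psi_poly N).[r] <= 1 + r * (psi_poly N).[r] ^+ 2.
Proof.
move=> r0; rewrite -lhsE -rhsE; apply: horner_le => // k.
rewrite lhs_coef rhs_coef; case: ltnP => kN; last first.
  by rewrite addr_ge0 // sumr_ge0 // => i _; rewrite mulr_ge0.
rewrite lerD2l; apply: ler_sum => i _; rewrite !coef_poly.
have -> : (i < N)%N by exact: ltn_trans kN.
suff -> : (k.-1 - i < N)%N by [].
by apply: leq_ltn_trans kN; rewrite (leq_trans (leq_subr _ _)) // leq_pred.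
Qed.

(** The right side built on N terms has degree below 2 N + 1, and its coefficients are dominated by
    full convolutions, which are the left coefficients of the longer truncation. *)
Lemma psi_poly_supersolution N r : 0 <= r ->
  1 + r * (psi_poly N).[r] ^+ 2 <=
  2 * (r * (psi_poly N.*2.+1)^`().[r]) + 3 * (psi_poly N.*2.+1).[r].
Proof.
move=> r0; rewrite -lhsE -rhsE; apply: horner_le => // k.
rewrite lhs_coef rhs_coef; case: ltnP => kN.
  by rewrite lerD2l; apply: ler_sum => i _; rewrite ler_pM.
rewrite gtn_eqF ?(leq_trans _ kN) // add0r big1 // => i _; rewrite !coef_poly.
have [iN|_] := ltnP i N; last by rewrite mul0r.
rewrite ltnNge (_ : (N <= _)%N) ?mulr0 //.
move: kN iN; rewrite -addnn; move: (nat_of_ord i) => j; lia.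
Qed.

(* [y = 1 - s ^ 2 p(s ^ 2)] is compared with [s cot s] through
   [Z = y sin s - s cos s], for which [Z' - s p Z = s sin s * (1 + r p^2 - 2 r p' - 3 p)]. *)
Lemma cot_comparison (p dp : R -> R) a K (sg : R) : sg = 1 \/ sg = -1 -> 0 < a < pi ->
  (forall r, 0 <= r <= a ^+ 2 -> is_derive r 1 p (dp r)) ->
  (forall r, 0 <= r <= a ^+ 2 -> 0 <= sg * (1 + r * p r ^+ 2 - (2 * (r * dp r) + 3 * p r))) ->
  (forall r, 0 <= r <= a ^+ 2 -> 0 <= p r <= K) ->
  0 <= sg * (fK a - a ^+ 2 * p (a ^+ 2)).
Proof.
move=> sg1 /andP[a0 api] dpP ode pK.
have sa : 0 < sin a by apply: sin_gt0_pi; rewrite a0.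
pose Z s := sg * ((1 - s ^+ 2 * p (s ^+ 2)) * sin s - s * cos s).
pose dsq s := 2 * s.
pose dZ s := sg * ((0 - (dsq s * p (s ^+ 2) + s ^+ 2 * (dp (s ^+ 2) * dsq s))) * sin s
   + (1 - s ^+ 2 * p (s ^+ 2)) * cos s - (1 * cos s + s * - sin s)).
have s2 s : 0 <= s <= a -> 0 <= s ^+ 2 <= a ^+ 2.
  by move=> /andP[s0 sa']; rewrite sqr_ge0 ler_sqr ?nnegrE // (le_trans s0).
suff : 0 <= Z a.
  rewrite /Z /fK gt_eqF // /cot.
  have -> : (1 - a ^+ 2 * p (a ^+ 2)) * sin a - a * cos a =
    (1 - a * (cos a / sin a) - a ^+ 2 * p (a ^+ 2)) * sin a by field; rewrite gt_eqF.
  by rewrite (mulrA sg) pmulr_lge0.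
apply: (@comparison_ge0 _ Z dZ (fun s => s * p (s ^+ 2)) a (a * K)).
- exact: ltW.
- move=> s h; have /andP[s0 sa'] := h.
  have dsqP : is_derive s 1 (fun s => s ^+ 2) (dsq s).
    by apply: der_eq (derX 1 (is_derive_id s (1 : R))) _; rewrite expr1 mulr1.
  have dpsq := der_comp (f := fun s => s ^+ 2) (x := s) (dpP _ (s2 _ h)) dsqP.
  have dw := derB (derC 1 s (1 : R)) (derM dsqP dpsq).
  have dt := derM (is_derive_id s (1 : R)) (is_derive_cos s).
  exact: (derZ sg (derB (derM dw (is_derive_sin s)) dt)).
- by rewrite /Z sin0 mulr0 mul0r subrr mulr0.
- move=> s /andP[s0 sa']; have h : 0 <= s <= a by rewrite !ltW.
  have := ode _ (s2 _ h); set q := p _; set dq := dp _ => E.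
  rewrite -subr_ge0.
  have -> : dZ s - s * q * Z s = s * sin s *
     (sg * (1 + s ^+ 2 * q ^+ 2 - (2 * (s ^+ 2 * dq) + 3 * q))).
    by rewrite /dZ /Z -/q -/dq /dsq; ring.
  by rewrite mulr_ge0 // mulr_ge0 ?(ltW s0) // sin_ge0_pi // (ltW s0) ltW // (lt_trans sa').
- move=> s /andP[s0 sa']; have h : 0 <= s <= a by rewrite !ltW.
  have /andP[p0 pk] := pK _ (s2 _ h).
  by rewrite ler_pM ?(ltW s0) // ltW.
Qed.

Lemma psi_poly_le_fK N a : 0 < a < pi -> a ^+ 2 * (psi_poly N).[a ^+ 2] <= fK a.
Proof.
move=> api; have := @cot_comparison (horner (psi_poly N)) (horner (psi_poly N)^`()) a
  (psi_poly N).[a ^+ 2] 1 (or_introl erefl) api.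
rewrite mul1r subr_ge0; apply => [r /andP[r0 _]|r /andP[r0 ra]].
- by rewrite mul1r subr_ge0; exact: psi_poly_subsolution.
- rewrite !horner_coef; apply/andP; split.
    by apply: sumr_ge0 => i _; rewrite mulr_ge0 ?exprn_ge0.
  by apply: ler_sum => i _; rewrite ler_wpM2l // lerXn2r ?nnegrE ?sqr_ge0.
Qed.

(** Truncations are subsolutions, so the partial sums at a^2 are bounded by [fK a / a ^+ 2] for
    every a < pi; here a^2 is the midpoint of r and pi^2. *)
Lemma psi_cvg r : 0 <= r < pi ^+ 2 -> cvgn (pseries psi_coef r).
Proof.
have pi0 : 0 < pi :> R by exact: pi_gt0.
move=> /andP[r0 rpi]; pose a := Num.sqrt ((r + pi ^+ 2) / 2).
have a2 : a ^+ 2 = (r + pi ^+ 2) / 2 by rewrite sqr_sqrtr //; lra.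
have a0 : 0 < a by rewrite sqrtr_gt0; lra.
have api : a < pi by rewrite -ltr_sqr ?nnegrE ?ltW // a2; lra.
apply: (@is_cvg_pseries_inside _ _ (a ^+ 2)); last first.
  by rewrite !ger0_norm ?sqr_ge0 // a2; lra.
apply: (@is_cvg_pseries_bounded _ _ _ (fK a / a ^+ 2)) => [k||N].
- exact: psi_coef_ge0.
- exact: sqr_ge0.
- by rewrite ler_pdivlMr ?exprn_gt0 // -psi_polyE mulrC psi_poly_le_fK // a0.
Qed.

(** [Psi m] is the m-th derivative of the function with [Psi 0 (s ^+ 2) = psiK s]. The variable r =
    |tau|^2 keeps everything differentiable at tau = 0. *)
Definition Psi := pser psi_coef.

Lemma Psi_derive m r : `|r| < pi ^+ 2 -> is_derive r 1 (Psi m) (Psi m.+1 r).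
Proof. exact: (pser_derive psi_coef_ge0 psi_cvg). Qed.

Lemma Psi_ge0 m r : 0 <= r < pi ^+ 2 -> 0 <= Psi m r.
Proof. exact: (pser_ge0 psi_coef_ge0 psi_cvg). Qed.

Lemma Psi_le m r r' : 0 <= r -> r <= r' -> r' < pi ^+ 2 -> Psi m r <= Psi m r'.
Proof. exact: (pser_le psi_coef_ge0 psi_cvg). Qed.

Lemma Psi_0 m : Psi m 0 = m`!%:R * psi_coef m.
Proof. exact: pser_0. Qed.

(** The two inequalities for truncations pass to the limit, which replaces a product of power
    series. *)
Lemma Psi_riccati r : 0 <= r < pi ^+ 2 ->
  2 * (r * Psi 1 r) + 3 * Psi 0 r = 1 + r * Psi 0 r ^+ 2.
Proof.
move=> rpi; have /andP[r0 _] := rpi.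
have c0 := pser_cvg psi_coef_ge0 psi_cvg (m := 0) rpi.
have c1 := pser_cvg psi_coef_ge0 psi_cvg (m := 1) rpi.
have q0 N : pseries psi_coef r N <= Psi 0 r.
  exact: (pseries_le_lim N psi_coef_ge0 r0 c0).
have q1 N : pseries (pseries_diffs psi_coef) r N <= Psi 1 r.
  exact: (pseries_le_lim N (pseries_diffs_ge0 psi_coef_ge0) r0 c1).
have q00 N : 0 <= pseries psi_coef r N.
  by apply: sumr_ge0 => k _; rewrite mulr_ge0 ?exprn_ge0 // psi_coef_ge0.
(* Differentiating the truncation with N + 1 terms leaves N terms, hence the shifted index. *)
have l0 : pseries psi_coef r N.+1 @[N --> \oo] --> Psi 0 r by rewrite cvg_shiftS.
apply/le_anti/andP; split.
- have L : 2 * (r * pseries (pseries_diffs psi_coef) r N) + 3 * pseries psi_coef r N.+1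
     @[N --> \oo] --> 2 * (r * Psi 1 r) + 3 * Psi 0 r.
    by apply: cvgD; apply: cvgM; (try exact: cvg_cst); [apply: cvgM; [exact: cvg_cst|]|].
  rewrite -(cvg_lim _ L) //; apply: limr_le; first by apply/cvg_ex; eexists; exact: L.
  apply: nearW => N; rewrite -psi_polyE -deriv_psi_polyE.
  apply: (le_trans (psi_poly_subsolution _ r0)).
  by rewrite lerD2l ler_wpM2l // ler_sqr ?nnegrE ?psi_polyE // (le_trans (q00 0%N)).
- have L : 1 + r * pseries psi_coef r N ^+ 2 @[N --> \oo] --> 1 + r * Psi 0 r ^+ 2.
    apply: cvgD; first exact: cvg_cst; apply: cvgM; first exact: cvg_cst.
    by rewrite expr2; under eq_fun do rewrite expr2; apply: cvgM.
  rewrite -(cvg_lim _ L) //; apply: limr_le; first by apply/cvg_ex; eexists; exact: L.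
  apply: nearW => N; rewrite -psi_polyE; apply: (le_trans (psi_poly_supersolution _ r0)).
  rewrite deriv_psi_polyE psi_polyE lerD // ?ler_wpM2l ?mulr_ge0 //.
Qed.

(** With equality in the Riccati equation the comparison with s cot s applies with both signs. *)
Lemma fK_Psi s : 0 <= s < pi -> fK s = s ^+ 2 * Psi 0 (s ^+ 2).
Proof.
move=> /andP[s0 spi]; have [->|sn0] := eqVneq s 0; first by rewrite /fK eqxx expr0n mul0r.
have s0' : 0 < s < pi by rewrite lt_neqAle eq_sym sn0 s0.
have s2 : s ^+ 2 < pi ^+ 2 by rewrite ltr_sqr ?nnegrE // pi_ge0.
have H sg : sg = 1 \/ sg = -1 -> 0 <= sg * (fK s - s ^+ 2 * Psi 0 (s ^+ 2)).
  move=> sg1; apply: (@cot_comparison (Psi 0) (Psi 1) s (Psi 0 (s ^+ 2))) => //.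
  - move=> r /andP[r0 rs]; apply: Psi_derive.
    by rewrite ger0_norm // (le_lt_trans rs).
  - by move=> r /andP[r0 rs]; rewrite Psi_riccati ?subrr ?mulr0 // r0 (le_lt_trans rs).
  - by move=> r /andP[r0 rs]; rewrite Psi_le // Psi_ge0 // r0 (le_lt_trans rs).
by have := H 1 (or_introl erefl); have := H (-1) (or_intror erefl); lra.
Qed.

Lemma psiK_Psi s : 0 <= s < pi -> psiK s = Psi 0 (s ^+ 2).
Proof.
move=> spi; rewrite /psiK; case: eqVneq => [->|s0].
  by rewrite expr0n Psi_0 psi_coef0 mul1r.
by rewrite fK_Psi // mulrC mulKf // expf_eq0 /=.
Qed.

End PsiSeries.

(** * Inequalities for psi: strict concavity of 1 / psi and the pole at pi *)

Section PsiBounds.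
Variable R : realType.
Implicit Types (r s : R).

(** At a first zero the function would arrive from positive values, which a positive derivative
    there excludes. *)
Lemma pos_of_derive_at_zero (f df : R -> R) (a : R) : 0 <= a ->
  (forall s, 0 <= s <= a -> is_derive s 1 f (df s)) -> 0 < f 0 ->
  (forall s, 0 < s <= a -> f s = 0 -> 0 < df s) -> 0 < f a.
Proof.
move=> a0 dfP f0 dpos.
have cf s : 0 <= s <= a -> {for s, continuous f}.
  by move=> h; apply/differentiable_continuous/derivable1_diffP; have [] := dfP _ h.
pose S := [set s : R | 0 <= s <= a /\ forall u, 0 <= u <= s -> 0 < f u].
have S0 : S 0.
  split; first by rewrite lexx.
  by move=> u h; have -> : u = 0 by lra.
have ubS : ubound S a by move=> s [/andP[]].
have supS : has_sup S by split; [exists 0|exists a].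
set s0 := sup S.
have s0a : 0 <= s0 <= a by rewrite (ub_le_sup _ S0) ?ge_sup //=; [exists 0|exists a].
have below u : 0 <= u -> u < s0 -> 0 < f u.
  move=> u0 us; have e0 : 0 < s0 - u by rewrite subr_gt0.
  by have [s [_ Ss] us'] := sup_adherent e0 supS; apply: Ss; rewrite -/s0 in us'; lra.
have s00 : 0 < f s0.
  rewrite ltNge; apply/negP => fs0.
  have s0p : 0 < s0.
    by rewrite lt_neqAle (andP s0a).1 andbT; apply/eqP => e; move: fs0; rewrite -e; lra.
  have fs0' : f s0 = 0.
    apply/le_anti; rewrite fs0 /= leNgt; apply/negP => fn.
    have /cvgrPdist_lt/(_ (- f s0)) := cf _ s0a; rewrite oppr_gt0 => /(_ fn)[d /= d0 Hd].
    pose u := Num.max 0 (s0 - d / 2).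
    have u0 : 0 <= u by rewrite le_max lexx.
    have us : u < s0 by rewrite gt_max s0p /=; lra.
    have ud : s0 - d / 2 <= u by rewrite le_max lexx orbT.
    have := Hd u; rewrite /ball_/= ger0_norm ?subr_ge0 ?(ltW us) // => Hu.
    have {}Hu : `|f s0 - f u| < - f s0 by apply: Hu; lra.
    have := below _ u0 us; move: Hu; rewrite distrC ltr_norml => /andP[_]; lra.
  have s0a' : 0 < s0 <= a by rewrite s0p (andP s0a).2.
  have l0 := dpos _ s0a' fs0'; have l20 : 0 < df s0 / 2 by rewrite divr_gt0.
  have [eta eta0 H] := is_derive_dist (dfP _ s0a) l20.
  pose h := Num.min (eta / 2) s0.
  have h0 : 0 < h by rewrite lt_min s0p divr_gt0.
  have hs : h <= s0 by rewrite ge_min lexx orbT.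
  have he : h <= eta / 2 by rewrite ge_min lexx.
  have := H (- h); rewrite normrN gtr0_norm // fs0' => Hh.
  have {}Hh : `|f (s0 - h) - 0 - df s0 * - h| <= df s0 / 2 * h by apply: Hh; lra.
  have : 0 < f (s0 - h) by apply: below; lra.
  have : 0 < df s0 * h by rewrite mulr_gt0.
  move: Hh; rewrite ler_norml => /andP[_]; lra.
have [s0lt|] := ltP s0 a; last by move=> h; have <- : s0 = a by apply/le_anti; rewrite (andP s0a).2.
have /cvgrPdist_lt/(_ _ s00)[d /= d0 Hd] := cf _ s0a.
pose u := Num.min a (s0 + d / 2).
have ua : u <= a by rewrite ge_min lexx.
have us : s0 < u by rewrite lt_min s0lt /=; lra.
have ud : u <= s0 + d / 2 by rewrite ge_min lexx orbT.
have Su : S u.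
  split; first by rewrite ua andbT; lra.
  move=> v /andP[v0 vu]; have [vs|sv] := ltP v s0; first exact: below.
  have := Hd v; rewrite /ball_/= ler0_norm ?subr_le0 // => Hv.
  have {}Hv : `|f s0 - f v| < f s0 by apply: Hv; lra.
  by move: Hv; rewrite ltr_norml => /andP[_]; lra.
have : u <= s0 by apply: ub_le_sup => //; exists a.
lra.
Qed.

Lemma is_derive_unique (f : R -> R) s (l l' : R) :
  is_derive s 1 f l -> is_derive s 1 f l' -> l = l'.
Proof. by move=> [_ <-] [_ <-]. Qed.

Let near_lt r : 0 < r < pi ^+ 2 -> \forall u \near r, 0 <= u < pi ^+ 2.
Proof.
move=> rpi; have ri : r \in `]0, pi ^+ 2[ by rewrite in_itv.
apply: filterS (near_in_itvoo ri) => u; rewrite in_itv /= => /andP[u0 up].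
by rewrite ltW.
Qed.

Lemma Psi_riccati_deriv r : 0 < r < pi ^+ 2 ->
  2 * (r * Psi 2 r) = Psi 0 r ^+ 2 - (5 - 2 * (r * Psi 0 r)) * Psi 1 r.
Proof.
move=> rpi; have /andP[r0 rp] := rpi.
have rn : `|r| < pi ^+ 2 by rewrite gtr0_norm.
have d0 := Psi_derive 0 rn; have d1 := Psi_derive 1 rn.
have dI := is_derive_id r (1 : R).
have dl := derD (derZ 2 (derM dI d1)) (derZ 3 d0).
have dr := derD (derC 1 r (1 : R)) (derM dI (derM d0 d0)).
have /is_derive_unique/(_ dr) : is_derive r 1 (fun u => 1 + u * (Psi 0 u * Psi 0 u)) 
   (2 * (1 * Psi 1 r + r * Psi 2 r) + 3 * Psi 1 r).
  apply: is_derive_near dl; apply: filterS (near_lt rpi) => u upi.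
  by rewrite Psi_riccati // expr2.
move=> h; lra.
Qed.

Lemma Psi0_gt0 r : 0 <= r < pi ^+ 2 -> 0 < Psi 0 r.
Proof.
move=> /andP[r0 rp]; apply: lt_le_trans (Psi_le 0 (lexx 0) r0 rp).
by rewrite Psi_0 psi_coef0 mul1r invr_gt0.
Qed.

Lemma Psi1_gt0 r : 0 <= r < pi ^+ 2 -> 0 < Psi 1 r.
Proof.
move=> /andP[r0 rp]; apply: lt_le_trans (Psi_le 1 (lexx 0) r0 rp).
by rewrite Psi_0 psi_coef1 mul1r invr_gt0.
Qed.

(* The Wronskian-type quantity below is, up to the factor [2 / P ^ 3], minus the
   second derivative of [s |-> 1 / P (s ^ 2)]. *)
Lemma Psi_strict r : 0 <= r < pi ^+ 2 ->
  0 < Psi 0 r ^+ 3 + 2 * Psi 1 r * (Psi 0 r - 1).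
Proof.
move=> rpi; have /andP[r0 rp] := rpi.
pose f s : R := Psi 0 s ^+ 3 + 2 * Psi 1 s * (Psi 0 s - 1).
pose df s : R := 3 * Psi 0 s ^+ 2 * Psi 1 s +
   (2 * Psi 2 s * (Psi 0 s - 1) + 2 * Psi 1 s * (Psi 1 s - 0)).
apply: (@pos_of_derive_at_zero f df) => // [s /andP[s0 sr]||s /andP[s0 sr] fs].
- have sn : `|s| < pi ^+ 2 by rewrite ger0_norm // (le_lt_trans sr).
  have d0 := Psi_derive 0 sn; have d1 := Psi_derive 1 sn.
  exact: (derD (derX 2 d0) (derM (derZ 2 d1) (derB d0 (derC 1 s (1 : R))))).
(* The value at 0 is 1/27 - 4/135 = 1/135. *)
- by rewrite /f !Psi_0 psi_coef0 psi_coef1 !mul1r; lra.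
- have spi : 0 < s < pi ^+ 2 by rewrite s0 (le_lt_trans sr).
  have spi' : 0 <= s < pi ^+ 2 by rewrite (ltW s0) (le_lt_trans sr).
  have p0 := Psi0_gt0 spi'; have E := Psi_riccati spi'; have E' := Psi_riccati_deriv spi.
  move: fs; rewrite /f; set p := Psi 0 s in p0 E E' *; set q := Psi 1 s in E E' * => fs.
  have spos : 0 < 2 * s by rewrite mulr_gt0.
  rewrite -(pmulr_rgt0 _ spos).
  suff -> : 2 * s * df s = p ^+ 3 + 4 * s * q ^+ 2 / p.
    apply: ltr_pwDl; first exact: exprn_gt0.
    by apply: divr_ge0; [rewrite mulr_ge0 ?sqr_ge0 // mulr_ge0 // ltW|exact: ltW].
  rewrite /df -/p -/q subr0.
  have -> : 2 * s * (3 * p ^+ 2 * q + (2 * Psi 2 s * (p - 1) + 2 * q * q)) =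
    6 * s * p ^+ 2 * q + 2 * (p - 1) * (2 * (s * Psi 2 s)) + 4 * s * q ^+ 2 by ring.
  rewrite E'; apply: (mulIf (lt0r_neq0 p0)); rewrite [RHS]mulrDl divfK ?lt0r_neq0 //.
  apply/eqP; rewrite -subr_eq0; apply/eqP.
  (* The difference is a combination of f(s), zero by assumption, and of the defect in the Riccati
     equation. *)
  transitivity ((p - 2 + 6 * s * q) * (p ^+ 3 + 2 * q * (p - 1))
    + (p - 1) * q * 4 * (1 + s * p ^+ 2 - (2 * (s * q) + 3 * p))); first by ring.
  by rewrite fs E subrr !mulr0 addr0.
Qed.

(** This is strict concavity of s |-> 1 / psi(s): the two Riccati identities turn the difference of
    the two sides into the quantity of [Psi_strict], except at r = 0, where the claim is
    immediate. *)
Lemma Psi_concavity r : 0 <= r < pi ^+ 2 ->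
  4 * r * Psi 1 r ^+ 2 < Psi 0 r * (Psi 1 r + 2 * r * Psi 2 r).
Proof.
move=> rpi; have /andP[r0 rp] := rpi.
have p0 := Psi0_gt0 rpi; have p1 := Psi1_gt0 rpi.
have [->|rn0] := eqVneq r 0.
  by rewrite !mulr0 !mul0r addr0 mulr_gt0 ?Psi0_gt0 ?Psi1_gt0 // lexx exprn_gt0 ?pi_gt0.
have rpi' : 0 < r < pi ^+ 2 by rewrite lt_neqAle eq_sym rn0 r0.
have E := Psi_riccati rpi; have E' := Psi_riccati_deriv rpi'.
have := Psi_strict rpi; rewrite -subr_gt0 -[in X in _ -> X]subr_gt0 subr0.
set p := Psi 0 r in p0 E E' *; set q := Psi 1 r in p1 E E' * => H.
suff -> : p * (q + 2 * r * Psi 2 r) - 4 * r * q ^+ 2 = p ^+ 3 + 2 * q * (p - 1) by [].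
have -> : p * (q + 2 * r * Psi 2 r) - 4 * r * q ^+ 2 =
  p * q + p * (2 * (r * Psi 2 r)) - 2 * q * (2 * (r * q) + 3 * p) + 6 * q * p by ring.
by rewrite E E'; ring.
Qed.

Lemma sin_le_id s : 0 <= s -> sin s <= s.
Proof.
rewrite le_eqVlt => /orP[/eqP <-|s0]; first by rewrite sin0.
have cs : {within `[0, s], continuous (@sin R)}.
  by apply: continuous_subspaceT => x; exact: continuous_sin.
have [c _] := MVT s0 (fun x _ => is_derive_sin x) cs.
rewrite sin0 !subr0 => ->; rewrite ler_piMl ?(ltW s0) //; exact: cos_le1.
Qed.

(** From sin(pi/4)^2 = 1/2 and sin s <= s. *)
Lemma pi_sqr_ge8 : 8 <= pi ^+ 2 :> R.
Proof.
have h0 : 0 <= pi / 4 :> R by rewrite divr_ge0 // pi_ge0.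
have := cos_pihalf R; have -> : pi / 2 = (pi / 4) *+ 2 :> R by rewrite -mulr_natl; field.
rewrite cos_mulr2n -mulr_natl cos2sin2 => E.
have sp : 0 <= sin (pi / 4) :> R by rewrite sin_ge0_pi // h0 /=; have := pi_ge0 R; lra.
have := sin_le_id h0; rewrite -(ler_sqr) ?nnegrE //; move: E.
rewrite exprMn; set S := sin _ ^+ 2; set p := pi ^+ 2; lra.
Qed.

(** As cot(pi - s) = - cot s, the cotangents cancel in (pi - s) f(s) + s f(pi - s). The identity
    transfers information on psi near 0 to its pole at pi. *)
Lemma Psi_reflection s : 0 < s < pi ->
  s * (pi - s) * (s * Psi 0 (s ^+ 2) + (pi - s) * Psi 0 ((pi - s) ^+ 2)) = pi.
Proof.
move=> /andP[s0 sp]; set v := pi - s.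
have v0 : 0 < v by rewrite subr_gt0.
have hs : 0 <= s < pi by rewrite ltW.
have hv : 0 <= v < pi by rewrite ltW //= /v; lra.
have fs := fK_Psi hs; have fv := fK_Psi hv.
have cv : cot v = - cot s.
  have sv : sin v = sin s by rewrite /v sinB sinpi cospi; ring.
  have cv : cos v = - cos s by rewrite /v cosB sinpi cospi; ring.
  by rewrite /cot sv cv mulNr.
have -> : s * v * (s * Psi 0 (s ^+ 2) + v * Psi 0 (v ^+ 2)) = v * fK s + s * fK v.
  by rewrite fs fv; ring.
rewrite /fK (gt_eqF s0) (gt_eqF v0) cv /v; move: (cot s) pi => c q; ring.
Qed.

Lemma Psi_upper s : 0 < s < pi -> Psi 0 (s ^+ 2) * (s ^+ 2 * (pi - s)) <= pi.
Proof.
move=> sp; have /andP[s0 spi] := sp; rewrite -[leRHS](Psi_reflection sp).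
have v0 : 0 < pi - s by rewrite subr_gt0.
have : 0 <= Psi 0 ((pi - s) ^+ 2).
  by apply: Psi_ge0; rewrite sqr_ge0 ltr_sqr ?nnegrE ?pi_ge0 ?(ltW v0) //=; lra.
set b := Psi 0 ((pi - s) ^+ 2); set a := Psi 0 (s ^+ 2) => b0; set v := pi - s in v0 *.
have : 0 <= s * v * (v * b).
  by apply: mulr_ge0; apply: mulr_ge0 => //; exact: ltW.
lra.
Qed.

(** The bound psi(s) >= 1 / (pi (pi - s)) has the exact leading term at pi, which makes the explicit
    set come out sharp. Up to pi/2 it follows from psi >= 1/3 and pi^2 >= 8; beyond, from the
    reflection and psi(pi - s) <= psi(pi/2) = 4 / pi^2. *)
Lemma Psi_lower s : 0 <= s < pi -> 1 <= Psi 0 (s ^+ 2) * (pi * (pi - s)).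
Proof.
move=> /andP[s0 spi]; have pi0 : 0 < pi :> R by exact: pi_gt0.
have p8 := pi_sqr_ge8.
have v0 : 0 < pi - s by rewrite subr_gt0.
have sqlt (u : R) : 0 <= u -> u < pi -> u ^+ 2 < pi ^+ 2.
  by move=> u0 up; rewrite ltr_pXn2r ?nnegrE // ltW.
have [sh|sh] := leP s (pi / 2).
  have := Psi_le 0 (lexx 0) (sqr_ge0 s) (sqlt _ s0 spi).
  rewrite Psi_0 psi_coef0 mul1r => h3.
  have : 3 <= pi * (pi - s).
    have : pi * (pi / 2) <= pi * (pi - s) by rewrite ler_pM2l //; lra.
    by move: p8; rewrite expr2; lra.
  set a := Psi 0 _ in h3 *; set b := pi * _ => b3; nra.
have s0' : 0 < s by lra.
have sp : 0 < s < pi by rewrite s0'.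
have h2 : 0 < (pi : R) / 2 < pi by lra.
have Ph : Psi 0 ((pi / 2) ^+ 2) = 4 / pi ^+ 2 :> R.
  have := Psi_reflection h2; have -> : pi - pi / 2 = pi / 2 :> R by field.
  move: (Psi 0 _) (lt0r_neq0 pi0) => a; move: (pi : R) => q q0 E.
  have q2 : q ^+ 2 != 0 by rewrite expf_eq0 /=.
  apply: (mulIf q2); rewrite divfK //; apply: (mulfI q0).
  transitivity (4 * (q / 2 * (q / 2) * (q / 2 * a + q / 2 * a))); first by field.
  by rewrite E mulrC.
have vh : pi - s <= pi / 2 by lra.
have := @Psi_le R 0 ((pi - s) ^+ 2) ((pi / 2) ^+ 2) (sqr_ge0 _).
rewrite ler_sqr ?nnegrE ?(ltW v0) // ?divr_ge0 ?(ltW pi0) // => /(_ vh).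
rewrite Ph => Hv; have {}Hv : Psi 0 ((pi - s) ^+ 2) <= 4 / pi ^+ 2.
  by apply: Hv; apply: sqlt; lra.
rewrite ler_pdivlMr ?exprn_gt0 // in Hv.
have := Psi_reflection sp; move: (Psi 0 (s ^+ 2)) (Psi 0 ((pi - s) ^+ 2)) Hv => a b.
move: v0 vh pi0 s0' sh spi; move: (pi : R) => q v0 vh q0 s0' sh sq Hv E.
rewrite -(ler_pM2l (_ : 0 < s ^+ 2)) ?exprn_gt0 // mulr1.
have -> : s ^+ 2 * (a * (q * (q - s))) = q * (q - s * (q - s) ^+ 2 * b).
  transitivity (q * (s * (q - s) * (s * a + (q - s) * b) - s * (q - s) ^+ 2 * b)); first by ring.
  by rewrite E.
have : s * (q - s) ^+ 2 * (b * q ^+ 2) <= s * (q - s) ^+ 2 * 4.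
  by rewrite ler_pM2l // mulr_gt0 // exprn_gt0.
move=> H; rewrite -(ler_pM2l q0).
have -> : q * (q * (q - s * (q - s) ^+ 2 * b)) = q ^+ 3 - s * (q - s) ^+ 2 * (b * q ^+ 2) by ring.
set v := q - s in v0 H *; have -> : s = q - v by rewrite /v; ring.
(* The remaining cubic is v (2 q^2 - 5 q v + 4 v^2), with the square completed. *)
have : 0 <= v * (2 * (q - 5 / 4 * v) ^+ 2 + 7 / 8 * v ^+ 2).
  by rewrite mulr_ge0 ?(ltW v0) // addr_ge0 // mulr_ge0 ?sqr_ge0 //.
have -> : v * (2 * (q - 5 / 4 * v) ^+ 2 + 7 / 8 * v ^+ 2) =
  q ^+ 3 - (q - v) * v ^+ 2 * 4 - q * (q - v) ^+ 2 by field.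
move: H; have -> : s = q - v by rewrite /v; ring.
lra.
Qed.

End PsiBounds.

(** * The Taylor series of s / sin s *)

Section SsinSeries.
Variable R : realType.
Implicit Types (r s : R).

(** Read off from s / sin s = 1 + f(s) - 2 f(s/2), that is 1 / sin s = cot(s/2) - cot s, with f(s) =
    s^2 psi(s) expanded by [psi_coef]. *)
Definition ssin_taylor (m : nat) : R :=
  if odd m then 0 else if m./2 is k.+1 then psi_coef R k * (1 - 2 / 4 ^+ k.+1) else 1.

Lemma ssin_taylor_ge0 m : 0 <= ssin_taylor m.
Proof.
rewrite /ssin_taylor; case: ifP => // _; case: (m./2) => // k.
rewrite mulr_ge0 ?psi_coef_ge0 // subr_ge0 ler_pdivrMr ?exprn_gt0 // mul1r exprS.
have : 1 <= 4 ^+ k :> R by rewrite exprn_ege1 // ler1n.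
lra.
Qed.

Lemma pseries_ssin_taylor s N : pseries ssin_taylor s N.+1.*2 =
  1 + s ^+ 2 * pseries (psi_coef R) (s ^+ 2) N
    - 2 * ((s / 2) ^+ 2 * pseries (psi_coef R) ((s / 2) ^+ 2) N).
Proof.
elim: N => [|N ih].
  rewrite /pseries /series /= !big_nat_recr //= !big_nil /ssin_taylor /=.
  by rewrite !expr0 mul0r mulr0 !add0r !mulr0 addr0 subr0 mulr1 addr0.
have pS (c : R^nat) (x : R) M : pseries c x M.+1 = pseries c x M + c M * x ^+ M.
  by rewrite /pseries /series /= big_nat_recr.
rewrite (doubleS N.+1) (pS _ _ N.+1.*2.+1) (pS _ _ N.+1.*2) ih !(pS (psi_coef R)) [ssin_taylor N.+1.*2.+1]/ssin_taylor /= odd_double /= mul0r addr0.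
rewrite /ssin_taylor odd_double doubleK.
have -> : s ^+ N.+1.*2 = s ^+ 2 * (s ^+ 2) ^+ N by rewrite -mul2n exprM exprS.
have -> : (s / 2) ^+ 2 = s ^+ 2 / 4 by field.
rewrite expr_div_n (exprS 4 N); move: (pseries _ _ _) (pseries _ _ _) => A B.
move: ((s ^+ 2) ^+ N) (s ^+ 2) => qN q.
by field; rewrite expf_neq0.
Qed.

Lemma ssin_fK s : `|s| < pi -> ssin s = 1 + fK s - 2 * fK (s / 2).
Proof.
move=> spi; rewrite /ssin /fK mulf_eq0 invr_eq0 pnatr_eq0 orbF.
case: eqVneq => [_|s0]; first by rewrite mulr0 subr0 addr0.
pose u := s / 2; have su : s = u *+ 2 by rewrite /u -mulr_natl; field.
have u2 : `|u| < pi / 2.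
  by rewrite /u normrM normfV (ger0_norm (_ : 0 <= 2)) // ltr_pM2r.
have cu : 0 < cos u by apply: cos_gt0_pihalf; rewrite -ltr_norml.
have sn : sin s != 0.
  rewrite /cot.
  have [sp|sp|e] := ltgtP s 0; last by rewrite e eqxx in s0.
    rewrite -oppr_eq0 -sinN gt_eqF // sin_gt0_pi // oppr_gt0 sp /=.
    by rewrite ltr0_norm in spi.
  by rewrite gt_eqF // sin_gt0_pi // sp /=; rewrite gtr0_norm in spi.
move: sn; rewrite -/u /cot su sin_mulr2n cos_mulr2n mulrn_eq0 /= mulf_eq0 negb_or.
move=> /andP[c0 sn0]; by field; rewrite c0 sn0.
Qed.

Lemma fK_Psi_norm s : `|s| < pi -> fK s = s ^+ 2 * Psi 0 (s ^+ 2).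
Proof.
move=> spi; rewrite -(real_normK (num_real s)) -fK_Psi ?normr_ge0 //.
rewrite /fK normr_eq0; case: eqVneq => // s0.
case: ltrgt0P s0 => // sp _; congr (1 - _).
by rewrite /cot sinN cosN invrN mulrN mulrNN.
Qed.

Lemma ssin_taylor_cvg_even s : `|s| < pi ->
  pseries ssin_taylor s N.+1.*2 @[N --> \oo] --> ssin s.
Proof.
move=> spi; rewrite ssin_fK //.
have h2 : `|s / 2| < pi.
  rewrite normrM normfV (ger0_norm (_ : 0 <= 2)) //; have := normr_ge0 s; lra.
rewrite !fK_Psi_norm //; under eq_fun do rewrite pseries_ssin_taylor.
have cP u : `|u| < pi -> pseries (psi_coef R) (u ^+ 2) N @[N --> \oo] --> Psi 0 (u ^+ 2).
  move=> up; apply: (psi_cvg (r := u ^+ 2)).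
  by rewrite sqr_ge0 -(real_normK (num_real u)) ltr_pXn2r ?nnegrE ?pi_ge0.
by apply: cvgB; [apply: cvgD; [exact: cvg_cst|]|apply: cvgM; [exact: cvg_cst|]];
  apply: cvgM; (try exact: cvg_cst); exact: cP.
Qed.

Lemma ssin_taylor_is_cvg s : 0 <= s < pi -> cvgn (pseries ssin_taylor s).
Proof.
move=> /andP[s0 spi]; have sn : `|s| < pi by rewrite ger0_norm.
have cv := ssin_taylor_cvg_even sn.
have nd := nondecreasing_pseries ssin_taylor_ge0 s0.
apply: (@is_cvg_pseries_bounded _ _ _ (ssin s)) => // [|N]; first exact: ssin_taylor_ge0.
rewrite -(cvg_lim _ cv) //; apply: (@le_trans _ _ (pseries ssin_taylor s N.+1.*2)).
  by apply: nd; rewrite doubleS -addnn; lia.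
apply: (nondecreasing_cvgn_le (u_ := fun N => pseries ssin_taylor s N.+1.*2)).
  by move=> i j ij; apply: nd; rewrite leq_double.
by apply/cvg_ex; eexists; exact: cv.
Qed.

Lemma ssin_pser s : `|s| < pi -> ssin s = pser ssin_taylor 0 s.
Proof.
move=> spi; have cv := ssin_taylor_cvg_even spi.
have cs : cvgn (pseries ssin_taylor s).
  apply: (@is_cvg_pseries_inside _ _ ((`|s| + pi) / 2)).
    by apply: ssin_taylor_is_cvg; have := normr_ge0 s; lra.
  by rewrite [`|(_ + _) / _|]ger0_norm; have := normr_ge0 s; lra.
rewrite -(cvg_lim _ cv) //; apply: cvg_lim => //.
have : (fun N : nat => N.+1.*2) @ \oo --> \oo.
  apply/cvgnyPge => A; near=> N; rewrite doubleS -addnn.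
  have : (A <= N)%N by near: N; exact: nbhs_infty_ge.
  lia.
by move=> /cvg_comp; apply.
Unshelve. all: by end_near. Qed.

(** [ssin_coef] is defined through iterated derivatives at 0; identifying them on the whole interval
    is what lets the induction on m proceed. *)
Lemma derive1n_ssin m s : `|s| < pi -> derive1n m (@ssin R) s = pser ssin_taylor m s.
Proof.
elim: m s => [|m ih] s spi; first exact: ssin_pser.
rewrite derive1nS derive1E.
have si : s \in `](- pi), pi[ by rewrite in_itv /= -ltr_norml.
have ds := pser_derive ssin_taylor_ge0 ssin_taylor_is_cvg m spi.
have : is_derive s 1 (derive1n m (@ssin R)) (pser ssin_taylor m.+1 s).
  apply: is_derive_near ds; apply: filterS (near_in_itvoo si) => u.
  by rewrite in_itv /= -ltr_norml => /ih ->.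
by case.
Qed.

Lemma ssin_coefE k : ssin_coef R k = ssin_taylor k.*2.
Proof.
rewrite /ssin_coef derive1n_ssin ?normr0 ?pi_gt0 // pser_0 mulrC mulKf //.
Qed.

Lemma ssin_coef_cvg s : 0 <= s < pi ->
  \sum_(k < N) ssin_coef R k * (s ^+ 2) ^+ k @[N --> \oo] --> ssin s.
Proof.
move=> /andP[s0 spi]; have sn : `|s| < pi by rewrite ger0_norm.
have E N : \sum_(k < N) ssin_coef R k * (s ^+ 2) ^+ k = pseries ssin_taylor s N.*2.
  rewrite /pseries /series /=; elim: N => [|N ih]; first by rewrite big_nil big_ord0.
  rewrite doubleS 2!(big_nat_recr _ _ _ (leq0n _)) /= -ih big_ord_recr /= ssin_coefE.
  rewrite -exprM mul2n [ssin_taylor N.*2.+1]/ssin_taylor /= odd_double /= mul0r.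
  by rewrite [in RHS]addr0.
rewrite -cvg_shiftS; under eq_fun do rewrite E.
exact: ssin_taylor_cvg_even.
Qed.

End SsinSeries.

(** * First and second derivatives of phi *)

Section PhiCalculus.
Variables (R : realType) (n : nat).
Implicit Types (g : pt R n) (tau v w : 'rV[R]_n).

Notation P k tau := (Psi k (dot tau tau)).

Lemma OmegaP tau : Omega tau <-> 0 <= dot tau tau < pi ^+ 2.
Proof.
by rewrite /Omega dot_ge0 -enorm_sqr ltr_pXn2r ?nnegrE ?enorm_ge0 ?pi_ge0.
Qed.

Lemma der_dotl v tau w : is_derive tau w (fun s : 'rV[R]_n => dot s v) (dot w v).
Proof.
apply/is_derive_lineP.
have E : (fun u : R => dot (tau + u *: w) v) = (fun u => dot tau v + u * dot w v).
  by apply/funext => u; rewrite dotDl dotZl.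
rewrite E; apply: der_eq (derD (derC _ _ _) (derM (is_derive_id _ _) (derC _ _ _))) _.
by rewrite mulr0 addr0 add0r [LHS]mul1r.
Qed.

Lemma der_dotr v tau w : is_derive tau w (fun s : 'rV[R]_n => dot v s) (dot v w).
Proof. by under eq_fun do rewrite dotC; rewrite dotC; exact: der_dotl. Qed.

Lemma der_dot_self tau w : is_derive tau w (fun s : 'rV[R]_n => dot s s) (2 * dot tau w).
Proof.
apply/is_derive_lineP.
have E : (fun u : R => dot (tau + u *: w) (tau + u *: w)) =
   (fun u => dot tau tau + u * (2 * dot tau w) + u ^+ 2 * dot w w).
  by apply/funext => u; rewrite !(dotDl, dotDr, dotZl, dotZr) (dotC w tau); ring.
rewrite E; have dI := is_derive_id (0 : R) (1 : R).
apply: der_eq (derD (derD (derC _ _ _) (derM dI (derC _ _ _))) (derM (derX 1 dI) (derC _ _ _))) _.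
by rewrite expr1 !mulr0 !mul0r !addr0 add0r [LHS]mul1r.
Qed.

Lemma Omega_norm tau : Omega tau -> `|dot tau tau| < pi ^+ 2.
Proof. by move/OmegaP => /andP[q0 ql]; rewrite ger0_norm. Qed.

Lemma der_Psi k tau w : Omega tau ->
  is_derive tau w (fun s : 'rV[R]_n => P k s) (P k.+1 tau * (2 * dot tau w)).
Proof.
move=> om; apply: (der_comp (f := fun s => dot s s) (x := tau)); last exact: der_dot_self.
exact: Psi_derive (Omega_norm om).
Qed.

Lemma Omega_near tau : Omega tau -> \forall s \near tau, Omega s.
Proof.
move=> /OmegaP /andP[_ ql].
have cq : {for tau, continuous (fun s : 'rV[R]_n => dot s s)}.
  exact: continuous_dot.
have e0 : 0 < pi ^+ 2 - dot tau tau by rewrite subr_gt0.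
have /cvgrPdist_lt/(_ _ e0) H := cq; apply: filterS H => s.
by rewrite distrC ltr_norml ltrBlDr subrK => /andP[_ h]; apply/OmegaP; rewrite dot_ge0.
Qed.

Definition mass g tau := x1 (xof g) ^+ 2 * dot tau tau + dot tau (xstar (xof g)) ^+ 2.

Lemma phiE g tau : Omega tau -> phi g tau =
  dot (xof g) (xof g) + 4 * dot (tof g) tau - mass g tau * P 0 tau.
Proof.
move=> om; have h : 0 <= enorm tau < pi by rewrite enorm_ge0.
by rewrite /phi fK_Psi // psiK_Psi // enorm_sqr /mass; ring.
Qed.

Definition dmassP g tau v :=
  2 * (x1 (xof g) ^+ 2 * dot tau v + dot tau (xstar (xof g)) * dot v (xstar (xof g))) * P 0 tau
  + mass g tau * (P 1 tau * (2 * dot tau v)).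

Definition ddmassP g tau v w :=
  2 * (x1 (xof g) ^+ 2 * dot w v + dot w (xstar (xof g)) * dot v (xstar (xof g))) * P 0 tau
  + 2 * (x1 (xof g) ^+ 2 * dot tau v + dot tau (xstar (xof g)) * dot v (xstar (xof g)))
      * (P 1 tau * (2 * dot tau w))
  + 2 * (x1 (xof g) ^+ 2 * dot tau w + dot tau (xstar (xof g)) * dot w (xstar (xof g)))
      * (P 1 tau * (2 * dot tau v))
  + mass g tau * (P 2 tau * (2 * dot tau w) * (2 * dot tau v) + P 1 tau * (2 * dot w v)).

Definition dphi g tau v := 4 * dot (tof g) v - dmassP g tau v.

Lemma der_mass g tau w : is_derive tau w (mass g)
  (2 * (x1 (xof g) ^+ 2 * dot tau w + dot tau (xstar (xof g)) * dot w (xstar (xof g)))).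
Proof.
have := derD (derZ (x1 (xof g) ^+ 2) (der_dot_self tau w)) (derX 1 (der_dotl (xstar (xof g)) tau w)).
by move/der_eq; apply; rewrite expr1; ring.
Qed.

Lemma der_massP g tau w : Omega tau ->
  is_derive tau w (fun s => mass g s * P 0 s) (dmassP g tau w).
Proof. by move=> om; exact: (derM (der_mass g tau w) (der_Psi 0 w om)). Qed.

Lemma der_dmassP g tau v w : Omega tau ->
  is_derive tau w (fun s => dmassP g s v) (ddmassP g tau v w).
Proof.
move=> om; rewrite /dmassP.
have d0 := derZ 2 (derD (derZ (x1 (xof g) ^+ 2) (der_dotl v tau w))
   (derM (der_dotl (xstar (xof g)) tau w) (derC (dot v (xstar (xof g))) tau w))).
have dm := derM (der_mass g tau w) (derM (der_Psi 1 w om) (derZ 2 (der_dotl v tau w))).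
have := derD (derM d0 (der_Psi 0 w om)) dm.
by move/der_eq; apply; rewrite /ddmassP; ring.
Qed.

Lemma der_phi g tau v : Omega tau -> is_derive tau v (phi g) (dphi g tau v).
Proof.
move=> om; have := derB (derD (derC (dot (xof g) (xof g)) tau v)
  (derZ 4 (der_dotr (tof g) tau v))) (der_massP g v om).
rewrite add0r; apply: is_derive_near; apply: filterS (Omega_near om) => s oms.
by rewrite phiE.
Qed.

Lemma der_dphi g tau v w : Omega tau ->
  is_derive tau w (fun s => dphi g s v) (- ddmassP g tau v w).
Proof.
move=> om; have := derB (derC (4 * dot (tof g) v) tau w) (der_dmassP g v w om).
by rewrite sub0r.
Qed.

Lemma der_derive_phi g tau v w : Omega tau ->
  is_derive tau w ('D_v (phi g)) (- ddmassP g tau v w).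
Proof.
move=> om; apply: is_derive_near (der_dphi g v w om).
by apply: filterS (Omega_near om) => s oms; have [_ ->] := der_phi g v oms.
Qed.

(** Write q = |tau|^2, al = tau.v, a = tau.xs, b = v.xs. The form is X^2 F + 2 S, where F > 0 is the
    second derivative of |tau|^2 P, and p S = (p b + 2 a al P')^2 + a^2 D by completing the square.
    In q D the Cauchy-Schwarz defect q |v|^2 - al^2 and [Psi_concavity] each contribute a
    nonnegative term, not both zero. *)
Lemma ddmassP_gt0 g tau v : Omega tau ->
  x1 (xof g) != 0 \/ dot tau (xstar (xof g)) != 0 -> v != 0 -> 0 < ddmassP g tau v v.
Proof.
move=> /OmegaP om Hxa v0.
have p0 := Psi0_gt0 om; have p1 := Psi1_gt0 om; have p2 := Psi_ge0 2 om.
have K := Psi_concavity om; have /andP[q0 _] := om.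
have V0 : 0 < dot v v by rewrite lt_def dot_eq0 v0 dot_ge0.
have CS := dot_sqr_le tau v.
rewrite /ddmassP /mass.
set X := x1 (xof g) in Hxa *; set a := dot tau (xstar (xof g)) in Hxa *; set b := dot v (xstar (xof g)).
move: (dot tau tau) (dot tau v) (dot v v) (P 0 tau) (P 1 tau) (P 2 tau)
  p0 p1 p2 K q0 V0 CS => q al V p pp pd p0 p1 p2 K q0 V0 CS.
have fst_gt0 : 0 < 2 * V * p + 8 * pp * al ^+ 2 + 4 * q * pd * al ^+ 2 + 2 * q * pp * V.
  have : 0 < 2 * V * p by rewrite !mulr_gt0.
  have a2 := sqr_ge0 al; have pp0 := ltW p1.
  have : 0 <= 8 * pp * al ^+ 2 by apply: mulr_ge0 => //; exact: mulr_ge0.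
  have : 0 <= 4 * q * pd * al ^+ 2 by apply: mulr_ge0 => //; apply: mulr_ge0 => //; exact: mulr_ge0.
  have : 0 <= 2 * q * pp * V by rewrite !mulr_ge0 // ltW.
  lra.
pose D := p * (pp * V + 2 * pd * al ^+ 2) - 4 * al ^+ 2 * pp ^+ 2.
have D0 : 0 < D.
  have [qe|qn] := eqVneq q 0.
    have al0 : al ^+ 2 = 0 by apply/le_anti; rewrite sqr_ge0 andbT (le_trans CS) // qe mul0r.
    by rewrite /D al0 !mulr0 mul0r subr0 addr0 !mulr_gt0.
  have q_gt0 : 0 < q by rewrite lt_def qn.
  rewrite -(pmulr_rgt0 _ q_gt0).
  have -> : q * D = p * pp * (q * V - al ^+ 2) +
     al ^+ 2 * (p * (pp + 2 * q * pd) - 4 * q * pp ^+ 2) by rewrite /D; ring.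
  have [al0|aln] := eqVneq al 0.
    by rewrite al0 expr0n /= mul0r addr0 subr0 !mulr_gt0.
  apply: ltr_wpDl; first by rewrite mulr_ge0 ?subr_ge0 // mulr_ge0 // ltW.
  by rewrite mulr_gt0 ?subr_gt0 // exprn_even_gt0.
have snd_ge : (p * b + 2 * a * al * pp) ^+ 2 + a ^+ 2 * D =
  p * (p * b ^+ 2 + 4 * a * b * pp * al + a ^+ 2 * (2 * pd * al ^+ 2 + pp * V)).
  by rewrite /D; ring.
set F := 2 * V * p + _ + _ + _ in fst_gt0.
set S := p * b ^+ 2 + _ + _ in snd_ge.
rewrite (_ : _ + _ + _ + _ = X ^+ 2 * F + 2 * S); last by rewrite /F /S; ring.
have S0 : 0 <= S.
  by rewrite -(pmulr_rge0 _ p0) -snd_ge addr_ge0 ?sqr_ge0 // mulr_ge0 ?sqr_ge0 // ltW.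
case: Hxa => [X0|a0].
  by apply: ltr_pwDl; [rewrite mulr_gt0 // exprn_even_gt0|rewrite mulr_ge0].
apply: ltr_wpDl; first by rewrite mulr_ge0 ?sqr_ge0 // ltW.
rewrite mulr_gt0 // -(pmulr_rgt0 _ p0) -snd_ge; apply: ltr_wpDl; first exact: sqr_ge0.
by rewrite mulr_gt0 // exprn_even_gt0.
Qed.

End PhiCalculus.

(** * Critical points of phi and the distance they determine *)

Section CriticalPoints.
Variables (R : realType) (n : nat).
Implicit Types (g : pt R n) (th tau v w : 'rV[R]_n).

Notation P k tau := (Psi k (dot tau tau)).

Definition crit g th := Omega th /\ forall v, dphi g th v = 0.

Lemma dot_evec u (i : 'I_n) : dot u (evec R i) = u 0 i.
Proof.
rewrite /dot (bigD1 i) //= big1 => [|j /negbTE ji]; rewrite mxE !eqxx /=.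
  by rewrite mulr1 addr0.
by rewrite ji mulr0.
Qed.

Definition gradP g tau : 'rV[R]_n :=
  2 *: ((x1 (xof g) ^+ 2 * P 0 tau + mass g tau * P 1 tau) *: tau
        + (dot tau (xstar (xof g)) * P 0 tau) *: xstar (xof g)).

Lemma dmassPE g tau v : dmassP g tau v = dot (gradP g tau) v.
Proof. by rewrite /dmassP /gradP dotZl dotDl !dotZl (dotC v); ring. Qed.

Lemma dphiE g tau v : dphi g tau v = dot (4 *: tof g - gradP g tau) v.
Proof. by rewrite /dphi dmassPE dotBl dotZl. Qed.

Lemma critP g th : crit g th <-> Omega th /\ 4 *: tof g = gradP g th.
Proof.
split=> -[om H]; split => //; last by move=> v; rewrite dphiE H subrr dot0l.
apply/eqP; rewrite -subr_eq0; apply/eqP/rowP => i.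
by have := H (evec R i); rewrite dphiE dot_evec => ->; rewrite mxE.
Qed.

Definition ddvec g tau w : 'rV[R]_n :=
  (2 * P 0 tau) *: (x1 (xof g) ^+ 2 *: w + dot w (xstar (xof g)) *: xstar (xof g))
  + (2 * (P 1 tau * (2 * dot tau w))) *:
      (x1 (xof g) ^+ 2 *: tau + dot tau (xstar (xof g)) *: xstar (xof g))
  + (2 * (x1 (xof g) ^+ 2 * dot tau w + dot tau (xstar (xof g)) * dot w (xstar (xof g)))
      * (P 1 tau * 2) + mass g tau * (P 2 tau * (2 * dot tau w) * 2)) *: tau
  + (mass g tau * (P 1 tau * 2)) *: w.

Lemma ddmassPE g tau v w : ddmassP g tau v w = dot v (ddvec g tau w).
Proof.
rewrite /ddmassP /ddvec !(dotDr, dotZr) (dotC v w) (dotC v tau); ring.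
Qed.

Lemma ddmassPC g tau v w : ddmassP g tau v w = ddmassP g tau w v.
Proof. by rewrite /ddmassP (dotC w v); ring. Qed.

Lemma mul_hessian g tau v (j : 'I_n) : Omega tau ->
  (v *m \matrix_(i, j) 'D_(evec R i) ('D_(evec R j) (phi g)) tau) 0 j = - (ddvec g tau v) 0 j.
Proof.
move=> om; rewrite mxE (eq_bigr (fun i => - (v 0 i * ddvec g tau (evec R j) 0 i))).
  by rewrite sumrN -/(dot v _) -ddmassPE ddmassPC ddmassPE dotC dot_evec.
move=> i _; rewrite mxE; have [_ ->] := der_derive_phi g (evec R j) (evec R i) om.
by rewrite ddmassPC ddmassPE dotC dot_evec mulrN.
Qed.

Lemma exists_orthogonal u : (2 <= n)%N -> exists2 v : 'rV[R]_n, v != 0 & dot v u = 0.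
Proof.
move=> n2; have i0 : (0 < n)%N by exact: leq_trans n2.
pose a : 'I_n := Ordinal i0; pose b : 'I_n := Ordinal n2.
have [ua|ua] := eqVneq (u 0 a) 0.
  exists (evec R a); last by rewrite dotC dot_evec.
  by apply/eqP => /rowP/(_ a); rewrite !mxE !eqxx => /eqP; rewrite oner_eq0.
exists (u 0 b *: evec R a - u 0 a *: evec R b).
  apply/eqP => /rowP/(_ b); rewrite !mxE !eqxx /= mulr0 mulr1 sub0r => /eqP.
  by rewrite oppr_eq0 (negbTE ua).
by rewrite dotBl !dotZl !(dotC (evec _ _)) !dot_evec mulrC subrr.
Qed.

(** If [x1] and theta.xs both vanish, the Hessian has rank at most one and kills any vector
    orthogonal to [xs], which exists in dimension at least two; otherwise it is definite by
    [ddmassP_gt0]. *)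
Lemma MsetP g : (2 <= n)%N -> Mset g <->
  exists2 th, crit g th & x1 (xof g) != 0 \/ dot th (xstar (xof g)) != 0.
Proof.
move=> n2; split.
  move=> [th [om D1 _ det0]]; exists th.
    apply/critP; split => //; apply/eqP; rewrite -subr_eq0; apply/eqP/rowP => i.
    have [_] := D1 i; have [_ ->] := der_phi g (evec R i) om.
    by rewrite dphiE dot_evec => ->; rewrite mxE.
  apply: contrapT => /not_orP[/negP]; rewrite negbK => /eqP X0.
  move=> /negP; rewrite negbK => /eqP a0; move/negP: det0; apply; apply/det0P.
  have [v v0 vx] := exists_orthogonal (xstar (xof g)) n2.
  have dv0 : ddvec g th v = 0.
    by rewrite /ddvec /mass X0 a0 vx !(expr0n, mul0r, mulr0, scale0r, scaler0, addr0).
  by exists v => //; apply/rowP => j; rewrite mul_hessian // dv0 !mxE oppr0.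
move=> [th [om D0] Hxa]; exists th; split => //.
- by move=> i; have [d1 d2] := der_phi g (evec R i) om; split => //; rewrite d2 D0.
- by move=> i j; have [] := der_derive_phi g (evec R j) (evec R i) om.
- apply/det0P => -[v v0 vM].
  have := ddmassP_gt0 om Hxa v0.
  have dv0 : ddvec g th v = 0.
    apply/rowP => j; apply: oppr_inj; rewrite -mul_hessian // vM !mxE oppr0 //.
  by rewrite ddmassPE dv0 dot0r ltxx.
Qed.

(** Pairing the critical equation with theta and using that [mass g] is quadratic gives phi = |x|^2
    + mass (P + 2 |theta|^2 P'); the Riccati equation removes P'. *)
Lemma crit_phi g th : crit g th -> phi g th = dot (xof g) (xof g)
  + mass g th * (1 - 2 * P 0 th + dot th th * P 0 th ^+ 2).
Proof.
move=> /critP[om E]; rewrite phiE // -dotZl E /gradP dotZl dotDl !dotZl (dotC (xstar _)).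
have Ric := Psi_riccati ((OmegaP th).1 om).
have -> : 1 - 2 * P 0 th + dot th th * P 0 th ^+ 2 = 2 * (dot th th * P 1 th) + P 0 th by lra.
by rewrite /mass; ring.
Qed.

Lemma Psi_ssin c : 0 < c < pi ->
  1 - 2 * Psi 0 (c ^+ 2) + c ^+ 2 * Psi 0 (c ^+ 2) ^+ 2 = ((c / sin c) ^+ 2 - 1) / c ^+ 2 :> R.
Proof.
move=> /[dup] cpi /andP[c0 cp]; have s0 : sin c != 0 by rewrite gt_eqF // sin_gt0_pi.
have cn : c != 0 by rewrite gt_eqF.
have h : 0 <= c < pi by rewrite ltW.
have := fK_Psi h; rewrite /fK (negbTE cn) /cot => E.
have -> : Psi 0 (c ^+ 2) = (1 - c * (cos c / sin c)) / c ^+ 2.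
  by rewrite E mulrC mulKf // expf_neq0.
have CS : sin c ^+ 2 = 1 - cos c ^+ 2 by rewrite sin2cos2.
apply: (mulIf (expf_neq0 2 s0)); apply: (mulIf (expf_neq0 2 cn)).
transitivity (c ^+ 2 * (sin c ^+ 2 + cos c ^+ 2) - sin c ^+ 2); first by field; rewrite cn s0.
rewrite [sin c ^+ 2 + _]addrC cos2Dsin2; by field; rewrite cn s0.
Qed.

Lemma crit_phi_ssin g th : crit g th -> phi g th =
  ssin (enorm th) ^+ 2 * x1 (xof g) ^+ 2 + enorm (xstar (xof g)) ^+ 2
  + (ssin (enorm th) ^+ 2 - 1) * dot (xstar (xof g)) (unitv th) ^+ 2.
Proof.
move=> ct; rewrite crit_phi // dotS enorm_sqr; have [om _] := ct.
have [->|th0] := eqVneq th 0.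
  by rewrite enorm0 /mass !dot0l /ssin eqxx unitv0 dot0r; ring.
have c0 : 0 < enorm th by rewrite enorm_gt0.
have cpi : 0 < enorm th < pi by rewrite c0.
have qE : dot th th = enorm th ^+ 2 by rewrite enorm_sqr.
rewrite /mass qE (Psi_ssin cpi) dot_unitvE (dotC th) /ssin (gt_eqF c0).
set c := enorm th in c0 cpi *; set k := c / sin c.
by field; rewrite gt_eqF.
Qed.

(** The critical equation for theta = c e is the end-point condition of the helix with turning angle
    2 c, once its coefficients are rewritten trigonometrically. *)
Lemma ccdistE_le_crit g th : crit g th -> (ccdistE g <= (Num.sqrt (phi g th))%:E)%E.
Proof.
move=> ct; have := crit_phi_ssin ct; have [om E] := (critP g th).1 ct.
have [th0 _|th0 phE] := eqVneq th 0.
  have -> : phi g th = dot (xof g) (xof g) by rewrite crit_phi // /mass th0 !dot0l; ring.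
  apply: ccdistE_le_line; apply/rowP => i.
  have := congr1 (fun v : 'rV_n => v 0 i) E.
  by rewrite /gradP th0 !dot0l !mxE; lra.
set c := enorm th in phE; have c0 : 0 < c by rewrite enorm_gt0.
have cpi : 0 < c < pi by rewrite c0.
have cn : c != 0 by rewrite gt_eqF.
have s0 : sin c != 0 by rewrite gt_eqF // sin_gt0_pi.
have h : 0 <= c < pi by rewrite ltW.
pose e := unitv th; have thE : th = c *: e by rewrite unitvK.
have ee : dot e e = 1 by exact: dot_unitv.
have thth : dot th th = c ^+ 2 by rewrite enorm_sqr.
set X := x1 (xof g) in phE; set xs := xstar (xof g) in phE.
pose b := dot e xs.
have a_b : dot th xs = c * b by rewrite thE dotZl.
have fE := fK_Psi h; rewrite /fK (negbTE cn) in fE.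
have P0E : Psi 0 (c ^+ 2) = (1 - c * cot c) / c ^+ 2.
  by rewrite fE mulrC mulKf // expf_neq0.
have Ric : 2 * (c ^+ 2 * Psi 1 (c ^+ 2)) + 3 * Psi 0 (c ^+ 2) = 1 + c ^+ 2 * Psi 0 (c ^+ 2) ^+ 2.
  by apply: Psi_riccati; rewrite -thth; exact/OmegaP.
(* Both sides are the derivative of s |-> 1 - s cot s at c. *)
have radial : 2 * c * (Psi 0 (c ^+ 2) + c ^+ 2 * Psi 1 (c ^+ 2)) = (c - sin c * cos c) / sin c ^+ 2.
  have -> : 2 * c * (Psi 0 (c ^+ 2) + c ^+ 2 * Psi 1 (c ^+ 2)) =
     c * (1 - Psi 0 (c ^+ 2) + c ^+ 2 * Psi 0 (c ^+ 2) ^+ 2).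
    move: Ric; set p := Psi 0 _; set q := Psi 1 _ => Ric.
    have -> : 1 - p + c ^+ 2 * p ^+ 2 = 2 * (c ^+ 2 * q) + 2 * p by lra.
    by ring.
  rewrite P0E /cot; apply: (mulIf (expf_neq0 2 s0)).
  transitivity (c * (sin c ^+ 2 + cos c ^+ 2) - sin c * cos c); first by field; rewrite cn s0.
  by rewrite [sin c ^+ 2 + _]addrC cos2Dsin2; field.
have tE : tof g = (4^-1 * (X ^+ 2 + b ^+ 2) * ((c - sin c * cos c) / sin c ^+ 2)) *: e
    + (2^-1 * b * ((1 - c * cot c) / c)) *: (xs - b *: e).
  apply/rowP => i; have := congr1 (fun v : 'rV_n => v 0 i) E.
  rewrite /gradP /mass thth -/X -/xs a_b -radial thE !mxE => H.
  apply: (mulfI (_ : 4 != 0 :> R)) => //; rewrite H P0E -[X in _ = 4 * (_ + 2^-1 * b * (X / c) * _)]/(1 - c * cot c).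
  by field.
have := ccdistE_le_geodesic cpi ee tE; rewrite -/X -/xs -/b phE /ssin (negbTE cn).
rewrite enorm_sqr (dotC xs) -/e -/b.
by congr (_ <= (Num.sqrt _)%:E)%E; ring.
Qed.

(** Common conclusion for interior and boundary parameters: a bound sqrt L on the distance and
    values of phi approaching L pin everything down, as phi never exceeds the squared distance. *)
Lemma ccdistE_sup g (L : R) : 0 <= L -> (ccdistE g <= (Num.sqrt L)%:E)%E ->
  (forall eps, 0 < eps -> exists2 tau, Omega tau & L - eps <= phi g tau) ->
  [/\ ccdistE g = (Num.sqrt L)%:E, ccdist g ^+ 2 = L &
    (ccdistE g * ccdistE g)%E = ereal_sup [set (phi g tau)%:E | tau in Omega (n:=n)]].
Proof.
move=> L0 le H; have d0 := ccdistE_ge0 g.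
have [r rE] : exists r, ccdistE g = r%:E.
  by move: d0 le; case: (ccdistE g) => // r _ _; exists r.
rewrite rE lee_fin in d0 le.
have r2 : r ^+ 2 = L.
  apply/le_anti/andP; split; first by rewrite -(sqr_sqrtr L0) ler_pXn2r ?nnegrE ?sqrtr_ge0.
  apply/ler_addgt0Pr => eps eps0; have [tau om tl] := H _ eps0.
  have := phi_le_ccdistE g om; rewrite rE -EFinM lee_fin -expr2; lra.
have rL : r = Num.sqrt L by rewrite -r2 sqrtr_sqr ger0_norm.
split; rewrite ?rE ?rL // ?/ccdist ?rE //=.
rewrite -rL -EFinM -expr2; apply/le_anti/andP; split.
  apply/lee_addgt0Pr => eps eps0; have [tau om tl] := H _ eps0.
  apply: (@le_trans _ _ ((phi g tau)%:E + eps%:E)%E).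
    by rewrite -EFinD lee_fin r2; lra.
  by apply: leeD => //; apply: ereal_sup_ubound; exists tau.
apply: ge_ereal_sup => _ [tau om <-]; have := phi_le_ccdistE g om.
by rewrite rE -EFinM -expr2.
Qed.

Lemma crit_phi_ge0 g th : crit g th -> 0 <= phi g th.
Proof.
move=> ct; have := phi_le_ccdistE g ct.1; have := ccdistE_le_crit ct.
have := crit_phi_ssin ct; have [om _] := ct.
have ss : 1 <= ssin (enorm th) ^+ 2.
  rewrite /ssin; case: eqVneq => [_|t0]; first by rewrite expr1n.
  have c0 : 0 < enorm th by rewrite lt_def t0 enorm_ge0.
  rewrite exprn_ege1 // ler_pdivlMr ?sin_gt0_pi ?c0 // mul1r sin_le_id // ltW //.
move=> -> _ _; rewrite !addr_ge0 ?sqr_ge0 // mulr_ge0 ?sqr_ge0 ?subr_ge0 //.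
Qed.

Lemma crit_ccdist g th : crit g th ->
  [/\ ccdistE g = (Num.sqrt (phi g th))%:E, ccdist g ^+ 2 = phi g th &
    (ccdistE g * ccdistE g)%E = ereal_sup [set (phi g tau)%:E | tau in Omega (n:=n)]].
Proof.
move=> ct; apply: ccdistE_sup; [exact: crit_phi_ge0|exact: ccdistE_le_crit|].
by move=> eps eps0; exists th; [exact: ct.1|lra].
Qed.

End CriticalPoints.

(** * Uniqueness of a nondegenerate critical point *)

Section Uniqueness.
Variables (R : realType) (n : nat).
Implicit Types (g : pt R n) (th tau v w : 'rV[R]_n).

Lemma enormD_le m (u v : 'rV[R]_m) : enorm (u + v) <= enorm u + enorm v.
Proof.
rewrite -(ler_pXn2r (_ : 0 < 2)%N) ?nnegrE ?addr_ge0 ?enorm_ge0 //.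
rewrite enorm_sqr dotDl !dotDr (dotC v u) sqrrD !enorm_sqr.
by have := dot_le u v; lra.
Qed.

Lemma Omega_segment th th' (u : R) : Omega th -> Omega th' -> 0 <= u <= 1 ->
  Omega (th + u *: (th' - th)).
Proof.
rewrite /Omega => om om' /andP[u0 u1].
have -> : th + u *: (th' - th) = (1 - u) *: th + u *: th'.
  by apply/rowP => i; rewrite !mxE; ring.
apply: (le_lt_trans (enormD_le _ _)); rewrite !enormZ !ger0_norm ?subr_ge0 //.
have := enorm_ge0 th; have := enorm_ge0 th'.
move: (enorm th) (enorm th') om om' => a b aa bb b0 a0.
have [->|un] := eqVneq u 0; first by lra.
have up : 0 < u by rewrite lt_def un.
have : u * b < u * pi by rewrite ltr_pM2l.
have : (1 - u) * a <= (1 - u) * pi by rewrite ler_wpM2l ?subr_ge0 // ltW.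
lra.
Qed.

Lemma der_line (f : 'rV[R]_n -> R) x v (u0 df : R) : is_derive (x + u0 *: v) v f df ->
  is_derive u0 1 (fun u => f (x + u *: v)) df.
Proof.
move=> /is_derive_lineP H.
have -> : (fun u => f (x + u *: v)) = (fun u => (fun s : R => f (x + u0 *: v + s *: v)) (u - u0)).
  by apply/funext => u /=; rewrite -addrA -scalerDl (addrC u0) subrK.
have ds : is_derive u0 (1 : R) (fun u => u - u0) 1.
  by apply: der_eq (derB (is_derive_id u0 (1 : R)) (derC u0 u0 (1 : R))) _; rewrite subr0.
have {}H : is_derive (u0 - u0) 1 (fun s : R => f (x + u0 *: v + s *: v)) df by rewrite subrr.
by rewrite -[df]mulr1; exact: (der_comp (f := fun u => u - u0) (x := u0) H ds).
Qed.

Lemma ddmassP_ge0 g tau v : Omega tau -> 0 <= ddmassP g tau v v.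
Proof.
move=> om; have [->|v0] := eqVneq v 0.
  by rewrite /ddmassP !(dot0l, dot0r) !(mulr0, mul0r, addr0).
have [X0|X0] := eqVneq (x1 (xof g)) 0; last by apply: ltW; apply: ddmassP_gt0 => //; left.
have [a0|a0] := eqVneq (dot tau (xstar (xof g))) 0; last by apply: ltW; apply: ddmassP_gt0 => //; right.
rewrite /ddmassP /mass X0 a0 !(expr0n, mul0r, mulr0, add0r, addr0) /=.
have := Psi_ge0 0 ((OmegaP tau).1 om) => p0.
by rewrite mulr_ge0 // mulr_ge0 // -expr2 sqr_ge0.
Qed.

(** Along the segment from th to th' the directional derivative of phi does not increase and
    vanishes at both ends, yet it decreases strictly at th. *)
Lemma crit_unique g th th' : crit g th -> crit g th' ->
  x1 (xof g) != 0 \/ dot th (xstar (xof g)) != 0 -> th' = th.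
Proof.
move=> [om ct] [om' ct'] Hxa; apply/eqP; rewrite -subr_eq0; apply: contrapT => /negP v0.
set v := th' - th in v0.
have oms u : 0 <= u <= 1 -> Omega (th + u *: v) by exact: Omega_segment.
pose f u := dphi g (th + u *: v) v.
have df (u : R) : 0 <= u <= 1 -> is_derive u (1 : R) f (- ddmassP g (th + u *: v) v v).
  by move=> u01; apply: (der_line (f := fun s => dphi g s v)); apply: der_dphi; exact: oms.
have f0 : f 0 = 0 by rewrite /f scale0r addr0 ct.
have f1 : f 1 = 0 by rewrite /f scale1r /v addrC subrK ct'.
have noninc (u : R) : 0 <= u -> u < 1 -> f 1 <= f u.
  move=> u0 u1; have cf : {within `[u, 1], continuous f}.
    apply: derivable_within_continuous => s; rewrite in_itv /= => /andP[us s1].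
    by have [] : is_derive s (1 : R) f (- ddmassP g (th + s *: v) v v) by apply: df; lra.
  have [|c] := MVT u1 _ cf (df := fun s => - ddmassP g (th + s *: v) v v).
    by move=> s; rewrite in_itv /= => /andP[us s1]; apply: df; lra.
  rewrite in_itv /= => /andP[uc c1] E; rewrite -subr_le0 E.
  rewrite mulr_le0_ge0 ?oppr_le0 ?ddmassP_ge0 ?subr_ge0 ?ltW //.
  by apply: oms; lra.
have l0 : 0 < ddmassP g th v v by exact: ddmassP_gt0.
have d0 : is_derive (0 : R) 1 f (- ddmassP g th v v).
  by have := df 0; rewrite scale0r addr0 lexx ler01; apply.
have l20 : 0 < ddmassP g th v v / 2 by rewrite divr_gt0.
have [eta eta0 H] := is_derive_dist d0 l20.
pose h := Num.min (eta / 2) (1 / 2).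
have h0 : 0 < h by rewrite lt_min !divr_gt0.
have he : h <= eta / 2 by rewrite ge_min lexx.
have h1 : h <= 1 / 2 by rewrite ge_min lexx orbT.
have := H h; rewrite gtr0_norm // add0r f0 subr0 => Hh.
have {Hh} : `|f h - - ddmassP g th v v * h| <= ddmassP g th v v / 2 * h by apply: Hh; lra.
rewrite ler_norml => /andP[_].
have h_lt1 : h < 1 by lra.
have := noninc h (ltW h0) h_lt1; rewrite f1.
have : 0 < ddmassP g th v v * h by rewrite mulr_gt0.
lra.
Qed.

End Uniqueness.

(** * Critical points by maximization *)

Section Maximum.
Variables (R : realType) (n : nat).
Implicit Types (g : pt R n) (th tau v : 'rV[R]_n).

Lemma coord_sqr_le m (v : 'rV[R]_m) i : v 0 i ^+ 2 <= dot v v.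
Proof.
by rewrite /dot (bigD1 i) //= -expr2 lerDl sumr_ge0 // => j _; rewrite -expr2 sqr_ge0.
Qed.

Lemma continuous_dot_shift m (c v : 'rV[R]_m) :
  {for v, continuous (fun s : 'rV[R]_m => dot (s - c) (s - c))}.
Proof.
have sub i : {for v, continuous (fun s : 'rV[R]_m => (s - c) 0 i)}.
  rewrite (_ : (fun s => _) = (fun s : 'rV[R]_m => s 0 i + (- c 0 i))).
    apply: continuous_add; first exact: (@coord_continuous R 1 m 0 i).
    exact: (@cst_continuous _ _ (- c 0 i)).
  by apply/funext => s; rewrite !mxE.
by apply: continuous_sum => i; apply: continuous_mul.
Qed.

Lemma compact_enorm_ball m (c : 'rV[R]_m) (rho : R) : 0 <= rho ->
  compact [set v : 'rV[R]_m | enorm (v - c) <= rho].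
Proof.
move=> rho0.
pose box i := `[c 0 i - rho, c 0 i + rho]%classic.
apply: (@subclosed_compact _ _ [set v : 'rV[R]_m | forall i, box i (v ord0 i)]).
- have -> : [set v : 'rV[R]_m | enorm (v - c) <= rho] =
      (fun v : 'rV[R]_m => dot (v - c) (v - c)) @^-1` [set x : R | x <= rho ^+ 2].
    apply/seteqP; split => v /=; rewrite -enorm_sqr => h.
      by rewrite ler_pXn2r ?nnegrE ?enorm_ge0.
    by move: h; rewrite ler_pXn2r ?nnegrE ?enorm_ge0.
  have cl : closed [set x : R | x <= rho ^+ 2] by exact: closed_le.
  apply: (@preimage_closed _ _ (fun v : 'rV[R]_m => dot (v - c) (v - c)) _ _ cl).
  by move=> v _; exact: continuous_dot_shift.
- exact: (@rV_compact _ _ box (fun=> @segment_compact _ _ _)).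
- move=> v /= h i; rewrite /box /= in_itv /=.
  suff : `|v ord0 i - c 0 i| <= rho by rewrite ler_distl.
  rewrite -(ler_pXn2r (_ : 0 < 2)%N) ?nnegrE // real_normK ?num_real //.
  have := coord_sqr_le (v - c) i; rewrite !mxE => /le_trans; apply.
  by rewrite -enorm_sqr ler_pXn2r ?nnegrE ?enorm_ge0.
Qed.

Lemma continuous_dotr m (u v : 'rV[R]_m) : {for v, continuous (fun s : 'rV[R]_m => dot u s)}.
Proof.
apply: continuous_sum => i; apply: continuous_mul; first exact: (@cst_continuous _ _ (u 0 i)).
exact: (@coord_continuous R 1 m 0 i).
Qed.

Lemma continuous_Psi_dot k tau : Omega tau ->
  {for tau, continuous (fun s : 'rV[R]_n => Psi k (dot s s))}.
Proof.
move=> om; apply: (continuous_comp1 (f := fun s : 'rV[R]_n => dot s s)).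
  exact: continuous_dot.
apply/differentiable_continuous/derivable1_diffP.
by have [] := Psi_derive k (Omega_norm om).
Qed.

Lemma continuous_near (T : topologicalType) (f h : T -> R) (x : T) :
  (\forall y \near x, f y = h y) -> {for x, continuous f} -> {for x, continuous h}.
Proof.
move=> fh cf; have fx : f x = h x := nbhs_singleton fh.
apply/cvgrPdist_lt => e e0; have /cvgrPdist_lt/(_ _ e0) H := cf.
by apply: filterS2 fh H => y fy; rewrite -fx -fy.
Qed.

Lemma continuous_phi g tau : Omega tau -> {for tau, continuous (phi g)}.
Proof.
move=> om.
have cP : {for tau, continuous (fun s => dot (xof g) (xof g) + 4 * dot (tof g) s +
    (-1) * (x1 (xof g) ^+ 2 * dot s s + dot (xstar (xof g)) s * dot (xstar (xof g)) s)
      * Psi 0 (dot s s))}.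
  have cst (c : R) : {for tau, continuous (fun _ : 'rV[R]_n => c)}.
    exact: (@cst_continuous _ _ c).
  apply: continuous_add.
    by apply: continuous_add => //; apply: continuous_mul => //; exact: continuous_dotr.
  apply: continuous_mul; last exact: continuous_Psi_dot.
  apply: continuous_mul => //; apply: continuous_add; apply: continuous_mul => //;
    by [exact: continuous_dot|exact: continuous_dotr].
apply: continuous_near cP; apply: filterS (Omega_near om) => s oms.
by rewrite phiE // /mass (dotC s (xstar _)); ring.
Qed.

Lemma local_max_crit g c (rho : R) : Omega c -> 0 < rho ->
  (forall tau, enorm (tau - c) < rho -> Omega tau /\ phi g tau <= phi g c) -> crit g c.
Proof.
move=> om rho0 cmax; split => // v.
pose eta := rho / (enorm v + 1).
have v1 : 0 < enorm v + 1 by rewrite ltr_wpDl ?enorm_ge0.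
have eta0 : 0 < eta by rewrite divr_gt0.
have inK (u : R) : `|u| < eta -> enorm (c + u *: v - c) < rho.
  move=> ue; rewrite addrC addKr enormZ.
  apply: (@le_lt_trans _ _ (`|u| * (enorm v + 1))); first by rewrite ler_wpM2l // lerDl.
  by rewrite -ltr_pdivlMr.
pose f (u : R) := phi g (c + u *: v).
have i0 : (0 : R) \in `](- eta), eta[ by rewrite in_itv /= oppr_lt0 eta0.
have dfu (u : R) : u \in `](- eta), eta[ -> derivable f u 1.
  rewrite in_itv /= -ltr_norml => /inK/cmax[omu _].
  by have [] := der_line (der_phi g v omu).
have fle (u : R) : u \in `](- eta), eta[ -> f u <= f 0.
  rewrite in_itv /= -ltr_norml => /inK/cmax[_].
  by rewrite /f scale0r addr0.
have ee : - eta <= eta by lra.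
have df0 : is_derive (0 : R) 1 f 0 := derive1_at_max ee dfu i0 fle.
have := (is_derive_lineP (phi g) c v (dphi g c v)).1 (der_phi g v om).
by move=> /is_derive_unique/(_ df0).
Qed.

(** A point inside the ball beating the whole sphere forces the maximum into the interior. The
    centre is free: it is 0 for existence and a known critical point for stability. *)
Lemma max_crit g c0 (rho : R) tau0 :
  (forall v, enorm (v - c0) <= rho -> Omega v) -> enorm (tau0 - c0) < rho ->
  (forall tau, enorm (tau - c0) = rho -> phi g tau < phi g tau0) ->
  exists2 th, crit g th & enorm (th - c0) < rho.
Proof.
move=> KO t0r Hs; have rho0 : 0 <= rho by rewrite ltW // (le_lt_trans (enorm_ge0 _) t0r).
pose K := [set v : 'rV[R]_n | enorm (v - c0) <= rho].
have [|||c /set_mem cK cmax] := @EVT_max_rV R n (phi g) K.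
- by exists tau0; exact: ltW.
- exact: compact_enorm_ball.
- by apply: continuous_in_subspaceT => v /set_mem/KO; exact: continuous_phi.
have t0K : phi g tau0 <= phi g c by apply: cmax; apply/mem_set; exact: ltW.
have cr : enorm (c - c0) < rho.
  rewrite lt_neqAle cK andbT; apply/eqP => /Hs; rewrite ltNge t0K //.
exists c => //; have d0 : 0 < rho - enorm (c - c0) by rewrite subr_gt0.
apply: (local_max_crit (KO _ cK) d0) => tau td.
have tK : K tau.
  rewrite /K /=; have -> : tau - c0 = (tau - c) + (c - c0) by rewrite addrA subrK.
  by rewrite (le_trans (enormD_le _ _)) // -lerBrDr ltW.
by split; [exact: KO|apply: cmax; exact/mem_set].
Qed.

End Maximum.

(** * The explicit set is the complement of [Mset] *)

Section CutSet.
Variables (R : realType) (n : nat).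
Implicit Types (g : pt R n) (th tau v : 'rV[R]_n).

(** The coefficient, not the length, of the part of t along [xs]; it is 0 for [xs = 0] because
    division by 0 gives 0. In these terms the explicit set is x1 = 0 and pi [tpar]^2 <= [tnor]. *)
Definition tpar g : R :=
  dot (xstar (xof g)) (tof g) / dot (xstar (xof g)) (xstar (xof g)).
Definition tnor g : R := enorm (tperp (xstar (xof g)) (tof g)).

Lemma dot_tof g tau : dot (tof g) tau =
  dot (tperp (xstar (xof g)) (tof g)) tau + tpar g * dot tau (xstar (xof g)).
Proof. by rewrite tperpE dotBl dotZl (dotC tau) /tpar; ring. Qed.

Lemma Psi_lower_norm tau : Omega tau ->
  1 <= Psi 0 (dot tau tau) * (pi * (pi - enorm tau)).
Proof. by move=> om; rewrite -enorm_sqr; apply: Psi_lower; rewrite enorm_ge0. Qed.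

(** The left side, maximized over a, equals 4 c^2 / p, and 1 / p <= q. *)
Lemma quad_le (c a p q : R) : 0 < p -> 1 <= p * q -> 4 * c * a - a ^+ 2 * p <= 4 * c ^+ 2 * q.
Proof.
move=> p0 pq; rewrite -(ler_pM2l p0).
have := sqr_ge0 (a * p - 2 * c); have := sqr_ge0 c => c2 H.
have : c ^+ 2 <= c ^+ 2 * (p * q) by rewrite ler_peMr.
move: H; rewrite sqrrB; lra.
Qed.

(** The terms containing tau.xs are replaced by their maximum over that quantity, and 1 / P is
    bounded by pi (pi - |tau|) through [Psi_lower]. *)
Lemma phi_upper g tau : Omega tau -> phi g tau <= dot (xof g) (xof g)
  + 4 * dot (tperp (xstar (xof g)) (tof g)) tau + 4 * tpar g ^+ 2 * (pi * (pi - enorm tau))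
  - x1 (xof g) ^+ 2 * dot tau tau * Psi 0 (dot tau tau).
Proof.
move=> om; rewrite phiE // dot_tof /mass.
have := quad_le (tpar g) (dot tau (xstar (xof g)))
  (Psi0_gt0 ((OmegaP tau).1 om)) (Psi_lower_norm om).
lra.
Qed.

Lemma tnor_ge0 g : 0 <= tnor g. Proof. exact: enorm_ge0. Qed.

Lemma explicit_tpar g : explicit_set g -> x1 (xof g) = 0 /\ pi * tpar g ^+ 2 <= tnor g.
Proof.
move=> /explicit_setP /= [x0 H]; split=> //; rewrite /tpar.
have [->|xs0] := eqVneq (xstar (xof g)) 0.
  by rewrite !dot0l mul0r expr0n mulr0 tnor_ge0.
have D0 : 0 < dot (xstar (xof g)) (xstar (xof g)) by rewrite lt_def dot_eq0 xs0 dot_ge0.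
by rewrite expr_div_n mulrA ler_pdivrMr ?exprn_gt0 // (mulrC (tnor g)).
Qed.

Lemma dot_xof g : x1 (xof g) = 0 -> dot (xof g) (xof g) = dot (xstar (xof g)) (xstar (xof g)).
Proof. by move=> x0; rewrite dotS x0 mul0r add0r. Qed.

Lemma phi_perp g (s : R) : x1 (xof g) = 0 -> 0 <= s < pi ->
  let tau := s *: unitv (tperp (xstar (xof g)) (tof g)) in
  Omega tau /\ phi g tau = dot (xof g) (xof g) + 4 * s * tnor g.
Proof.
move=> x0 /andP[s0 spi]; set e := unitv _ => tau.
have om : Omega tau.
  rewrite /Omega enormZ ger0_norm //; apply: le_lt_trans spi; rewrite ler_piMr // /e.
  have [e0|e0] := eqVneq (tperp (xstar (xof g)) (tof g)) 0.
    by rewrite e0 unitv0 enorm0 ler01.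
  by rewrite /enorm dot_unitv // sqrtr1.
split=> //; rewrite phiE // /mass x0 expr0n mul0r add0r.
have ex : dot e (xstar (xof g)) = 0 by rewrite dotC dot_unitvE dotC dot_tperp mul0r.
rewrite dot_tof dotZl ex mulr0 expr0n mul0r subr0 mulr0 addr0 dotZr /e dot_unitvE.
rewrite -(enorm_sqr (tperp (xstar (xof g)) (tof g))) -/(tnor g).
have [->|e0] := eqVneq (tnor g) 0; first by rewrite expr0n !(mulr0, mul0r).
by field.
Qed.

(** On the ray along [tperp] phi is affine with slope 4 [tnor], so L is approached at the boundary
    of the ball, and the closed helix gives the other bound. *)
Lemma cut_ccdist g : explicit_set g ->
  let L := dot (xof g) (xof g) + 4 * pi * tnor g in
  [/\ ccdistE g = (Num.sqrt L)%:E, ccdist g ^+ 2 = L &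
    (ccdistE g * ccdistE g)%E = ereal_sup [set (phi g tau)%:E | tau in Omega (n:=n)]].
Proof.
move=> eg L; have [x0 _] := explicit_tpar eg; have T0 := tnor_ge0 g.
have pi0 : 0 < pi :> R by exact: pi_gt0.
apply: ccdistE_sup.
- by rewrite addr_ge0 ?dot_ge0 // mulr_ge0 // mulr_ge0 // ltW.
- by have := ccdistE_le_cut eg; rewrite /L dot_xof.
- move=> eps eps0; pose d := Num.min pi (eps / (4 * tnor g + 1)).
  have T1 : 0 < 4 * tnor g + 1 by lra.
  have d0 : 0 < d by rewrite lt_min pi0 divr_gt0.
  have d1 : d <= pi by rewrite ge_min lexx.
  have d2 : d * (4 * tnor g + 1) <= eps by rewrite -ler_pdivlMr // ge_min lexx orbT.
  have sP : 0 <= pi - d < pi by lra.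
  have [om phE] := phi_perp x0 sP; eexists; first exact: om.
  by rewrite phE /L; nra.
Qed.

(** A nondegenerate critical point has theta.xs nonzero, so its part orthogonal to [xs] is strictly
    shorter than theta; this makes phi(theta) strictly smaller than the known squared distance,
    which it should equal. If [tnor] is 0 then t = 0, and the strictness comes from the term
    (theta.xs)^2 P. *)
Lemma explicit_not_Mset g : (2 <= n)%N -> explicit_set g -> ~ Mset g.
Proof.
move=> n2 eg /MsetP -/(_ n2)[th ct Hxa]; have [om _] := ct.
have [x0 kT] := explicit_tpar eg.
have [_ d1 _] := cut_ccdist eg; have [_ d2 _] := crit_ccdist ct.
case: Hxa => [|a0]; first by rewrite x0 eqxx.
have := d1; rewrite d2 phiE // dot_tof /mass x0 expr0n mul0r add0r.
set tp := tperp _ _; set a := dot th _ in a0 *; set D := dot (xof g) (xof g) => E.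
have p0 := Psi0_gt0 ((OmegaP th).1 om).
have H := quad_le (tpar g) a p0 (Psi_lower_norm om).
have xs0 : xstar (xof g) != 0 by apply: contraNneq a0 => xs0; rewrite /a xs0 dot0r.
have D0 : 0 < dot (xstar (xof g)) (xstar (xof g)) by rewrite lt_def dot_eq0 xs0 dot_ge0.
have a2 : 0 < a ^+ 2 by rewrite exprn_even_gt0.
have T0 := tnor_ge0 g; have pi0 : 0 < pi :> R by exact: pi_gt0.
have sp : enorm th < pi by exact: om.
have [Tz|Tn] := eqVneq (tnor g) 0.
  have kz : tpar g = 0.
    apply/eqP; rewrite -sqrf_eq0; apply/eqP/le_anti; rewrite sqr_ge0 andbT.
    by rewrite -(pmulr_rle0 _ pi0) -Tz.
  have tp0 : tp = 0 by apply/eqP; rewrite -enorm_eq0 -/(tnor g) Tz.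
  have : 0 < a ^+ 2 * Psi 0 (dot th th) by rewrite mulr_gt0.
  by move: E; rewrite kz tp0 dot0l Tz; lra.
have Tp : 0 < tnor g by rewrite lt_def Tn.
pose u := th - (a / dot (xstar (xof g)) (xstar (xof g))) *: xstar (xof g).
have tu : dot tp th = dot tp u by rewrite /u dotBr dotZr dot_tperp mulr0 subr0.
have uu : dot u u = dot th th - a ^+ 2 / dot (xstar (xof g)) (xstar (xof g)).
  rewrite /u !(dotBl, dotBr, dotZl, dotZr) (dotC (xstar _) th) -/a.
  by field; rewrite gt_eqF.
have ult : enorm u < enorm th.
  rewrite -(ltr_pXn2r (_ : 0 < 2)%N) ?nnegrE ?enorm_ge0 // !enorm_sqr uu.
  by rewrite gtrBl divr_gt0.
have : dot tp th < tnor g * enorm th.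
  by rewrite tu (le_lt_trans (dot_le _ _)) // ltr_pM2l.
have : 4 * tpar g ^+ 2 * (pi * (pi - enorm th)) <= 4 * tnor g * (pi - enorm th).
  have : pi * tpar g ^+ 2 * (pi - enorm th) <= tnor g * (pi - enorm th).
    by rewrite ler_wpM2r // subr_ge0 ltW.
  by move: (pi - enorm th) => q; lra.
by move: E; lra.
Qed.

(* Test point [tau = c v xs + (pi - v) e] with [e] a unit vector orthogonal to [xs];
   as [v -> 0] the excess of [phi] over [|xs|^2 + 4 pi T] is [4 v (pi k^2 - T)]. *)
Lemma exists_phi_gt g : (2 <= n)%N -> x1 (xof g) = 0 -> tnor g < pi * tpar g ^+ 2 ->
  exists2 tau, Omega tau & dot (xof g) (xof g) + 4 * pi * tnor g < phi g tau.
Proof.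
move=> n2 x0 lt; set T := tnor g in lt *; set k := tpar g in lt.
have T0 : 0 <= T by exact: tnor_ge0.
have pi0 : 0 < pi :> R by exact: pi_gt0.
set xs := xstar (xof g); set D := dot xs xs.
have k0 : k != 0 by apply: contraTneq lt => ->; rewrite expr0n mulr0 -leNgt.
have D0 : 0 < D.
  rewrite lt_def dot_ge0 andbT; apply: contraNneq k0.
  by rewrite /k /tpar -/xs -/D => ->; rewrite invr0 mulr0.
have [e ee [ex te]] : exists2 e, dot e e = 1 & dot e xs = 0 /\ dot (tperp xs (tof g)) e = T.
  have [t0|t0] := eqVneq (tperp xs (tof g)) 0.
    have [v v0 vx] := exists_orthogonal xs n2.
    exists (unitv v); first exact: dot_unitv.
    by rewrite dotC dot_unitvE dotC vx mul0r /T /tnor t0 dot0l enorm0.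
  exists (unitv (tperp xs (tof g))); first exact: dot_unitv.
  rewrite dotC !dot_unitvE (dotC xs) dot_tperp mul0r -enorm_sqr expr2 mulfK //.
  by rewrite enorm_eq0.
(* Maximizes 4 k c D - c^2 D^2 / pi, the limit of the gain per unit v; the maximum is 4 pi k^2. *)
pose c := 2 * pi * k / D.
(* A lower bound for the excess of phi divided by v, with psi estimated by [Psi_upper]; unlike that
   quotient it extends continuously to v = 0. *)
pose h (v : R) := 4 * k * c * D - 4 * T - c ^+ 2 * D ^+ 2 * (2 * pi ^+ 2)
   * ((pi - v) ^+ 2 * (2 * pi - v * (1 + c ^+ 2 * D)))^-1.
have h0 : 0 < h 0.
  have -> : h 0 = 4 * (pi * k ^+ 2 - T); last by rewrite mulr_gt0 // subr_gt0.
  rewrite /h /c; move: (pi : R) pi0 => q q0; field; rewrite ?gt_eqF //.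
have ch : {for (0 : R), continuous h}.
  have dI := is_derive_id (0 : R) (1 : R).
  have d1 := derX 1 (derB (derC (pi : R) (0 : R) (1 : R)) dI).
  have d2 := derB (derC (2 * pi : R) (0 : R) (1 : R)) (derM dI (derC (1 + c ^+ 2 * D) (0 : R) (1 : R))).
  have d3 := derM d1 d2.
  have nz : (pi - (0 : R)) ^+ 2 * (2 * pi - 0 * (1 + c ^+ 2 * D)) != 0.
    by rewrite subr0 mul0r subr0 mulf_neq0 ?expf_neq0 ?mulf_neq0 ?gt_eqF.
  have := derB (derC (4 * k * c * D - 4 * T) (0 : R) (1 : R))
    (derZ (c ^+ 2 * D ^+ 2 * (2 * pi ^+ 2))
      (derV (f := fun s : R => (pi - s) ^+ 2 * (2 * pi - s * (1 + c ^+ 2 * D))) (x := 0) nz d3)).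
  by move=> [dh _]; apply/differentiable_continuous/derivable1_diffP.
have /cvgrPdist_lt/(_ _ h0)[eta /= eta0 Hh] := ch.
pose kap := 1 + c ^+ 2 * D.
have kap0 : 0 < kap by rewrite /kap ltr_pwDl // mulr_ge0 ?sqr_ge0 // ltW.
(* The three bounds ensure h v > 0, then pi - v > 0, then |tau| < pi by 2 pi - v kap > 0. *)
pose v := Num.min (eta / 2) (Num.min (pi / 2) (pi / kap)).
have v0 : 0 < v by rewrite !lt_min !divr_gt0.
have v_eta : v < eta by rewrite gt_min; apply/orP; left; lra.
have v_pi : v <= pi / 2 by rewrite !ge_min lexx orbT.
have v_kap : v * kap <= pi by rewrite -ler_pdivlMr // !ge_min lexx !orbT.
have hv : 0 < h v.
  have := Hh v; rewrite /ball_/= sub0r normrN gtr0_norm // => /(_ v_eta).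
  by rewrite distrC ltr_norml => /andP[]; lra.
pose tau := (c * v) *: xs + (pi - v) *: e.
have QE : dot tau tau = pi ^+ 2 - v * (2 * pi - v * kap).
  rewrite /tau !(dotDl, dotDr, dotZl, dotZr) (dotC xs e) ex ee -/D /kap.
  by move: (pi : R) => q; ring.
have den : 0 < 2 * pi - v * kap by lra.
have om : Omega tau by apply/OmegaP; rewrite dot_ge0 QE gtrBl mulr_gt0.
exists tau => //.
have a_E : dot tau xs = c * v * D by rewrite /tau dotDl !dotZl ex mulr0 addr0.
have tpE : dot (tperp xs (tof g)) tau = (pi - v) * T.
  by rewrite /tau dotDr !dotZr dot_tperp te mulr0 add0r.
rewrite phiE // dot_tof -/xs tpE /mass x0 expr0n mul0r add0r -/xs a_E -/k.
set p := Psi 0 _.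
set s := enorm tau.
have s2 : s ^+ 2 = dot tau tau by rewrite enorm_sqr.
have spi : s < pi by exact: om.
have vp : 0 < pi - v by lra.
have s_ge : (pi - v) ^+ 2 <= s ^+ 2.
  rewrite s2 QE /kap; have : 0 <= v * (v * (c ^+ 2 * D)).
    by do 2! (apply: mulr_ge0; first exact: ltW); rewrite mulr_ge0 ?sqr_ge0 // ltW.
  by rewrite sqrrB; move: (pi : R) => q; lra.
have s0 : 0 < s.
  rewrite lt_def enorm_ge0 andbT; apply: contraTneq s_ge => ->.
  by rewrite expr0n -ltNge exprn_gt0.
have up : p * (s ^+ 2 * (pi - s)) <= pi by rewrite /p -s2; apply: Psi_upper; rewrite s0.
have p0 : 0 < p by apply: Psi0_gt0; exact/OmegaP.
have dpi : v * (2 * pi - v * kap) <= 2 * pi * (pi - s).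
  have : v * (2 * pi - v * kap) = (pi - s) * (pi + s).
    by have := s2; rewrite QE => H; rewrite -subr_sqr H; ring.
  by move=> ->; rewrite mulrC ler_wpM2r ?subr_ge0 ?(ltW spi) //; lra.
(* The pole of psi is simple and pi - |tau| is at least of order v, so v p stays bounded. *)
have vp_le : v * p <= 2 * pi ^+ 2 * ((pi - v) ^+ 2 * (2 * pi - v * kap))^-1.
  rewrite ler_pdivlMr ?mulr_gt0 ?exprn_gt0 //.
  have -> : v * p * ((pi - v) ^+ 2 * (2 * pi - v * kap)) =
     p * ((pi - v) ^+ 2 * (v * (2 * pi - v * kap))) by ring.
  apply: (@le_trans _ _ (p * (s ^+ 2 * (2 * pi * (pi - s))))).
    rewrite ler_pM2l //; apply: ler_pM => //; first exact: sqr_ge0.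
    by rewrite mulr_ge0 ?(ltW v0) ?(ltW den).
  have -> : p * (s ^+ 2 * (2 * pi * (pi - s))) = 2 * pi * (p * (s ^+ 2 * (pi - s))) by ring.
  have -> : 2 * pi ^+ 2 = 2 * pi * pi :> R by rewrite expr2 mulrA.
  by rewrite ler_pM2l ?mulr_gt0.
rewrite -subr_gt0.
have cD : 0 <= c ^+ 2 * D ^+ 2 by rewrite mulr_ge0 ?sqr_ge0.
have : v * (c ^+ 2 * D ^+ 2 * (v * p)) <= v * (c ^+ 2 * D ^+ 2 *
   (2 * pi ^+ 2 * ((pi - v) ^+ 2 * (2 * pi - v * kap))^-1)).
  by rewrite ler_pM2l // ler_wpM2l.
have : 0 < v * h v by rewrite mulr_gt0.
rewrite /h -/kap; move: (_ ^-1) => r h1 h2.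
have -> : dot (xof g) (xof g) + 4 * ((pi - v) * T + k * (c * v * D)) - (c * v * D) ^+ 2 * p -
  (dot (xof g) (xof g) + 4 * pi * T) =
  v * (4 * k * c * D - 4 * T) - v * (c ^+ 2 * D ^+ 2 * (v * p)).
  by move: (pi : R) => q; ring.
by move: h1 h2; lra.
Qed.

(** Near the boundary of the ball the pole of psi takes over. If x1 is nonzero, phi drops below
    phi(0) there; if x1 = 0, [phi_upper] bounds phi near the boundary by almost |x|^2 + 4 pi T,
    which the test point of [exists_phi_gt] exceeds. *)
Lemma exists_crit g : (2 <= n)%N -> ~ explicit_set g ->
  exists2 th, crit g th & x1 (xof g) != 0 \/ dot th (xstar (xof g)) != 0.
Proof.
move=> n2 ne; have pi0 : 0 < pi :> R by exact: pi_gt0.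
have T0 := tnor_ge0 g.
have [x0|x0] := eqVneq (x1 (xof g)) 0; last first.
  have X2 : 0 < x1 (xof g) ^+ 2 by rewrite exprn_even_gt0.
  set X := x1 (xof g) ^+ 2 in X2; set t := enorm (tof g).
  have t0 : 0 <= t by exact: enorm_ge0.
  (* With pi d P >= 1 and |tau| >= pi/2 this gives X |tau|^2 P >= 4 (t + 1) pi, more than the linear
     term 4 t.tau can reach. *)
  pose d := Num.min (pi / 2) (X / (16 * (t + 1))).
  have t1 : 0 < 16 * (t + 1) by lra.
  have d0 : 0 < d by rewrite lt_min !divr_gt0.
  have dpi : d <= pi / 2 by rewrite ge_min lexx.
  have dX : d * (16 * (t + 1)) <= X by rewrite -ler_pdivlMr // ge_min lexx orbT.
  have [|||th ct _] := @max_crit R n g 0 (pi - d) 0.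
  - by move=> v; rewrite subr0 /Omega => /le_lt_trans; apply; lra.
  - by rewrite subr0 enorm0; lra.
  - move=> tau; rewrite subr0 => tE; have om : Omega tau by rewrite /Omega tE; lra.
    have om0 : Omega (0 : 'rV[R]_n) by rewrite /Omega enorm0.
    have -> : phi g 0 = dot (xof g) (xof g).
      by rewrite phiE // /mass !(dot0l, dot0r); ring.
    rewrite phiE // /mass -addrA gtrDl subr_lt0.
    have p0 := Psi0_gt0 ((OmegaP tau).1 om).
    have := Psi_lower_norm om; rewrite tE; have -> : pi - (pi - d) = d by ring.
    move=> pl; have := dot_le (tof g) tau; rewrite tE -/t => tt.
    have q2 : (pi / 2) ^+ 2 <= dot tau tau.
      rewrite -enorm_sqr tE ler_pXn2r ?nnegrE ?divr_ge0 ?(ltW pi0) //; lra.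
    have a2 := sqr_ge0 (dot tau (xstar (xof g))).
    set p := Psi 0 _ in p0 pl *.
    apply: (@lt_le_trans _ _ (X * (pi / 2) ^+ 2 * p)); last first.
      by rewrite ler_pM2r // ler_wpDr // ler_pM2l.
    apply: (@lt_le_trans _ _ (d * (16 * (t + 1)) * (pi / 2) ^+ 2 * p)); last first.
      by rewrite ler_pM2r // ler_pM2r ?exprn_gt0 ?divr_gt0.
    have -> : d * (16 * (t + 1)) * (pi / 2) ^+ 2 * p = 4 * (t + 1) * pi * (p * (pi * d)) by field.
    apply: (@lt_le_trans _ _ (4 * (t + 1) * pi)); last by rewrite ler_peMr // !mulr_ge0 //; lra.
    apply: (@le_lt_trans _ _ (4 * (t * (pi - d)))); first by rewrite ler_pM2l.
    have : t * (pi - d) <= t * pi by rewrite ler_wpM2l //; lra.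
    lra.
  by exists th => //; left.
have lt : tnor g < pi * tpar g ^+ 2.
  rewrite ltNge; apply/negP => le; apply/ne/explicit_setP; split=> //=.
  have [xs0|xs0] := eqVneq (xstar (xof g)) 0.
    by rewrite xs0 !dot0l !expr0n mulr0 mul0r.
  have D0 : 0 < dot (xstar (xof g)) (xstar (xof g)) by rewrite lt_def dot_eq0 xs0 dot_ge0.
  by move: le; rewrite /tpar expr_div_n mulrA ler_pdivrMr ?exprn_gt0 // (mulrC (tnor g)).
have [tau0 om0 gt0] := exists_phi_gt n2 x0 lt.
set eta := phi g tau0 - (dot (xof g) (xof g) + 4 * pi * tnor g).
have eta0 : 0 < eta by rewrite subr_gt0.
have k0 := sqr_ge0 (tpar g).
pose d := Num.min ((pi - enorm tau0) / 2) (eta / (4 * tpar g ^+ 2 * pi + 1) / 2).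
have k1 : 0 < 4 * tpar g ^+ 2 * pi + 1.
  have : 0 <= 4 * tpar g ^+ 2 * pi by rewrite mulr_ge0 ?(ltW pi0) // mulr_ge0.
  lra.
have s0pi : 0 < pi - enorm tau0 by rewrite subr_gt0.
have d0 : 0 < d by rewrite lt_min !divr_gt0.
have d1 : d <= (pi - enorm tau0) / 2 by rewrite ge_min lexx.
have d2 : d * (4 * tpar g ^+ 2 * pi + 1) <= eta / 2.
  by rewrite -ler_pdivlMr // mulrAC ge_min lexx orbT.
have [|||th ct _] := @max_crit R n g 0 (pi - d) tau0.
- by move=> v; rewrite subr0 /Omega => /le_lt_trans; apply; lra.
- by rewrite subr0; lra.
- move=> tau; rewrite subr0 => tE; have om : Omega tau by rewrite /Omega tE; lra.
  apply: (le_lt_trans (phi_upper g om)).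
  rewrite x0 expr0n !mul0r subr0 tE; have -> : pi - (pi - d) = d by ring.
  have := dot_le (tperp (xstar (xof g)) (tof g)) tau; rewrite -/(tnor g) tE => tt.
  have : tnor g * (pi - d) <= tnor g * pi by rewrite ler_wpM2l //; lra.
  have E : phi g tau0 = eta + (dot (xof g) (xof g) + 4 * pi * tnor g) by rewrite /eta subrK.
  rewrite E; move: d2 d0 eta0 tt; clear; move: (pi : R) => q; lra.
(* Were theta.xs zero, the critical equation would give t.xs = 0, hence [tpar g = 0], against 0 <=
   [tnor] < pi [tpar]^2. *)
exists th => //; right; apply/negP => /eqP a0.
have [om E] := (critP g th).1 ct.
have : dot (4 *: tof g) (xstar (xof g)) = 0.
  by rewrite E /gradP /mass x0 a0 !(expr0n, mul0r, addr0, scale0r, scaler0, dot0l).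
rewrite dotZl (dotC (tof g)) => /eqP; rewrite mulf_eq0 pnatr_eq0 /= => /eqP kz.
by move: lt; rewrite /tpar kz mul0r expr0n mulr0 ltNge T0.
Qed.

Lemma Mset_explicit g : (2 <= n)%N -> (~ Mset g) <-> explicit_set g.
Proof.
move=> n2; split=> [nM|]; last exact: explicit_not_Mset.
by apply: contrapT => /(exists_crit n2) H; apply: nM; apply/MsetP.
Qed.

End CutSet.

(** * Failure of smoothness on the explicit set *)

Section NotSmoothOnCut.
Variables (R : realType) (n : nat).
Hypothesis n2 : (2 <= n)%N.
Implicit Types (g p : pt R n) (th tau v : 'rV[R]_n).

Definition pt_x1 : pt R n := row_mx (evec R ord0) 0.
Definition pt_t (v : 'rV[R]_n) : pt R n := row_mx 0 v.

Lemma xofD g p (u : R) : xof (g + u *: p) = xof g + u *: xof p.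
Proof. by apply/rowP => i; rewrite !mxE. Qed.

Lemma tofD g p (u : R) : tof (g + u *: p) = tof g + u *: tof p.
Proof. by apply/rowP => i; rewrite !mxE. Qed.

Lemma tof_x1 g (u : R) : tof (g + u *: pt_x1) = tof g.
Proof. by rewrite tofD /tof /pt_x1 row_mxKr scaler0 addr0. Qed.

Lemma xstar_x1 g (u : R) : xstar (xof (g + u *: pt_x1)) = xstar (xof g).
Proof.
rewrite xofD /xof /pt_x1 row_mxKl; apply/rowP => i.
by rewrite !mxE !eqxx /= mulr0 addr0.
Qed.

Lemma x1_x1 g (u : R) : x1 (xof (g + u *: pt_x1)) = x1 (xof g) + u.
Proof. by rewrite xofD /xof /pt_x1 row_mxKl /x1 !mxE !eqxx mulr1. Qed.

Lemma xof_t g v (u : R) : xof (g + u *: pt_t v) = xof g.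
Proof. by rewrite xofD /xof /pt_t row_mxKl scaler0 addr0. Qed.

Lemma tof_t g v (u : R) : tof (g + u *: pt_t v) = tof g + u *: v.
Proof. by rewrite tofD /tof /pt_t row_mxKr. Qed.

(* AM-GM in the distance [d = pi - s] to the boundary: [A d + pi u^2 / (4 d) >= sqrt (A pi) |u|]. *)
Lemma kink_bound (A c u s q : R) : 0 < A -> 0 < c -> c ^+ 2 <= A * pi -> c <= A * pi / 2 ->
  `|u| <= 1 -> 0 <= s -> s < pi -> 0 < q -> 1 <= q * (pi * (pi - s)) ->
  c * `|u| <= A * (pi - s) + u ^+ 2 * s ^+ 2 * q.
Proof.
move=> A0 c0 c1 c2 u1 s0 spi p0 P1; have pi0 : 0 < pi :> R by exact: pi_gt0.
have [sh|sh] := leP s (pi / 2).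
  have h0 : c * `|u| <= c by rewrite ler_piMr // ltW.
  have h1 : A * (pi / 2) <= A * (pi - s) by rewrite ler_pM2l //; lra.
  have h2 : 0 <= u ^+ 2 * s ^+ 2 * q by rewrite mulr_ge0 ?(ltW p0) // mulr_ge0 ?sqr_ge0.
  lra.
have d0 : 0 < pi - s by rewrite subr_gt0.
have sq : pi / (4 * (pi - s)) <= s ^+ 2 * q.
  rewrite ler_pdivrMr ?mulr_gt0 //.
  have h1 : (pi / 2) ^+ 2 <= s ^+ 2 by rewrite ler_pXn2r ?nnegrE ?divr_ge0 ?(ltW pi0) // ltW.
  apply: (@le_trans _ _ ((pi / 2) ^+ 2 * (4 * (q * (pi - s))))).
    have -> : (pi / 2) ^+ 2 * (4 * (q * (pi - s))) = pi * (q * (pi * (pi - s))) by field.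
    by rewrite ler_peMr // ltW.
  have -> : s ^+ 2 * q * (4 * (pi - s)) = s ^+ 2 * (4 * (q * (pi - s))) by ring.
  by rewrite ler_wpM2r // !mulr_ge0 ?(ltW p0) ?(ltW d0).
apply: (@le_trans _ _ (A * (pi - s) + u ^+ 2 * (pi / (4 * (pi - s))))); last first.
  by rewrite lerD2l -mulrA ler_wpM2l // sqr_ge0.
rewrite -subr_ge0 -(real_normK (num_real u)); set uu := `|u|.
set d := pi - s in d0 *.
have -> : A * d + uu ^+ 2 * (pi / (4 * d)) - c * uu =
   ((2 * A * d - c * uu) ^+ 2 + uu ^+ 2 * (A * pi - c ^+ 2)) / (4 * A * d).
  clearbody d; move: (pi : R) => w; by field; rewrite !gt_eqF.
apply: divr_ge0; last by rewrite !mulr_ge0 ?(ltW A0) ?(ltW d0).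
by rewrite addr_ge0 ?sqr_ge0 // mulr_ge0 ?sqr_ge0 // subr_ge0.
Qed.

(** Leaving the set along e_0 makes x1 = u nonzero, so a critical point of norm s exists there, and
    [phi_upper] at it reads d(g)^2 + u^2 - (A (pi - s) + u^2 s^2 P) with A = 4 (T - pi k^2) > 0. *)
Lemma ccdist_kink g : x1 (xof g) = 0 -> pi * tpar g ^+ 2 < tnor g ->
  exists2 c : R, 0 < c & forall u : R, 0 < `|u| <= 1 ->
    ccdist (g + u *: pt_x1) ^+ 2 <= ccdist g ^+ 2 + u ^+ 2 - c * `|u|.
Proof.
move=> x0 lt; have pi0 : 0 < pi :> R by exact: pi_gt0.
have eg : explicit_set g.
  apply/explicit_setP; split=> //=.
  have [xs0|xs0] := eqVneq (xstar (xof g)) 0.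
    by rewrite xs0 !dot0l !expr0n mulr0 mul0r.
  have D0 : 0 < dot (xstar (xof g)) (xstar (xof g)) by rewrite lt_def dot_eq0 xs0 dot_ge0.
  move: (ltW lt); rewrite /tpar expr_div_n mulrA ler_pdivrMr ?exprn_gt0 //.
  by rewrite (mulrC (tnor g)).
have [_ dg _] := cut_ccdist eg.
pose A := 4 * (tnor g - pi * tpar g ^+ 2).
have A0 : 0 < A by rewrite mulr_gt0 // subr_gt0.
pose c := Num.min (Num.sqrt (A * pi)) (A * pi / 2).
have Api : 0 < A * pi by rewrite mulr_gt0.
have c0 : 0 < c by rewrite lt_min sqrtr_gt0 Api divr_gt0.
have c1 : c ^+ 2 <= A * pi.
  rewrite -[leRHS](sqr_sqrtr (ltW Api)) ler_pXn2r ?nnegrE ?sqrtr_ge0 ?(ltW c0) //.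
  by rewrite ge_min lexx.
have c2 : c <= A * pi / 2 by rewrite ge_min lexx orbT.
exists c => // u /andP[u0 u1]; set gu := g + u *: pt_x1.
have xu : x1 (xof gu) = u by rewrite x1_x1 x0 add0r.
have un0 : u != 0 by rewrite -normr_gt0.
have ne : ~ explicit_set gu by move=> [h _]; move: un0; rewrite -xu h eqxx.
have [th ct _] := exists_crit n2 ne; have [om _] := ct.
have [_ -> _] := crit_ccdist ct; apply: (le_trans (phi_upper gu om)).
have tpE : tperp (xstar (xof gu)) (tof gu) = tperp (xstar (xof g)) (tof g).
  by rewrite xstar_x1 tof_x1.
have -> : tpar gu = tpar g by rewrite /tpar xstar_x1 tof_x1.
rewrite dg tpE dotS xu xstar_x1 (dot_xof x0) -(enorm_sqr th).
have := dot_le (tperp (xstar (xof g)) (tof g)) th; rewrite -/(tnor g).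
have P1 := Psi_lower_norm om; rewrite -(enorm_sqr th) in P1.
have p0 : 0 < Psi 0 (enorm th ^+ 2) by rewrite enorm_sqr; apply: Psi0_gt0; exact/OmegaP.
set s := enorm th in P1 p0 *; set q := Psi 0 (s ^+ 2) in P1 p0 *.
have s0 : 0 <= s by exact: enorm_ge0.
have spi : s < pi by exact: om.
set D := dot (xstar _) _; set tt := dot _ th => Htt.
suff : c * `|u| <= A * (pi - s) + u ^+ 2 * s ^+ 2 * q.
  rewrite /A; move: Htt; clear; move: (pi : R) `|u| (u ^+ 2 * s ^+ 2 * q) => w uu z.
  by rewrite -(expr2 u); lra.
exact: kink_bound.
Qed.

(** A derivative would make f(h) + f(-h) - 2 f(0) at least - c h / 2 for small h, while the kink
    forces it below 2 h^2 - 2 c h. *)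
Lemma ccdist_not_derivable g : x1 (xof g) = 0 -> pi * tpar g ^+ 2 < tnor g ->
  ~ derivable (fun p => ccdist p ^+ 2) g pt_x1.
Proof.
move=> x0 lt dF; have [c c0 K] := ccdist_kink x0 lt.
pose f (u : R) := ccdist (g + u *: pt_x1) ^+ 2.
have f0 : f 0 = ccdist g ^+ 2 by rewrite /f scale0r addr0.
have /derivableP/is_derive_lineP dl := dF.
set l := 'D_pt_x1 _ g in dl.
have c4 : 0 < c / 4 by rewrite divr_gt0.
have [eta eta0 H] := is_derive_dist dl c4.
pose h := Num.min (eta / 2) (Num.min (c / 4) 1).
have h0 : 0 < h by rewrite !lt_min ltr01 !divr_gt0.
have h1 : h <= eta / 2 by rewrite ge_min lexx.
have h2 : h <= c / 4 by rewrite !ge_min lexx orbT.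
have h3 : h <= 1 by rewrite !ge_min lexx !orbT.
have hn : `|h| = h by rewrite gtr0_norm.
have heta : h < eta by lra.
have := H h; rewrite hn add0r => /(_ heta); rewrite -/(f h) -/(f 0) f0.
have := H (- h); rewrite normrN hn add0r => /(_ heta); rewrite -/(f (- h)) -/(f 0) f0.
have h01 : 0 < h <= 1 by rewrite h0.
have := K h; rewrite hn => /(_ h01); rewrite -/(f h).
have := K (- h); rewrite normrN hn sqrrN => /(_ h01); rewrite -/(f (- h)).
move=> K1 K2; rewrite !ler_norml => /andP[L1 _] /andP[L2 _].
have : h * h <= c / 4 * h by rewrite ler_pM2r.
move: K1 K2 L1 L2; rewrite expr2; have : 0 < c * h by rewrite mulr_gt0.
lra.
Qed.

Lemma nbhs_line g p (U : set (pt R n)) : open U -> U g ->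
  exists2 u : R, 0 < u < 1 & U (g + u *: p).
Proof.
move=> oU Ug; have cl : {for (0 : R), continuous (fun u : R => g + u *: p)}.
  by apply: cvgD; [exact: cvg_cst|apply: cvgZl; exact: cvg_id].
have nU : nbhs (g + (0 : R) *: p) U by rewrite scale0r addr0; exact: open_nbhs_nbhs.
have /nbhs_ballP[e /= e0 He] := cl _ nU.
exists (Num.min (e / 2) (1 / 2)).
  by rewrite lt_min !divr_gt0 //= gt_min; apply/orP; right; lra.
apply: He; rewrite /ball/= sub0r normrN ger0_norm ?le_min ?divr_ge0 ?(ltW e0) //.
by rewrite gt_min; apply/orP; left; lra.
Qed.

(** If T = 0 then t = 0, and moving t orthogonally to [xs] makes T positive while k stays 0; if T >
    0, shrinking the part of t along [xs] makes the inequality strict. *)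
Lemma near_kink g (U : set (pt R n)) : explicit_set g -> open U -> U g ->
  exists2 g', U g' & x1 (xof g') = 0 /\ pi * tpar g' ^+ 2 < tnor g'.
Proof.
move=> eg oU Ug; have [x0 kT] := explicit_tpar eg; have T0 := tnor_ge0 g.
have pi0 : 0 < pi :> R by exact: pi_gt0.
set xs := xstar (xof g); have [Tz|Tn] := eqVneq (tnor g) 0.
  have kz : tpar g = 0.
    apply/eqP; rewrite -sqrf_eq0; apply/eqP/le_anti; rewrite sqr_ge0 andbT.
    by rewrite -(pmulr_rle0 _ pi0) -Tz.
  have [v v0 vx] := exists_orthogonal xs n2.
  have [u /andP[u0 _] Uu] := nbhs_line (pt_t v) oU Ug.
  exists (g + u *: pt_t v) => //; rewrite /tpar /tnor tperpE xof_t tof_t -/xs; split=> //.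
  have xv : dot xs (tof g + u *: v) = dot xs (tof g).
    by rewrite dotDr dotZr (dotC xs v) vx mulr0 addr0.
  rewrite xv -/(tpar g) kz expr0n mulr0 scale0r subr0.
  have t0 : tof g = 0.
    have : tperp xs (tof g) = 0 by apply/eqP; rewrite -enorm_eq0 -/(tnor g) Tz.
    by rewrite tperpE -/(tpar g) kz scale0r subr0.
  by rewrite t0 add0r enormZ mulr_gt0 ?normr_gt0 ?enorm_gt0 ?gt_eqF.
have Tp : 0 < tnor g by rewrite lt_def Tn.
have [u /andP[u0 u1] Uu] := nbhs_line (pt_t (- tpar g *: xs)) oU Ug.
exists (g + u *: pt_t (- tpar g *: xs)) => //; rewrite xof_t; split=> //.
have kE : tpar (g + u *: pt_t (- tpar g *: xs)) = (1 - u) * tpar g.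
  rewrite /tpar xof_t tof_t -/xs dotDr !dotZr; have [D0|D0] := eqVneq (dot xs xs) 0.
    by rewrite D0 invr0 !mulr0.
  by field.
have -> : tnor (g + u *: pt_t (- tpar g *: xs)) = tnor g.
  rewrite /tnor !tperpE -/(tpar _) -/(tpar g) kE xof_t tof_t -/xs; congr enorm.
  by apply/rowP => i; rewrite !mxE; ring.
rewrite kE exprMn; have [k0|kn] := eqVneq (tpar g) 0.
  by rewrite k0 expr0n !mulr0.
apply: lt_le_trans kT; rewrite ltr_pM2l // gtr_pMl ?exprn_even_gt0 //.
by rewrite expr_lt1 // ?subr_ge0 ?(ltW u1) // gtrBl.
Qed.

Lemma cut_not_smooth g : explicit_set g -> ~ smooth_near (fun p => ccdist p ^+ 2) g.
Proof.
move=> eg [U [oU Ug H]]; have [g' Ug' [x0 lt]] := near_kink eg oU Ug.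
have [/(_ pt_x1 _ Ug') + _] := H [::].
exact: ccdist_not_derivable.
Qed.

End NotSmoothOnCut.

(** * Stability of the nondegenerate critical point under perturbation of g *)

Section Stability.
Variables (R : realType) (n : nat).
Hypothesis n2 : (2 <= n)%N.
Implicit Types (g p : pt R n) (th tau v : 'rV[R]_n).

Lemma abs_dot_le m (u v : 'rV[R]_m) : `|dot u v| <= enorm u * enorm v.
Proof.
by rewrite ler_norml lerNl -dotNl (le_trans (dot_le _ _)) ?dot_le // /enorm dotNl dotNr opprK.
Qed.

Lemma crit_max g th tau : crit g th -> Omega tau -> phi g tau <= phi g th.
Proof.
move=> ct om; have [E _ _] := crit_ccdist ct; have := phi_le_ccdistE g om.
by rewrite E -EFinM lee_fin -expr2 sqr_sqrtr // crit_phi_ge0.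
Qed.

(** A second maximizer would be critical as well, against uniqueness. *)
Lemma crit_strict_max g th tau : crit g th ->
  x1 (xof g) != 0 \/ dot th (xstar (xof g)) != 0 ->
  Omega tau -> tau != th -> phi g tau < phi g th.
Proof.
move=> ct Hxa om tn; rewrite lt_neqAle crit_max // andbT.
apply: contra_neq tn => E; apply: (crit_unique ct _ Hxa).
have d0 : 0 < pi - enorm tau by rewrite subr_gt0.
apply: (local_max_crit om d0) => s sd.
have oms : Omega s.
  have -> : s = (s - tau) + tau by rewrite subrK.
  by rewrite /Omega (le_lt_trans (enormD_le _ _)) // -ltrBrDr.
by rewrite E; split=> //; exact: crit_max.
Qed.

Lemma continuous_enorm_fun (T : topologicalType) m (F : T -> 'rV[R]_m) (x : T) :
  (forall i, {for x, continuous (fun s => F s 0 i)}) ->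
  {for x, continuous (fun s => enorm (F s))}.
Proof.
move=> H; apply: (continuous_comp1 (k := @Num.sqrt R) (f := fun s => dot (F s) (F s))).
  by apply: continuous_sum => i; apply: continuous_mul.
exact: sqrt_continuous.
Qed.

Lemma continuous_abs_fun (T : topologicalType) (F : T -> R) (x : T) :
  {for x, continuous F} -> {for x, continuous (fun s => `|F s|)}.
Proof. by move=> H; apply: (continuous_comp1 H); exact: norm_continuous. Qed.

Lemma continuous_cst_fun (T : topologicalType) (c : R) (x : T) :
  {for x, continuous (fun _ : T => c)}.
Proof. exact: (@cst_continuous _ _ c). Qed.

Lemma near_pt2 g0 (P Q S : set (pt R n)) :
  nbhs g0 P -> nbhs g0 Q -> (forall g, P g -> Q g -> S g) -> nbhs g0 S.
Proof. by move=> HP HQ H; apply: filterS2 HP HQ. Qed.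

Lemma continuous_x1 g : {for g, continuous (fun p => x1 (xof p))}.
Proof.
rewrite (_ : (fun p => _) = (fun p : pt R n => p 0 (lshift n ord0))).
  exact: (@coord_continuous R 1 (n.+1 + n) 0 (lshift n ord0)).
by apply/funext => p; rewrite /x1 mxE.
Qed.

Lemma continuous_xof g i : {for g, continuous (fun p => xof p 0 i)}.
Proof.
rewrite (_ : (fun p => _) = (fun p : pt R n => p 0 (lshift n i))).
  exact: (@coord_continuous R 1 (n.+1 + n) 0 (lshift n i)).
by apply/funext => p; rewrite mxE.
Qed.

Lemma continuous_xstar g i : {for g, continuous (fun p => xstar (xof p) 0 i)}.
Proof.
rewrite (_ : (fun p => _) = (fun p => xof p 0 (lift ord0 i))); first exact: continuous_xof.
by apply/funext => p; rewrite mxE.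
Qed.

Lemma continuous_tof g i : {for g, continuous (fun p => tof p 0 i)}.
Proof.
rewrite (_ : (fun p => _) = (fun p : pt R n => p 0 (rshift n.+1 i))).
  exact: (@coord_continuous R 1 (n.+1 + n) 0 (rshift n.+1 i)).
by apply/funext => p; rewrite mxE.
Qed.

Lemma continuous_subC (T : topologicalType) (F : T -> R) (c : R) (x : T) :
  {for x, continuous F} -> {for x, continuous (fun s => F s - c)}.
Proof. by move=> H; apply: continuous_add => //; exact: continuous_cst_fun. Qed.

(* Uniform in [tau] on the ball of radius [s1 < pi], where [C = Psi 0 (s1 ^ 2)]. *)
Definition phi_modulus g0 (C : R) g : R :=
  `|dot (xof g) (xof g) - dot (xof g0) (xof g0)| + 4 * pi * enorm (tof g - tof g0)
  + pi ^+ 2 * C * (`|x1 (xof g) ^+ 2 - x1 (xof g0) ^+ 2|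
     + enorm (xstar (xof g) - xstar (xof g0)) * enorm (xstar (xof g) + xstar (xof g0))).

Lemma phi_dist g0 g tau (s1 : R) : enorm tau <= s1 -> s1 < pi ->
  `|phi g tau - phi g0 tau| <= phi_modulus g0 (Psi 0 (s1 ^+ 2)) g.
Proof.
move=> ts s1pi; have s0 := enorm_ge0 tau; have s10 := le_trans s0 ts.
have om : Omega tau by exact: (le_lt_trans ts).
have pi0 : 0 <= pi :> R by exact: pi_ge0.
have s1pi2 : s1 ^+ 2 < pi ^+ 2 by rewrite ltr_pXn2r ?nnegrE.
have tpi : enorm tau <= pi by exact: ltW.
rewrite !phiE // -(enorm_sqr tau) /phi_modulus.
have q_le : enorm tau ^+ 2 <= pi ^+ 2 by rewrite ler_pXn2r ?nnegrE.
have P_le : Psi 0 (enorm tau ^+ 2) <= Psi 0 (s1 ^+ 2).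
  by apply: Psi_le => //; [exact: sqr_ge0|rewrite ler_pXn2r ?nnegrE].
have P_ge : 0 <= Psi 0 (enorm tau ^+ 2).
  by apply: Psi_ge0; rewrite sqr_ge0 (le_lt_trans _ s1pi2) // ler_pXn2r ?nnegrE.
set P := Psi 0 (enorm tau ^+ 2) in P_le P_ge *; set C := Psi 0 (s1 ^+ 2) in P_le *.
rewrite /mass -(enorm_sqr tau).
set q := enorm tau ^+ 2 in q_le *.
have q0 : 0 <= q by exact: sqr_ge0.
set X := x1 (xof g) ^+ 2; set X0 := x1 (xof g0) ^+ 2.
set a := dot tau (xstar (xof g)); set a0 := dot tau (xstar (xof g0)).
set A := dot (xof g) _; set A0 := dot (xof g0) _.
have -> : A + 4 * dot (tof g) tau - (X * q + a ^+ 2) * P -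
    (A0 + 4 * dot (tof g0) tau - (X0 * q + a0 ^+ 2) * P) =
  (A - A0) + 4 * dot (tof g - tof g0) tau - (q * (X - X0) + (a - a0) * (a + a0)) * P.
  by rewrite dotBl; ring.
apply: (le_trans (ler_normB _ _)); apply: lerD.
  apply: (le_trans (ler_normD _ _)); rewrite lerD2l normrM (ger0_norm (_ : 0 <= 4)) //.
  rewrite -mulrA ler_pM2l // mulrC (le_trans (abs_dot_le _ _)) //.
  by rewrite ler_wpM2l ?enorm_ge0.
rewrite normrM (ger0_norm P_ge) -mulrA (mulrC C) mulrA.
apply: ler_pM => //; apply: (le_trans (ler_normD _ _)); rewrite [leRHS]mulrDr; apply: lerD.
  by rewrite normrM (ger0_norm q0) ler_wpM2r.
rewrite normrM /a /a0 -dotBr -dotDr.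
apply: (@le_trans _ _ ((enorm tau * enorm (xstar (xof g) - xstar (xof g0))) *
   (enorm tau * enorm (xstar (xof g) + xstar (xof g0))))).
  by apply: ler_pM => //; exact: abs_dot_le.
by rewrite mulrACA -expr2 -/q ler_wpM2r // mulr_ge0 ?enorm_ge0.
Qed.

Lemma phi_modulus_near g0 (C e : R) : 0 < e -> \forall g \near g0, phi_modulus g0 C g < e.
Proof.
move=> e0; have cw : {for g0, continuous (phi_modulus g0 C)}.
  have cst (c : R) : {for g0, continuous (fun _ : pt R n => c)}.
    exact: (@cst_continuous _ _ c).
  have cX := @continuous_x1 g0.
  apply: continuous_add; first apply: continuous_add.
  - apply: continuous_abs_fun; apply: continuous_subC; apply: continuous_sum => i.
    by apply: continuous_mul; exact: continuous_xof.
  - apply: continuous_mul => //; apply: continuous_enorm_fun => i.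
    rewrite (_ : (fun s => _) = (fun p => tof p 0 i + - tof g0 0 i)).
      by apply: continuous_subC; exact: continuous_tof.
    by apply/funext => s; rewrite !mxE.
  - apply: continuous_mul => //; apply: continuous_add.
      apply: continuous_abs_fun; apply: continuous_subC.
      by rewrite (_ : (fun s => _) = (fun p => x1 (xof p) * x1 (xof p))) //; apply: continuous_mul.
    apply: continuous_mul; apply: continuous_enorm_fun => i.
      rewrite (_ : (fun s => _) = (fun p => xstar (xof p) 0 i + - xstar (xof g0) 0 i)).
        by apply: continuous_subC; exact: continuous_xstar.
      by apply/funext => s; rewrite !mxE.
    rewrite (_ : (fun s => _) = (fun p => xstar (xof p) 0 i + xstar (xof g0) 0 i)).
      by apply: continuous_add => //; exact: continuous_xstar.
    by apply/funext => s; rewrite !mxE.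
have w0 : phi_modulus g0 C g0 = 0.
  by rewrite /phi_modulus !subrr !enorm0 normr0 !mulr0 !mul0r !addr0 !mulr0 ?addr0.
have /cvgrPdist_lt/(_ _ e0) H := cw; apply: filterS H => g.
by rewrite w0 sub0r normrN; exact: le_lt_trans (ler_norm _).
Qed.

(** By compactness phi g0 stays below its value at th0 by some m on a small sphere; a perturbation
    of phi by less than m / 2 keeps th0 above the sphere, and [max_crit] applies. *)
Lemma crit_near g0 th0 (r : R) : crit g0 th0 ->
  x1 (xof g0) != 0 \/ dot th0 (xstar (xof g0)) != 0 -> 0 < r ->
  \forall g \near g0, exists2 th, crit g th & enorm (th - th0) < r.
Proof.
move=> ct Hxa r0; have om0 : enorm th0 < pi by exact: ct.1.
pose rho := Num.min (r / 2) ((pi - enorm th0) / 2).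
have rho0 : 0 < rho by rewrite lt_min !divr_gt0 ?subr_gt0.
have rr : rho <= r / 2 by rewrite ge_min lexx.
have rp : rho <= (pi - enorm th0) / 2 by rewrite ge_min lexx orbT.
pose s1 := enorm th0 + rho.
have s1pi : s1 < pi by rewrite /s1; lra.
have Ks v : enorm (v - th0) <= rho -> enorm v <= s1.
  move=> h; have -> : v = th0 + (v - th0) by rewrite addrC subrK.
  by rewrite (le_trans (enormD_le _ _)) // /s1 lerD2l.
have KO v : enorm (v - th0) <= rho -> Omega v by move=> /Ks h; exact: (le_lt_trans h).
have [m m0 Hm] : exists2 m, 0 < m & forall tau, enorm (tau - th0) = rho ->
    phi g0 tau <= phi g0 th0 - m.
  pose S := [set v : 'rV[R]_n | enorm (v - th0) = rho].
  have nth0 v : S v -> v != th0.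
    by move=> Sv; apply: contraTneq rho0 => e; rewrite -Sv e subrr enorm0 ltxx.
  have cS : compact S.
    apply: (@subclosed_compact _ _ [set v : 'rV[R]_n | enorm (v - th0) <= rho]).
    - have -> : S = (fun v : 'rV[R]_n => dot (v - th0) (v - th0)) @^-1` [set rho ^+ 2].
        apply/seteqP; split => v /=; rewrite -enorm_sqr; first by move=> ->.
        by move=> h; apply/eqP; rewrite -(eqrXn2 (_ : 0 < 2)%N) ?enorm_ge0 ?h ?(ltW rho0).
      have cl : closed [set rho ^+ 2] by exact: closed_eq.
      apply: (@preimage_closed _ _ (fun v : 'rV[R]_n => dot (v - th0) (v - th0)) _ _ cl).
      by move=> v _; exact: continuous_dot_shift.
    - by apply: compact_enorm_ball; exact: ltW.
    - by move=> v /= ->.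
  have S0 : S !=set0.
    have i0 : 'I_n by exact: (Ordinal (ltnW n2)).
    exists (th0 + rho *: evec R i0); rewrite /S /= addrC addKr enormZ gtr0_norm //.
    by rewrite /enorm dot_evec mxE !eqxx sqrtr1 mulr1.
  have [|c /set_mem cS' cmax] := EVT_max_rV S0 cS (f := phi g0).
    apply: continuous_in_subspaceT => v /set_mem Sv; apply: continuous_phi; apply: KO.
    by rewrite Sv.
  have omc : Omega c by apply: KO; rewrite cS'.
  have lt := crit_strict_max ct Hxa omc (nth0 _ cS').
  exists (phi g0 th0 - phi g0 c); first by rewrite subr_gt0.
  by move=> tau ts; rewrite opprB addrC subrK; apply: cmax; apply/mem_set.
have m20 : 0 < m / 2 by rewrite divr_gt0.
apply: filterS (phi_modulus_near g0 (Psi 0 (s1 ^+ 2)) m20) => g gm.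
have close tau : enorm (tau - th0) <= rho -> `|phi g tau - phi g0 tau| < m / 2.
  by move=> /Ks h; exact: (le_lt_trans (phi_dist _ _ h s1pi)).
have [|||th cth d] := @max_crit R n g th0 rho th0 => //.
- by rewrite subrr enorm0.
- move=> tau ts; have := Hm _ ts.
  have := close tau; rewrite ts lexx => /(_ isT).
  have := close th0; rewrite subrr enorm0 (ltW rho0) => /(_ isT).
  by rewrite !ltr_norml => /andP[? ?] /andP[? ?]; lra.
- by exists th => //; lra.
Qed.

(** Value 0 where there is no critical point; on [Mset] the critical point is unique. *)
Definition theta g : 'rV[R]_n := xget 0 [set th | crit g th].

Lemma thetaP g : Mset g -> crit g (theta g) /\
  (x1 (xof g) != 0 \/ dot (theta g) (xstar (xof g)) != 0).
Proof.
move=> /MsetP -/(_ n2)[th ct Hxa].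
have c' : crit g (theta g) by rewrite /theta; case: xgetP => [_ -> //|/(_ th)].
by split=> //; rewrite (crit_unique ct c' Hxa).
Qed.

Lemma theta_unique g th : Mset g -> crit g th -> th = theta g.
Proof. by move=> Mg ct; have [c' Hxa] := thetaP Mg; exact: crit_unique Hxa. Qed.

Lemma Mset_near g0 : Mset g0 -> \forall g \near g0, Mset g.
Proof.
move=> M0; have [ct [X0|a0]] := thetaP M0.
  have cX := continuous_abs_fun (@continuous_x1 g0).
  have X0' : 0 < `|x1 (xof g0)| by rewrite normr_gt0.
  have H : nbhs g0 [set g | `| `|x1 (xof g0)| - `|x1 (xof g)| | < `|x1 (xof g0)|].
    by have /cvgrPdist_lt/(_ _ X0') := cX.
  have H' := crit_near ct (or_introl X0) ltr01.
  apply: (near_pt2 H H') => g Hg [th cth _]; apply/MsetP => //; exists th => //; left.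
  by apply/eqP => e; move: Hg => /=; rewrite e normr0 subr0 normr_id ltxx.
set th0 := theta g0 in ct a0; set xs0 := xstar (xof g0) in a0.
pose e := `|dot th0 xs0|; have e0 : 0 < e by rewrite normr_gt0.
(* With |theta - theta0| and |xs - xs0| below r1 <= 1, the three error terms in the expansion of
   theta0.xs0 around theta.xs = 0 add up to at most e / 2. *)
pose r := e / 2 / (enorm xs0 + 1 + enorm th0).
have den : 0 < enorm xs0 + 1 + enorm th0.
  by rewrite -addrA ltr_wpDl ?enorm_ge0 // ltr_pwDl ?enorm_ge0.
have r0 : 0 < r by rewrite !divr_gt0.
pose r1 := Num.min r 1; have r10 : 0 < r1 by rewrite lt_min r0 ltr01.
have cx : {for g0, continuous (fun g => enorm (xstar (xof g) - xs0))}.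
  apply: continuous_enorm_fun => i.
  rewrite (_ : (fun s => _) = (fun p => xstar (xof p) 0 i + - xs0 0 i)).
    by apply: continuous_subC; exact: continuous_xstar.
  by apply/funext => s; rewrite [LHS]mxE [X in _ + X]mxE.
have H : nbhs g0 [set g | `|enorm (xs0 - xs0) - enorm (xstar (xof g) - xs0)| < r1].
  by have /cvgrPdist_lt/(_ _ r10) := cx.
have H' := crit_near ct (or_intror a0) r10.
apply: (near_pt2 H H') => g Hg [th cth d]; apply/MsetP => //; exists th => //; right.
move: Hg => /=; rewrite subrr enorm0 sub0r normrN (ger0_norm (enorm_ge0 _)) => Hg.
set xs := xstar (xof g) in Hg *; apply/eqP => z.
have : dot th0 xs0 = - (dot (th - th0) xs0 + dot th0 (xs - xs0) + dot (th - th0) (xs - xs0)).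
  by rewrite !(dotBl, dotBr) z; ring.
move=> /(congr1 (fun z : R => `|z|)); rewrite normrN -/e => eE.
have : e <= r1 * enorm xs0 + enorm th0 * r1 + r1 * 1.
  rewrite eE; apply: (le_trans (ler_normD _ _)); apply: lerD.
    apply: (le_trans (ler_normD _ _)); apply: lerD; apply: (le_trans (abs_dot_le _ _)).
      by rewrite ler_wpM2r ?enorm_ge0 // ltW.
    by rewrite ler_wpM2l ?enorm_ge0 // ltW.
  apply: (le_trans (abs_dot_le _ _)); apply: ler_pM; rewrite ?enorm_ge0 ?(ltW d) //.
  by rewrite ltW // (lt_le_trans Hg) // ge_min lexx orbT.
have : r1 * (enorm xs0 + 1 + enorm th0) <= e / 2.
  by rewrite -ler_pdivlMr // ge_min lexx.
lra.
Qed.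

Lemma open_Mset : open (@Mset R n).
Proof. by rewrite openE => g /Mset_near. Qed.

Lemma continuous_theta g0 i : Mset g0 -> {for g0, continuous (fun g => theta g 0 i)}.
Proof.
move=> M0; have [ct Hxa] := thetaP M0.
apply/(@cvgrPdist_lt _ _ _ (nbhs g0) _ (fun g => theta g 0 i)) => e e0.
have H := crit_near ct Hxa e0; have H' := Mset_near M0.
apply: (near_pt2 H H') => g [th cth d] Mg; rewrite -(theta_unique Mg cth).
apply: le_lt_trans d; rewrite -(ler_pXn2r (_ : 0 < 2)%N) ?nnegrE ?enorm_ge0 //.
rewrite real_normK ?num_real // enorm_sqr; apply: le_trans (coord_sqr_le _ i).
by rewrite !mxE -sqrrN opprB.
Qed.

End Stability.

(** * Limits of determinants and adjugates *)

Section FilterLimits.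
Variables (R : realType) (T : Type) (F : set_system T).
Context {FF : Filter F}.

Lemma cvg_fsum (I : Type) (r : seq I) (h : I -> T -> R) (a : I -> R) :
  (forall i, h i @ F --> a i) ->
  (fun s => \sum_(i <- r) h i s) @ F --> \sum_(i <- r) a i.
Proof.
move=> H; elim: r => [|i r ih].
  rewrite big_nil (_ : (fun s => _) = cst 0); first exact: cvg_cst.
  by apply/funext => s; rewrite big_nil.
rewrite big_cons (_ : (fun s => _) = (fun s => h i s + \sum_(j <- r) h j s)).
  by apply: cvgD => //; exact: H.
by apply/funext => s; rewrite big_cons.
Qed.

Lemma cvg_fprod (I : Type) (r : seq I) (h : I -> T -> R) (a : I -> R) :
  (forall i, h i @ F --> a i) ->
  (fun s => \prod_(i <- r) h i s) @ F --> \prod_(i <- r) a i.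
Proof.
move=> H; elim: r => [|i r ih].
  rewrite big_nil (_ : (fun s => _) = cst 1); first exact: cvg_cst.
  by apply/funext => s; rewrite big_nil.
rewrite big_cons (_ : (fun s => _) = (fun s => h i s * \prod_(j <- r) h j s)).
  by apply: cvgM => //; exact: H.
by apply/funext => s; rewrite big_cons.
Qed.

Lemma cvg_det m (A : T -> 'M[R]_m) (B : 'M[R]_m) :
  (forall i j, (fun s => A s i j) @ F --> B i j) -> (fun s => \det (A s)) @ F --> \det B.
Proof.
move=> H; rewrite /determinant; apply: cvg_fsum => s.
by apply: cvgM; [exact: cvg_cst|apply: cvg_fprod => i; exact: H].
Qed.

Lemma cvg_adj m (A : T -> 'M[R]_m) (B : 'M[R]_m) i j :
  (forall i j, (fun s => A s i j) @ F --> B i j) ->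
  (fun s => (\adj (A s)) i j) @ F --> (\adj B) i j.
Proof.
move=> H; rewrite mxE (_ : (fun s => _) = (fun s => cofactor (A s) j i)); last first.
  by apply/funext => s; rewrite mxE.
apply: cvgM; first exact: cvg_cst.
apply: cvg_det => a b; rewrite !mxE (_ : (fun s => _) = (fun s => A s (lift j a) (lift i b))).
  exact: H.
by apply/funext => s; rewrite !mxE.
Qed.

Lemma cvg_dot m (u v : T -> 'rV[R]_m) (a b : 'rV[R]_m) :
  (forall i, (fun s => u s 0 i) @ F --> a 0 i) -> (forall i, (fun s => v s 0 i) @ F --> b 0 i) ->
  (fun s => dot (u s) (v s)) @ F --> dot a b.
Proof. by move=> H K; apply: cvg_fsum => i; apply: cvgM. Qed.

End FilterLimits.

(** * Directional derivatives of [theta] *)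

Section ImplicitDerivative.
Variables (R : realType) (n : nat).
Hypothesis n2 : (2 <= n)%N.
Implicit Types (g p : pt R n) (th tau v w : 'rV[R]_n).

Notation P k tau := (Psi k (dot tau tau)).

Lemma cvg_ddmassP (T : Type) (F : set_system T) {FF : Filter F} (G : T -> pt R n)
    (tau : T -> 'rV[R]_n) g0 tau0 v w : Omega tau0 ->
  (fun s => x1 (xof (G s))) @ F --> x1 (xof g0) ->
  (forall i, (fun s => xstar (xof (G s)) 0 i) @ F --> xstar (xof g0) 0 i) ->
  (forall i, (fun s => tau s 0 i) @ F --> tau0 0 i) ->
  (fun s => ddmassP (G s) (tau s) v w) @ F --> ddmassP g0 tau0 v w.
Proof.
move=> om cX cx ct.
have c0 (c : R) : (fun _ : T => c) @ F --> c by exact: cvg_cst.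
have cX2 : (fun s => x1 (xof (G s)) ^+ 2) @ F --> x1 (xof g0) ^+ 2 by apply: cvgM.
have cq : (fun s => dot (tau s) (tau s)) @ F --> dot tau0 tau0 by exact: cvg_dot.
have ca : (fun s => dot (tau s) (xstar (xof (G s)))) @ F --> dot tau0 (xstar (xof g0)).
  exact: cvg_dot.
have cb u : (fun s => dot u (xstar (xof (G s)))) @ F --> dot u (xstar (xof g0)).
  by apply: cvg_dot => // i; exact: c0.
have cv u : (fun s => dot (tau s) u) @ F --> dot tau0 u.
  by apply: cvg_dot => // i; exact: c0.
have cP k : (fun s => P k (tau s)) @ F --> P k tau0.
  apply: (cvg_comp _ _ cq).
  have [d _] := Psi_derive k (Omega_norm om).
  exact/differentiable_continuous/derivable1_diffP.
have cm : (fun s => mass (G s) (tau s)) @ F --> mass g0 tau0.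
  by apply: cvgD; apply: cvgM.
have D (f h : T -> R) (a b : R) : f @ F --> a -> h @ F --> b -> (fun s => f s + h s) @ F --> a + b.
  exact: cvgD.
have M (f h : T -> R) (a b : R) : f @ F --> a -> h @ F --> b -> (fun s => f s * h s) @ F --> a * b.
  exact: cvgM.
have cS u z : (fun s => 2 * (x1 (xof (G s)) ^+ 2 * dot u z
      + dot u (xstar (xof (G s))) * dot z (xstar (xof (G s))))) @ F -->
    2 * (x1 (xof g0) ^+ 2 * dot u z + dot u (xstar (xof g0)) * dot z (xstar (xof g0))).
  exact: M _ _ _ _ (c0 2) (D _ _ _ _ (M _ _ _ _ cX2 (c0 _)) (M _ _ _ _ (cb u) (cb z))).
have cT z : (fun s => 2 * (x1 (xof (G s)) ^+ 2 * dot (tau s) z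
      + dot (tau s) (xstar (xof (G s))) * dot z (xstar (xof (G s))))) @ F -->
    2 * (x1 (xof g0) ^+ 2 * dot tau0 z + dot tau0 (xstar (xof g0)) * dot z (xstar (xof g0))).
  exact: M _ _ _ _ (c0 2) (D _ _ _ _ (M _ _ _ _ cX2 (cv z)) (M _ _ _ _ ca (cb z))).
have c2 z : (fun s => 2 * dot (tau s) z) @ F --> 2 * dot tau0 z by exact: M _ _ _ _ (c0 2) (cv z).
have c1 z : (fun s => P 1 (tau s) * (2 * dot (tau s) z)) @ F --> P 1 tau0 * (2 * dot tau0 z).
  exact: M _ _ _ _ (cP 1%N) (c2 z).
have t1 := M _ _ _ _ (cS w v) (cP 0).
have t2 := M _ _ _ _ (cT v) (c1 w).
have t3 := M _ _ _ _ (cT w) (c1 v).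
apply: (D _ _ _ _ (D _ _ _ _ (D _ _ _ _ t1 t2) t3)).
exact: M _ _ _ _ cm (D _ _ _ _ (M _ _ _ _ (M _ _ _ _ (cP 2%N) (c2 w)) (c2 v)) (M _ _ _ _ (cP 1%N) (c0 _))).
Qed.

Lemma der_affine (f : pt R n -> R) g (v : pt R n) df : (forall u : R, f (g + u *: v) = f g + u * df) ->
  is_derive g v f df.
Proof.
move=> H; apply/is_derive_lineP; rewrite (_ : (fun u => _) = (fun u => f g + u * df)); last first.
  by apply/funext.
have := derD (derC (f g) (0 : R) (1 : R)) (derM (is_derive_id (0 : R) (1 : R)) (derC df (0 : R) (1 : R))).
by move/der_eq; apply; rewrite mulr0 addr0 add0r [LHS]mul1r.
Qed.

Lemma der_x1 g (v : pt R n) : is_derive g v (fun p => x1 (xof p)) (x1 (xof v)).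
Proof. by apply: der_affine => u; rewrite xofD /x1 !mxE. Qed.

Lemma der_xstar a g (v : pt R n) :
  is_derive g v (fun p => dot a (xstar (xof p))) (dot a (xstar (xof v))).
Proof.
apply: der_affine => u; rewrite -dotZr -dotDr xofD; congr dot.
by apply/rowP => i; rewrite !mxE.
Qed.

Lemma der_tof a g (v : pt R n) : is_derive g v (fun p => dot (tof p) a) (dot (tof v) a).
Proof. by apply: der_affine => u; rewrite tofD dotDl dotZl. Qed.

Definition dgphi g (v : pt R n) tau w : R :=
  4 * dot (tof v) w
  - (2 * (2 * x1 (xof g) * x1 (xof v) * dot tau w
      + (dot tau (xstar (xof v)) * dot w (xstar (xof g))
         + dot tau (xstar (xof g)) * dot w (xstar (xof v)))) * P 0 tau
     + (2 * x1 (xof g) * x1 (xof v) * dot tau tau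
        + 2 * dot tau (xstar (xof g)) * dot tau (xstar (xof v))) * (P 1 tau * (2 * dot tau w))).

Lemma der_dgphi g (v : pt R n) tau w : is_derive g v (fun p => dphi p tau w) (dgphi g v tau w).
Proof.
rewrite /dphi /dmassP /mass.
have dX := derX 1 (der_x1 g v).
have dA := derD (derM dX (derC (dot tau w) g v)) (derM (der_xstar tau g v) (der_xstar w g v)).
have dM := derD (derM dX (derC (dot tau tau) g v)) (derX 1 (der_xstar tau g v)).
have := derB (derZ 4 (der_tof w g v)) (derD (derM (derZ 2 dA) (derC (P 0 tau) g v))
  (derM dM (derC (P 1 tau * (2 * dot tau w)) g v))).
by move/der_eq; apply; rewrite /dgphi !expr1; ring.
Qed.

Lemma is_derive_quotientP (f : R -> R) (d : R) : is_derive (0 : R) (1 : R) f d <->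
  (fun h => h^-1 * (f h - f 0)) @ (0 : R)^' --> d.
Proof.
have E : (fun h : R => h^-1 *: ((f \o shift (0 : R)) (h *: (1 : R)) - f 0)) =
    (fun h => h^-1 * (f h - f 0)).
  by apply/funext => h /=; rewrite addr0; have -> : h *: (1 : R) = h by exact: mulr1.
split=> [[c <-]|H]; first by move: c; rewrite /derivable /derive E.
split; rewrite /derivable /derive E; first exact: cvgP H.
exact: cvg_lim H.
Qed.

(** Minus the Hessian of [phi g] at [theta g], hence positive definite on [Mset]. *)
Definition hess g : 'M[R]_n :=
  \matrix_(j, i) ddmassP g (theta g) (evec R j) (evec R i).

Lemma hess_det g : Mset g -> \det (hess g) != 0.
Proof.
move=> Mg; have [[om _] Hxa] := thetaP n2 Mg; apply/det0P => -[v v0 vM].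
have := ddmassP_gt0 om Hxa v0; rewrite ddmassPE.
have -> : ddvec g (theta g) v = 0.
  apply/rowP => i; have := congr1 (fun z : 'rV_n => z 0 i) vM; rewrite [LHS]mxE [RHS]mxE => E; rewrite [RHS]mxE -E.
  rewrite -dot_evec dotC -ddmassPE ddmassPC ddmassPE; apply: eq_bigr => j _.
  by rewrite [X in _ = _ * X]mxE ddmassPE dotC dot_evec.
by rewrite dot0r ltxx.
Qed.

Lemma ddmassP_sum g tau v w :
  ddmassP g tau v w = \sum_i ddmassP g tau v (evec R i) * w 0 i.
Proof.
rewrite ddmassPC ddmassPE dotC; apply: eq_bigr => i _.
by rewrite ddmassPC ddmassPE dotC dot_evec.
Qed.

(* Differentiates [dphi g (theta g) = 0]: by the mean value theorem in [theta], the increment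
   of [theta] solves a linear system whose matrix tends to [hess g]. *)
Definition dtheta (v : pt R n) g (i : 'I_n) : R :=
  (\sum_j (\adj (hess g)) i j * dgphi g v (theta g) (evec R j)) / \det (hess g).

Lemma dphi_increment g th0 th j : Omega th0 -> Omega th ->
  exists2 xi : R, 0 <= xi <= 1 &
    dphi g th (evec R j) - dphi g th0 (evec R j) =
    - ddmassP g (th0 + xi *: (th - th0)) (evec R j) (th - th0).
Proof.
move=> om0 om; pose f (u : R) := dphi g (th0 + u *: (th - th0)) (evec R j).
have df (u : R) : 0 <= u <= 1 ->
    is_derive u (1 : R) f (- ddmassP g (th0 + u *: (th - th0)) (evec R j) (th - th0)).
  move=> u01; apply: (der_line (f := fun s => dphi g s (evec R j))); apply: der_dphi.
  exact: Omega_segment.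
have [|||c] := @MVT_segment R f (fun u => - ddmassP g (th0 + u *: (th - th0)) (evec R j) (th - th0)) 0 1.
- exact: ler01.
- by move=> x; rewrite in_itv /= => /andP[a b]; apply: df; rewrite !ltW.
- apply: derivable_within_continuous => u; rewrite in_itv /= => /df[d _]; exact: d.
rewrite in_itv /= => c01; rewrite subr0 mulr1 /f scale1r scale0r addr0 (addrC th0) subrK => E.
by exists c.
Qed.

(** The mean value theorem yields a separate intermediate point for each component, so row j of the
    matrix M u is evaluated at its own point; all of them tend to [theta g] by continuity. Cramer's
    rule with the adjugate then passes to the limit and keeps the formula algebraic in the
    entries. *)
Lemma der_theta g (v : pt R n) i : Mset g ->
  is_derive g v (fun p => theta p 0 i) (dtheta v g i).
Proof.
move=> Mg; apply/is_derive_lineP.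
have [[om c0] Hxa] := thetaP n2 Mg; set th0 := theta g in om c0 Hxa.
pose G (u : R) := g + u *: v.
have G0 : G 0 = g by rewrite /G scale0r addr0.
have cl : {for (0 : R), continuous G}.
  by apply: cvgD; [exact: cvg_cst|apply: cvgZl; exact: cvg_id].
have cG : G @ (0 : R)^' --> g.
  have : G @ (0 : R)^' --> G 0 by apply: cvg_within_filter; exact: cl.
  by rewrite G0.
have MG : \forall u \near (0 : R)^', Mset (G u).
  have K (U : set (pt R n)) : nbhs g U -> \forall u \near (0 : R)^', U (G u) by move=> /cG.
  by apply: (K (@Mset R n)); exact: (Mset_near n2 Mg).
have cF (f : pt R n -> R) : {for g, continuous f} -> (fun u => f (G u)) @ (0 : R)^' --> f g.
  by move=> h; exact: (cvg_comp _ _ cG h).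
have ct k : (fun u => theta (G u) 0 k) @ (0 : R)^' --> th0 0 k.
  by apply: (cF (fun p => theta p 0 k)); exact: continuous_theta.
(* The intermediate points are chosen for all u and j at once, with the dummy value 0 when [G u] is
   outside [Mset]. *)
pose Q (uj : R * 'I_n) (x : R) := 0 <= x <= 1 /\
  (Mset (G uj.1) -> dphi (G uj.1) th0 (evec R uj.2) =
    ddmassP (G uj.1) (th0 + x *: (theta (G uj.1) - th0)) (evec R uj.2) (theta (G uj.1) - th0)).
have [xi Hxi] : {xi : R * 'I_n -> R & forall uj, Q uj (xi uj)}.
  apply: choice => -[u j]; rewrite /Q /=.
  have [Mu|nM] := pselect (Mset (G u)); last first.
    by exists 0; split=> [|/nM []]; rewrite lexx ler01.
  have [[omu cu] _] := thetaP n2 Mu.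
  have [x x01 E] := dphi_increment (G u) j om omu; exists x; split=> // _.
  by apply: oppr_inj; rewrite -E cu sub0r.
pose M u := \matrix_(j, i) ddmassP (G u) (th0 + xi (u, j) *: (theta (G u) - th0)) (evec R j) (evec R i).
have cM a b : (fun u => M u a b) @ (0 : R)^' --> hess g a b.
  rewrite mxE (_ : (fun u => _) = (fun u => ddmassP (G u) (th0 + xi (u, a) *: (theta (G u) - th0))
     (evec R a) (evec R b))); last by apply/funext => u; rewrite mxE.
  apply: cvg_ddmassP => // [||k].
  - exact: (cF (fun p => x1 (xof p)) (@continuous_x1 R n g)).
  - by move=> k; exact: (cF (fun p => xstar (xof p) 0 k) (@continuous_xstar R n g k)).
  apply/cvgrPdist_lt => e e0; have /cvgrPdist_lt/(_ _ e0) := ct k; apply: filterS => u h.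
  apply: le_lt_trans h; rewrite !mxE.
  have [/andP[x0 x1] _] := Hxi (u, a).
  rewrite -/th0 opprD addrA subrr sub0r normrN normrM ger0_norm // -normrN opprB.
  by rewrite ler_piMl.
have cD : (fun u => \det (M u)) @ (0 : R)^' --> \det (hess g) by exact: cvg_det.
have cc j : (fun u => u^-1 * dphi (G u) th0 (evec R j)) @ (0 : R)^' --> dgphi g v th0 (evec R j).
  have /is_derive_lineP/is_derive_quotientP := der_dgphi g v th0 (evec R j).
  by rewrite -/(G 0) G0 c0; under eq_fun do rewrite subr0.
have D0 := hess_det Mg.
apply/is_derive_quotientP; rewrite -/(G 0) G0 -/th0.
have lim : (fun u => (\sum_j (\adj (M u)) i j * (u^-1 * dphi (G u) th0 (evec R j))) / \det (M u))
    @ (0 : R)^' --> dtheta v g i.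
  apply: cvgM; last exact: cvgV.
  by apply: cvg_fsum => j; apply: cvgM; [exact: cvg_adj|exact: cc].
apply: cvg_trans lim; apply: near_eq_cvg.
have Dn : \forall u \near (0 : R)^', \det (M u) != 0.
  have p0 : 0 < `|\det (hess g)| by rewrite normr_gt0.
  have /cvgrPdist_lt/(_ _ p0) := cD; apply: filterS => u h.
  by apply: contraTneq h => ->; rewrite subr0 ltxx.
apply: filterS2 MG Dn => u Mu du.
set del := theta (G u) - th0.
have S : forall k, \sum_j M u k j * del 0 j = dphi (G u) th0 (evec R k).
  move=> k; have [_ /(_ Mu) ->] := Hxi (u, k); rewrite ddmassP_sum; apply: eq_bigr => j _.
  by rewrite mxE.
have E : \det (M u) * del 0 i = \sum_j (\adj (M u)) i j * dphi (G u) th0 (evec R j).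
  have H : (\det (M u) *: del^T) i 0 = (\adj (M u) *m (M u *m del^T)) i 0.
    by rewrite mulmxA mul_adj_mx mul_scalar_mx.
  rewrite [RHS]mxE [LHS]mxE [del^T _ _]mxE in H; rewrite H.
  apply: eq_bigr => j _; rewrite -S; congr (_ * _); rewrite mxE.
  by apply: eq_bigr => l _; rewrite [del^T _ _]mxE.
have -> : theta (G u) 0 i - th0 0 i = del 0 i by rewrite !mxE.
rewrite (eq_bigr (fun j => u^-1 * ((\adj (M u)) i j * dphi (G u) th0 (evec R j)))); last first.
  by move=> j _; rewrite mulrCA.
by rewrite -mulr_sumr -E -mulrA [_ * del _ _]mulrC mulfK.
Qed.

End ImplicitDerivative.

(** * Smoothness of the squared distance on [Mset] *)

Section Smoothness.
Variables (R : realType) (n : nat).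
Hypothesis n2 : (2 <= n)%N.
Implicit Types (g p : pt R n) (F G : pt R n -> R).

(* Expressions built from the coordinates and from [theta]; they are closed under
   differentiation on [Mset]. *)
Inductive smexp : (pt R n -> R) -> Prop :=
| smexp_cst (c : R) : smexp (fun _ => c)
| smexp_coord i : smexp (fun g => g 0 i)
| smexp_theta i : smexp (fun g => theta g 0 i)
| smexp_Psi k : smexp (fun g => Psi k (dot (theta g) (theta g)))
| smexp_inv F : smexp F -> (forall g, Mset g -> F g != 0) -> smexp (fun g => (F g)^-1)
| smexp_add F G : smexp F -> smexp G -> smexp (fun g => F g + G g)
| smexp_mul F G : smexp F -> smexp G -> smexp (fun g => F g * G g).

Lemma smexp_sum (I : Type) (r : seq I) (F : I -> pt R n -> R) :
  (forall i, smexp (F i)) -> smexp (fun g => \sum_(i <- r) F i g).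
Proof.
move=> H; elim: r => [|i r ih].
  rewrite (_ : (fun g => _) = (fun _ => 0)); first exact: smexp_cst.
  by apply/funext => s; rewrite big_nil.
rewrite (_ : (fun g => _) = (fun s => F i s + \sum_(j <- r) F j s)).
  exact: smexp_add.
by apply/funext => s; rewrite big_cons.
Qed.

Lemma smexp_prod (I : Type) (r : seq I) (F : I -> pt R n -> R) :
  (forall i, smexp (F i)) -> smexp (fun g => \prod_(i <- r) F i g).
Proof.
move=> H; elim: r => [|i r ih].
  rewrite (_ : (fun g => _) = (fun _ => 1)); first exact: smexp_cst.
  by apply/funext => s; rewrite big_nil.
rewrite (_ : (fun g => _) = (fun s => F i s * \prod_(j <- r) F j s)).
  exact: smexp_mul.
by apply/funext => s; rewrite big_cons.
Qed.

Lemma smexp_scale (c : R) F : smexp F -> smexp (fun g => c * F g).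
Proof. by move=> H; apply: smexp_mul => //; exact: smexp_cst. Qed.

Lemma smexp_opp F : smexp F -> smexp (fun g => - F g).
Proof.
move=> H; rewrite (_ : (fun g => _) = (fun g => -1 * F g)); first exact: smexp_scale.
by apply/funext => g; rewrite mulN1r.
Qed.

Lemma smexp_sqr F : smexp F -> smexp (fun g => F g ^+ 2).
Proof. by move=> H; exact: (smexp_mul H H). Qed.

Lemma smexp_dot m (u v : pt R n -> 'rV[R]_m) : (forall i, smexp (fun g => u g 0 i)) ->
  (forall i, smexp (fun g => v g 0 i)) -> smexp (fun g => dot (u g) (v g)).
Proof. by move=> H K; apply: smexp_sum => i; exact: smexp_mul. Qed.

Lemma smexp_det m (A : pt R n -> 'M[R]_m) : (forall i j, smexp (fun g => A g i j)) ->
  smexp (fun g => \det (A g)).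
Proof.
move=> H; rewrite /determinant; apply: smexp_sum => s.
by apply: smexp_scale; apply: smexp_prod => i; exact: H.
Qed.

Lemma smexp_adj m (A : pt R n -> 'M[R]_m) i j : (forall i j, smexp (fun g => A g i j)) ->
  smexp (fun g => (\adj (A g)) i j).
Proof.
move=> H; rewrite (_ : (fun g => _) = (fun g => cofactor (A g) j i)); last first.
  by apply/funext => s; rewrite mxE.
apply: smexp_scale; apply: smexp_det => a b.
rewrite (_ : (fun g => _) = (fun s => A s (lift j a) (lift i b))); first exact: H.
by apply/funext => s; rewrite !mxE.
Qed.

Lemma smexp_xof i : smexp (fun g => xof g 0 i).
Proof.
rewrite (_ : (fun g => _) = (fun p : pt R n => p 0 (lshift n i))); first exact: smexp_coord.
by apply/funext => p; rewrite mxE.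
Qed.

Lemma smexp_tof i : smexp (fun g => tof g 0 i).
Proof.
rewrite (_ : (fun g => _) = (fun p : pt R n => p 0 (rshift n.+1 i))); first exact: smexp_coord.
by apply/funext => p; rewrite mxE.
Qed.

Lemma smexp_xstar i : smexp (fun g => xstar (xof g) 0 i).
Proof.
rewrite (_ : (fun g => _) = (fun p => xof p 0 (lift ord0 i))); first exact: smexp_xof.
by apply/funext => p; rewrite mxE.
Qed.

Lemma smexp_x1 : smexp (fun g => x1 (xof g)).
Proof. exact: smexp_xof. Qed.

Lemma smexp_mass : smexp (fun g => mass g (theta g)).
Proof.
apply: smexp_add.
  apply: smexp_mul; first exact: (smexp_sqr smexp_x1).
  by apply: smexp_dot => i; exact: smexp_theta.
by apply: smexp_sqr; apply: smexp_dot => i; [exact: smexp_theta|exact: smexp_xstar].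
Qed.

Lemma smexp_ddmassP v w : smexp (fun g => ddmassP g (theta g) v w).
Proof.
have cX := smexp_sqr smexp_x1.
have ca : smexp (fun g => dot (theta g) (xstar (xof g))).
  by apply: smexp_dot => i; [exact: smexp_theta|exact: smexp_xstar].
have cb u : smexp (fun g => dot u (xstar (xof g))).
  by apply: smexp_dot => i; [exact: smexp_cst|exact: smexp_xstar].
have ct u : smexp (fun g => dot (theta g) u).
  by apply: smexp_dot => i; [exact: smexp_theta|exact: smexp_cst].
have c2 u := smexp_scale 2 (ct u).
have cS u z := smexp_scale 2 (smexp_add (smexp_mul cX (smexp_cst (dot u z))) (smexp_mul (cb u) (cb z))).
have cT z := smexp_scale 2 (smexp_add (smexp_mul cX (ct z)) (smexp_mul ca (cb z))).
have c1 z := smexp_mul (smexp_Psi 1) (c2 z).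
exact: (smexp_add (smexp_add (smexp_add (smexp_mul (cS w v) (smexp_Psi 0))
  (smexp_mul (cT v) (c1 w))) (smexp_mul (cT w) (c1 v)))
  (smexp_mul smexp_mass (smexp_add (smexp_mul (smexp_mul (smexp_Psi 2) (c2 w)) (c2 v))
     (smexp_mul (smexp_Psi 1) (smexp_cst (2 * dot w v)))))).
Qed.

Lemma smexp_dgphi (v : pt R n) w : smexp (fun g => dgphi g v (theta g) w).
Proof.
have ct u : smexp (fun g => dot (theta g) u).
  by apply: smexp_dot => i; [exact: smexp_theta|exact: smexp_cst].
have ca : smexp (fun g => dot (theta g) (xstar (xof g))).
  by apply: smexp_dot => i; [exact: smexp_theta|exact: smexp_xstar].
have cb : smexp (fun g => dot w (xstar (xof g))).
  by apply: smexp_dot => i; [exact: smexp_cst|exact: smexp_xstar].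
have cq : smexp (fun g => dot (theta g) (theta g)) by apply: smexp_dot => i; exact: smexp_theta.
have cX := smexp_mul (smexp_scale 2 smexp_x1) (smexp_cst (x1 (xof v))).
have cw := smexp_cst (dot w (xstar (xof v))).
exact: (smexp_add (smexp_cst (4 * dot (tof v) w)) (smexp_opp
  (smexp_add (smexp_mul (smexp_scale 2 (smexp_add (smexp_mul cX (ct w))
     (smexp_add (smexp_mul (ct (xstar (xof v))) cb) (smexp_mul ca cw)))) (smexp_Psi 0))
   (smexp_mul (smexp_add (smexp_mul cX cq) (smexp_mul (smexp_scale 2 ca) (ct (xstar (xof v)))))
     (smexp_mul (smexp_Psi 1) (smexp_scale 2 (ct w))))))).
Qed.

Lemma smexp_hess i j : smexp (fun g => hess g i j).
Proof.
rewrite (_ : (fun g => _) = (fun g => ddmassP g (theta g) (evec R i) (evec R j))).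
  exact: smexp_ddmassP.
by apply/funext => g; rewrite mxE.
Qed.

Lemma smexp_dtheta (v : pt R n) i : smexp (fun g => dtheta v g i).
Proof.
apply: smexp_mul.
  apply: smexp_sum => j; apply: smexp_mul; last exact: smexp_dgphi.
  exact: (smexp_adj _ _ smexp_hess).
by apply: smexp_inv; [exact: (smexp_det smexp_hess)|exact: hess_det].
Qed.

Lemma der_coord i g (v : pt R n) : is_derive g v (fun p : pt R n => p 0 i) (v 0 i).
Proof. by apply: der_affine => u; rewrite !mxE. Qed.

(** The class contains all [Psi k] because differentiation raises k, and inverses because the
    derivative of [theta] is divided by the determinant of [hess]. *)
Lemma smexp_derive F (v : pt R n) : smexp F ->
  exists2 F', smexp F' & forall g, Mset g -> is_derive g v F (F' g).
Proof.
elim=> {F} [c|i|i|k|F sF [F' sF' H] F0|F G sF [F' sF' HF] sG [G' sG' HG]|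
    F G sF [F' sF' HF] sG [G' sG' HG]].
- by exists (fun _ => 0) => [|g _]; [exact: smexp_cst|exact: derC].
- by exists (fun _ => v 0 i) => [|g _]; [exact: smexp_cst|exact: der_coord].
- by exists (fun g => dtheta v g i) => [|g Mg]; [exact: smexp_dtheta|exact: der_theta].
- exists (fun g => Psi k.+1 (dot (theta g) (theta g)) *
      \sum_i (dtheta v g i * theta g 0 i + theta g 0 i * dtheta v g i)).
    apply: smexp_mul; first exact: smexp_Psi.
    apply: smexp_sum => i; have st := smexp_theta i; have sd := smexp_dtheta v i.
    exact: (smexp_add (smexp_mul sd st) (smexp_mul st sd)).
  move=> g Mg; have [[om _] _] := thetaP n2 Mg.
  apply: (der_comp (f := fun p => dot (theta p) (theta p)) (x := g)).
    exact: Psi_derive (Omega_norm om).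
  apply: der_sum => i; have dt := der_theta n2 v i Mg.
  exact: (derM dt dt).
- exists (fun g => - ((F g)^-1 ^+ 2) * F' g).
    by apply: smexp_mul => //; apply: smexp_opp; apply: smexp_sqr; exact: smexp_inv.
  by move=> g Mg; have := derV (F0 g Mg) (H g Mg); rewrite exprVn.
- exists (fun g => F' g + G' g); first exact: smexp_add.
  by move=> g Mg; exact: (derD (HF g Mg) (HG g Mg)).
- exists (fun g => F' g * G g + F g * G' g).
    exact: (smexp_add (smexp_mul sF' sG) (smexp_mul sF sG')).
  by move=> g Mg; exact: (derM (HF g Mg) (HG g Mg)).
Qed.

Lemma smexp_continuous F g : smexp F -> Mset g -> {for g, continuous F}.
Proof.
move=> sF Mg; elim: sF => {F} [c|i|i|k|F sF H F0|F G sF HF sG HG|F G sF HF sG HG].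
- exact: (@cst_continuous _ _ c).
- exact: (@coord_continuous R 1 (n.+1 + n) 0 i).
- exact: continuous_theta.
- have [[om _] _] := thetaP n2 Mg.
  apply: (continuous_comp1 (k := Psi k) (f := fun p => dot (theta p) (theta p))).
    by apply: continuous_sum => i; apply: continuous_mul; exact: continuous_theta.
  have [d _] := Psi_derive k (Omega_norm om).
  exact/differentiable_continuous/derivable1_diffP.
- have Fg := F0 g Mg; move: H. rewrite /prop_for /continuous_at => H; exact: (cvgV Fg H).
- exact: continuous_add.
- exact: continuous_mul.
Qed.

Lemma smexp_ccdist : exists2 F, smexp F & forall g, Mset g -> ccdist g ^+ 2 = F g.
Proof.
exists (fun g => dot (xof g) (xof g) + 4 * dot (tof g) (theta g)
    - mass g (theta g) * Psi 0 (dot (theta g) (theta g))).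
  apply: smexp_add; first apply: smexp_add.
  - by apply: smexp_dot => i; exact: smexp_xof.
  - by apply: smexp_scale; apply: smexp_dot => i; [exact: smexp_tof|exact: smexp_theta].
  - by apply: smexp_opp; apply: smexp_mul; [exact: smexp_mass|exact: smexp_Psi].
move=> g Mg; have [ct _] := thetaP n2 Mg; have [_ -> _] := crit_ccdist ct.
by rewrite phiE //; exact: ct.1.
Qed.

(** [Mset] is open, so agreement with an expression on it passes to derivatives. *)
Lemma iterD_smexp (vs : seq (pt R n)) :
  exists2 F, smexp F & forall g, Mset g -> Defs.iterD (fun p => ccdist p ^+ 2) vs g = F g.
Proof.
elim: vs => [|v vs [F sF H]]; first exact: smexp_ccdist.
have [F' sF' H'] := smexp_derive v sF; exists F' => // g Mg.
have N : \forall y \near g, F y = Defs.iterD (fun p => ccdist p ^+ 2) vs y.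
  by apply: filterS (Mset_near n2 Mg) => y /H.
by have [_] := is_derive_near N (H' g Mg).
Qed.

Lemma Mset_smooth g : Mset g -> smooth_near (fun p => ccdist p ^+ 2) g.
Proof.
move=> Mg; exists (@Mset R n); split; [exact: open_Mset|exact: Mg|] => vs.
have [F sF H] := iterD_smexp vs.
have N p : Mset p -> \forall y \near p, F y = Defs.iterD (fun p => ccdist p ^+ 2) vs y.
  by move=> Mp; apply: filterS (Mset_near n2 Mp) => y /H.
split=> [v p Mp|p Mp].
  have [F' _ H'] := smexp_derive v sF.
  by have [] := is_derive_near (N p Mp) (H' p Mp).
have c := smexp_continuous sF Mp.
have E : Defs.iterD (fun p => ccdist p ^+ 2) vs p = F p by exact: H.
rewrite /prop_for /continuous_at E; apply: cvg_trans c.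
exact: (near_eq_cvg (N p Mp)).
Qed.

End Smoothness.

(** * The matrix U / sin U *)

Section MatrixFormula.
Variables (R : realType) (n : nat).
Implicit Types (th : 'rV[R]_n) (x y : 'rV[R]_n.+1).

Lemma row_eq x y : x1 x = x1 y -> xstar x = xstar y -> x = y.
Proof.
move=> e0 /rowP es; apply/rowP => i; case: (unliftP ord0 i) => [j|] ->; last exact: e0.
by have := es j; rewrite !mxE.
Qed.

Lemma mul_Umat x (j : 'I_n) b :
  (x *m Umat R j) 0 b = x1 x * (b == lift ord0 j)%:R - x 0 (lift ord0 j) * (b == ord0)%:R.
Proof.
rewrite mxE (eq_bigr (fun a => x 0 a * ((a == ord0) && (b == lift ord0 j))%:R -
   x 0 a * ((a == lift ord0 j) && (b == ord0))%:R)); last by move=> a _; rewrite mxE mulrBr.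
rewrite sumrB; congr (_ - _).
  rewrite (bigD1 ord0) //= big1 ?addr0 // => a /negbTE ->; exact: mulr0.
rewrite (bigD1 (lift ord0 j)) //= eqxx big1 ?addr0 // => a /negbTE ->; exact: mulr0.
Qed.

Lemma mul_Asum x th b : (x *m Asum th) 0 b =
  \sum_j th 0 j * (x1 x * (b == lift ord0 j)%:R - x 0 (lift ord0 j) * (b == ord0)%:R).
Proof.
rewrite /Asum mulmx_sumr summxE; apply: eq_bigr => j _.
by rewrite -scalemxAr [LHS]mxE mul_Umat.
Qed.

Lemma x1_mul_Asum x th : x1 (x *m Asum th) = - dot th (xstar x).
Proof.
rewrite /x1 mul_Asum /dot -sumrN; apply: eq_bigr => j _.
by rewrite eqxx [xstar x _ _]mxE /= mulr0 sub0r mulr1 mulrN.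
Qed.

Lemma xstar_mul_Asum x th : xstar (x *m Asum th) = x1 x *: th.
Proof.
apply/rowP => i; rewrite [LHS]mxE mul_Asum [RHS]mxE (bigD1 i) //= big1 ?addr0.
  by rewrite eqxx mulr0 subr0 mulr1 mulrC.
move=> j ji; rewrite mulr0 subr0 (inj_eq lift_inj) eq_sym (negbTE ji) mulr0 mulr0 //.
Qed.

Lemma trmx_Asum th : (Asum th)^T = - Asum th.
Proof.
rewrite /Asum raddf_sum -sumrN; apply: eq_bigr => j _ /=; apply/matrixP => a b.
by rewrite !mxE (andbC (b == ord0)) (andbC (b == lift _ _)); ring.
Qed.

(** The square of U(theta): |theta|^2 times the orthogonal projection onto span(e_0, theta). Its
    powers are therefore multiples of it, which collapses the defining series of [UsinU]. *)
Definition Bmat th : 'M[R]_n.+1 := - (Asum th ^+ 2).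

Lemma x1_mul_Bmat x th : x1 (x *m Bmat th) = dot th th * x1 x.
Proof.
have -> : x *m Bmat th = - (x *m Asum th *m Asum th) by rewrite /Bmat mulmxN mulmxA.
by rewrite {1}/x1 mxE -/(x1 _) x1_mul_Asum opprK xstar_mul_Asum dotZr mulrC.
Qed.

Lemma xstar_mul_Bmat x th : xstar (x *m Bmat th) = dot th (xstar x) *: th.
Proof.
have -> : x *m Bmat th = - (x *m Asum th *m Asum th) by rewrite /Bmat mulmxN mulmxA.
apply/rowP => i; rewrite [LHS]mxE [LHS]mxE.
have := congr1 (fun z : 'rV_n => z 0 i) (xstar_mul_Asum (x *m Asum th) th).
by rewrite [LHS]mxE [RHS]mxE => ->; rewrite x1_mul_Asum mulNr opprK [RHS]mxE.
Qed.

Lemma trmx_Bmat th : (Bmat th)^T = Bmat th.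
Proof.
rewrite /Bmat expr2 raddfN /= -[Asum th * _]/(Asum th *m Asum th) trmx_mul trmx_Asum.
by rewrite mulNmx mulmxN opprK.
Qed.

Lemma Bmat_sqr th : Bmat th *m Bmat th = dot th th *: Bmat th.
Proof.
apply/row_matrixP => i; rewrite !rowE mulmxA -scalemxAr; apply: row_eq.
  by rewrite x1_mul_Bmat /x1 [RHS]mxE.
rewrite xstar_mul_Bmat xstar_mul_Bmat.
set d := delta_mx _ _; apply/rowP => k; rewrite [RHS]mxE [(_ *: (d *m _)) _ _]mxE.
have := congr1 (fun z : 'rV_n => z 0 k) (xstar_mul_Bmat d th).
by rewrite [LHS]mxE => ->; rewrite dotZr [LHS]mxE [(_ *: th) _ _]mxE; ring.
Qed.

Lemma Bmat_exp th k : Bmat th ^+ k.+1 = dot th th ^+ k *: Bmat th.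
Proof.
elim: k => [|k ih]; first by rewrite expr1 expr0 scale1r.
by rewrite exprS ih -scalerAr -[Bmat th * Bmat th]/(_ *m _) Bmat_sqr scalerA exprSr.
Qed.

Lemma ssin_coef0 : ssin_coef R 0 = 1.
Proof. by rewrite /ssin_coef /= /ssin eqxx divr1. Qed.

Lemma UsinU_partial th N :
  \sum_(k < N.+1) ssin_coef R k *: (- (Asum th ^+ 2)) ^+ k =
  1 + (\sum_(k < N) ssin_coef R k.+1 * dot th th ^+ k) *: Bmat th.
Proof.
rewrite big_ord_recl expr0 ssin_coef0 scale1r; congr (_ + _).
rewrite scaler_suml; apply: eq_bigr => k _; rewrite -/(Bmat th).
by rewrite lift0 Bmat_exp scalerA.
Qed.

(** Identity plus (s / sin s - 1) times the projection onto span(e_0, theta), s = |theta|. At theta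
    = 0 the matrix [Bmat] vanishes and its coefficient is 0 / 0 = 0. *)
Lemma UsinUE th : Omega th ->
  UsinU th = 1 + ((ssin (enorm th) - 1) / dot th th) *: Bmat th.
Proof.
move=> om; apply: cvg_lim; first exact: norm_hausdorff.
rewrite -cvg_shiftS /=.
under eq_fun do rewrite UsinU_partial.
apply: cvgD; first exact: cvg_cst.
have [th0|th0] := eqVneq th 0.
  have -> : Bmat th = 0.
    rewrite /Bmat (_ : Asum th = 0) ?expr0n ?oppr0 // /Asum big1 // => j _.
    by rewrite th0 mxE scale0r.
  under eq_fun do rewrite scaler0; rewrite scaler0; exact: cvg_cst.
have q0 : dot th th != 0 by rewrite dot_eq0.
apply: cvgZl.
have h : 0 <= enorm th < pi by rewrite enorm_ge0.
have H : (fun N => \sum_(k < N.+1) ssin_coef R k * (enorm th ^+ 2) ^+ k) @ \oo --> ssin (enorm th).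
  by rewrite (cvg_shiftS (fun N => \sum_(k < N) ssin_coef R k * (enorm th ^+ 2) ^+ k));
     exact: ssin_coef_cvg.
have E N : \sum_(k < N) ssin_coef R k.+1 * dot th th ^+ k =
    (\sum_(k < N.+1) ssin_coef R k * (enorm th ^+ 2) ^+ k - 1) / dot th th.
  rewrite enorm_sqr big_ord_recl expr0 mulr1 ssin_coef0 addrC addKr mulr_suml.
  apply: eq_bigr => k _; rewrite lift0 exprSr mulrA mulfK //.
under eq_fun do rewrite E.
by apply: cvgM; [apply: cvgB => //; exact: cvg_cst|exact: cvg_cst].
Qed.

Lemma enorm_UsinU th x : Omega th ->
  enorm (mxapp (UsinU th) x) ^+ 2 = ssin (enorm th) ^+ 2 * x1 x ^+ 2
    + enorm (xstar x) ^+ 2 + (ssin (enorm th) ^+ 2 - 1) * dot (xstar x) (unitv th) ^+ 2.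
Proof.
move=> om; rewrite UsinUE //; set k := (_ / _).
have -> : mxapp (1 + k *: Bmat th) x = x + k *: (x *m Bmat th).
  rewrite /mxapp raddfD /= trmx1 linearZ /= trmx_Bmat mulmxDr mulmx1 -scalemxAr //.
have X : x1 (x + k *: (x *m Bmat th)) = (1 + k * dot th th) * x1 x.
  rewrite [LHS]mxE [X in _ + X]mxE -/(x1 _) -/(x1 _) x1_mul_Bmat; ring.
have S : xstar (x + k *: (x *m Bmat th)) = xstar x + (k * dot th (xstar x)) *: th.
  apply/rowP => i; have := congr1 (fun z : 'rV_n => z 0 i) (xstar_mul_Bmat x th).
  by rewrite !mxE => ->; rewrite mulrA.
rewrite enorm_sqr dotS X S !(dotDl, dotDr, dotZl, dotZr) enorm_sqr dot_unitvE.
rewrite (dotC (xstar x) th); have [th0|th0] := eqVneq th 0.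
  by rewrite /k th0 enorm0 /ssin eqxx !dot0l; ring.
have q0 : dot th th != 0 by rewrite dot_eq0.
have e0 : enorm th != 0 by rewrite enorm_eq0.
rewrite exprMn exprVn enorm_sqr /k; field.
by [].
Qed.

End MatrixFormula.

(** * The equation expressing t through theta, and the vertical points *)

Section CriticalEquation.
Variables (R : realType) (n : nat).
Implicit Types (g : pt R n) (th tau v : 'rV[R]_n).

Lemma der_Gfun g tau v : Omega tau ->
  is_derive tau v (Gfun (xof g)) (dmassP g tau v).
Proof.
move=> om; apply: is_derive_near (der_massP g v om).
apply: filterS (Omega_near om) => s oms; have h : 0 <= enorm s < pi by rewrite enorm_ge0.
by rewrite /Gfun fK_Psi // psiK_Psi // enorm_sqr /mass; ring.
Qed.

Lemma crit_GfunP g th : crit g th <-> Omega th /\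
  forall j, tof g 0 j = 4^-1 * 'D_(evec R j) (Gfun (xof g)) th.
Proof.
have D (om : Omega th) j : 'D_(evec R j) (Gfun (xof g)) th = (gradP g th) 0 j.
  by have [_ ->] := der_Gfun g (evec R j) om; rewrite dmassPE dot_evec.
split=> [/critP[om E]|[om E]].
  by split=> // j; rewrite D // -E [X in _ = _ * X]mxE mulrA mulVf ?mul1r.
apply/critP; split=> //; apply/rowP => j.
by rewrite [LHS]mxE E D // mulrA mulfV ?mul1r.
Qed.

Lemma derive1_fK (s : R) : 0 < s < pi ->
  derive1 (@fK R) s = 2 * s * (Psi 0 (s ^+ 2) + s ^+ 2 * Psi 1 (s ^+ 2)).
Proof.
move=> /andP[s0 spi]; rewrite derive1E.
have s2 : `|s ^+ 2| < pi ^+ 2.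
  by rewrite ger0_norm ?sqr_ge0 // ltr_pXn2r ?nnegrE ?pi_ge0 // ltW.
have d2 := derX 1 (is_derive_id s (1 : R)).
have dP := der_comp (f := fun u : R => u ^+ 2) (x := s) (Psi_derive 0 s2) d2.
have N : \forall u \near s, u ^+ 2 * Psi 0 (u ^+ 2) = fK u.
  have : s \in `](- pi), pi[ by rewrite in_itv /= spi (lt_trans _ s0) // oppr_lt0 pi_gt0.
  move=> /near_in_itvoo; apply: filterS => u; rewrite in_itv /= -ltr_norml => h.
  by rewrite fK_Psi_norm.
by have [_ ->] := is_derive_near N (derM d2 dP); rewrite !expr1; ring.
Qed.

Lemma derive1_psiK (s : R) : 0 < s < pi ->
  derive1 (@psiK R) s = 2 * s * Psi 1 (s ^+ 2).
Proof.
move=> /andP[s0 spi]; rewrite derive1E.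
have s2 : `|s ^+ 2| < pi ^+ 2.
  by rewrite ger0_norm ?sqr_ge0 // ltr_pXn2r ?nnegrE ?pi_ge0 // ltW.
have d2 := derX 1 (is_derive_id s (1 : R)).
have dP := der_comp (f := fun u : R => u ^+ 2) (x := s) (Psi_derive 0 s2) d2.
have N : \forall u \near s, Psi 0 (u ^+ 2) = psiK u.
  have : s \in `]0, pi[ by rewrite in_itv /= s0.
  move=> /near_in_itvoo; apply: filterS => u; rewrite in_itv /= => /andP[u0 up].
  by rewrite psiK_Psi // (ltW u0).
by have [_ ->] := is_derive_near N dP; rewrite !expr1; ring.
Qed.

Lemma crit_tof g th : crit g th -> th != 0 -> let xs := xstar (xof g) in
  tof g = 4^-1 *: ((derive1 (@fK R) (enorm th) / enorm th * x1 (xof g) ^+ 2) *: th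
            + (derive1 (@psiK R) (enorm th) / enorm th * dot th xs ^+ 2) *: th
            + (2 * psiK (enorm th) * dot th xs) *: xs).
Proof.
move=> /critP[om E] th0 /=; have s0 : 0 < enorm th by rewrite enorm_gt0.
have spi : 0 < enorm th < pi by rewrite s0.
have h : 0 <= enorm th < pi by rewrite ltW.
rewrite derive1_fK // derive1_psiK // psiK_Psi // !enorm_sqr.
have -> : tof g = 4^-1 *: gradP g th by rewrite -E scalerA mulVf ?scale1r.
congr (_ *: _); rewrite /gradP /mass; set xs := xstar _; set q := dot th th.
set a := dot th xs; rewrite -scalerDl scalerDr !scalerA.
by congr (_ *: _ + _ *: _); [field; rewrite gt_eqF|ring].
Qed.

Lemma ccdist_vertical (t : 'rV[R]_n) :
  ccdist (row_mx 0 t : pt R n) ^+ 2 = 4 * pi * enorm t.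
Proof.
set g : pt R n := row_mx 0 t.
have xg : xof g = 0 by rewrite /xof row_mxKl.
have tg : tof g = t by rewrite /tof row_mxKr.
have xs0 : xstar (xof g) = 0 by rewrite xg; apply/rowP => i; rewrite !mxE.
have eg : explicit_set g.
  apply/explicit_setP => /=; rewrite xs0 !dot0l !expr0n mulr0 mul0r lexx.
  by split=> //; rewrite xg /x1 mxE.
have [_ -> _] := cut_ccdist eg.
by rewrite xg dot0l add0r /tnor xs0 tg /tperp unitv0 scaler0 subr0.
Qed.

End CriticalEquation.

Theorem theorem10p1 (R : realType) (n : nat) (hn : (2 <= n)%N) :
  (* (1) *)
  (forall g : pt R n,
     (ccdistE g * ccdistE g)%E = ereal_sup [set (phi g tau)%:E | tau in Omega (n:=n)])
  /\
  (* (2) *)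
  (@Cut R n = ~` @Mset R n /\ ~` @Mset R n = @explicit_set R n /\
   (forall t : 'rV[R]_n, ccdist (row_mx 0 t : pt R n) ^+ 2 = 4 * pi * enorm t) /\
   (forall g : pt R n, (~` @Mset R n) g -> xstar (xof g) != 0 ->
      let xs := xstar (xof g) in let t := tof g in
      ccdist g ^+ 2 = enorm xs ^+ 2 + 4 * pi * enorm (t - dot t (unitv xs) *: unitv xs)))
  /\
  (* (3) *)
  (forall g : pt R n, @Mset R n g ->
     let x := xof g in let t := tof g in let xs := xstar x in
     exists th : 'rV[R]_n,
       [/\ Omega th /\
           (forall j, derivable (Gfun x) th (evec R j) /\
                      t 0 j = 4^-1 * 'D_(evec R j) (Gfun x) th),
           (forall th' : 'rV[R]_n, Omega th' ->
              (forall j, t 0 j = 4^-1 * 'D_(evec R j) (Gfun x) th') -> th' = th),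
           (th != 0 ->
              t = 4^-1 *: ((derive1 (@fK R) (enorm th) / enorm th * x1 x ^+ 2) *: th
                          + (derive1 (@psiK R) (enorm th) / enorm th * dot th xs ^+ 2) *: th
                          + (2 * psiK (enorm th) * dot th xs) *: xs)),
           ccdist g ^+ 2 = phi g th &
           phi g th = ssin (enorm th) ^+ 2 * x1 x ^+ 2 + enorm xs ^+ 2
                      + (ssin (enorm th) ^+ 2 - 1) * dot xs (unitv th) ^+ 2
           /\ phi g th = enorm (mxapp (UsinU th) x) ^+ 2]).
Proof.
have expl (g : pt R n) : explicit_set g \/ exists2 th, crit g th &
    x1 (xof g) != 0 \/ dot th (xstar (xof g)) != 0.
  by have [e|ne] := pselect (explicit_set g); [left|right; exact: exists_crit].
have MC : ~` @Mset R n = @explicit_set R n.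
  by apply/seteqP; split=> g; [move/(Mset_explicit g hn).1|move/(Mset_explicit g hn).2].
split.
  by move=> g; have [/cut_ccdist[]|[th /crit_ccdist[]]] := expl g.
split.
  split.
    apply/seteqP; split=> g ng Mg; last by move: Mg; apply: cut_not_smooth => //; rewrite -MC.
    by apply: ng; exact: Mset_smooth.
  split=> //; split; first exact: ccdist_vertical.
  move=> g nM xs0; cbv zeta; move: nM; rewrite MC => /[dup] -[x0 _] /cut_ccdist[_ -> _].
  by rewrite (dot_xof x0) enorm_sqr.
move=> g Mg; cbv zeta; have [ct Hxa] := thetaP hn Mg.
have [_ dE _] := crit_ccdist ct; exists (theta g); split.
- split; first exact: ct.1.
  move=> j; split; last exact: ((crit_GfunP g _).1 ct).2.
  by have [] := der_Gfun g (evec R j) ct.1.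
- move=> th' om' E; apply: (crit_unique ct _ Hxa); exact/crit_GfunP.
- by move=> th0; exact: crit_tof.
- exact: dE.
- rewrite enorm_UsinU ?crit_phi_ssin //; exact: ct.1.
Qed.
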